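(* The fractional $(B,S)$-market model admits strong arbitrage: there exist a self-financing portfolio $\Pi$ and a constant $c>0$ such that $V^\Pi_0=0$ and $V^\Pi_1\ge c$ almost surely.
   Context: Let $B^H=\{B^H_t,t\in[0,1]\}$ be a fractional Brownian motion with Hurst parameter $H\in(1/2,1)$ on a complete probability space $(\Omega,\mathcal F,\mathsf P)$, i.e. a centered Gaussian process with continuous paths and $\mathsf E[B^H_tB^H_s]=\frac12(s^{2H}+t^{2H}-|s-t|^{2H})$. The fractional $(B,S)$-market on $[0,1]$ consists of a bond $B_t=\exp\{\int_0^t r_s\,ds\}$ and a stock $S_t=S_0\exp\{\mu t+\sigma B^H_t\}$, where $S_0>0$, $\mu\in\mathbb R$, $\sigma\ne0$ are constants and the interest rate $r$ is a (possibly random) process bounded in absolute value by a non-random constant. In differential form, $dB_t=r_tB_t\,dt$, $dS_t=\mu S_t\,dt+\sigma S_t\,dB^H_t$. The filtration $\mathbb F=\{\mathcal F_t\}$ is the ($\mathsf P$-completed) one generated by $B$ and $S$: $\mathcal F_t=\sigma\{B_u,S_u,u\le t\}=\sigma\{B_u,B^H_u,u\le t\}$; it is left-continuous. For $\alpha>0$, $t\in(0,1]$ put $\|f\|_{\alpha,t}=\int_0^t\left(\frac{|f(s)|}{s^\alpha}+\int_0^s\frac{|f(s)-f(z)|}{(s-z)^{1+\alpha}}dz\right)ds$. Integrals with respect to $B^H$ are pathwise generalized Lebesgue--Stieltjes integrals: $\int_0^tf_s\,dB^H_s$ is well defined if $\|f\|_{\alpha,t}<\infty$ a.s. for some $\alpha\in(1-H,1/2)$,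 and then $$\int_0^t f_s\,dB^H_s=\frac{1}{\Gamma(1-\alpha)\Gamma(\alpha)}\int_0^t\left(\frac{f(x)}{x^\alpha}+\alpha\int_0^x\frac{f(x)-f(u)}{(x-u)^{1+\alpha}}du\right)\left(\frac{B^H_t-B^H_x}{(t-x)^{1-\alpha}}+(1-\alpha)\int_x^t\frac{B^H_u-B^H_x}{(u-x)^{2-\alpha}}du\right)dx$$ (a value not depending on the choice of such $\alpha$). A portfolio is an $\mathbb F$-predictable process $\Pi=(\pi^0_t,\pi^1_t)_{t\in[0,1]}$ ($\pi^0$: number of bonds, $\pi^1$: number of shares), with value $V^\Pi_t=\pi^0_tB_t+\pi^1_tS_t$. It is self-financing if for all $t\in[0,1]$ $$V^\Pi_t=V^\Pi_0+\int_0^t\big(\pi^0_ur_uB_u+\pi^1_u\mu S_u\big)du+\int_0^t\sigma\pi^1_uS_u\,dB^H_u,$$ where the integrals are required to be well defined as Lebesgue and generalized Lebesgue--Stieltjes integrals respectively. *)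

(* Defs.v *)
(* A process on the time interval [0, 1] is a function
   R -> T -> R (time, then outcome); only its values at times in [0, 1] matter. *)
From HB Require Import structures.
From mathcomp Require Import all_boot all_order all_algebra.
From mathcomp Require Import all_classical all_reals all_analysis.

Set Implicit Arguments.
Unset Strict Implicit.
Unset Printing Implicit Defensive.

Import Order.TTheory GRing.Theory Num.Theory.
Import numFieldNormedType.Exports.

Local Open Scope classical_set_scope.
Local Open Scope ring_scope.

Local Notation leb := (@lebesgue_measure _).

Section gaussian.
Context {d : measure_display} {T : measurableType d} {R : realType}.
Implicit Types (P : probability T R) (X : R -> T -> R).

(* [normal_prob m 0] is not the point mass at [m] but a junk value. *)
Definition gaussian_law (m s : R) (A : set R) : \bar R :=
  if s == 0 then \d_m A else normal_prob m s A.

Definition is_gaussian P (Y : T -> R) : Prop :=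
  exists m s : R, forall A : set R, measurable A ->
    P (Y @^-1` A) = gaussian_law m s A.

Definition gaussian_process P X : Prop :=
  forall (n : nat) (t a : 'I_n -> R), (forall i, 0 <= t i <= 1) ->
    is_gaussian P (fun w => \sum_(i < n) a i * X (t i) w).

Record fractional_brownian_motion (H : R) P X : Prop := {
  fbm_measurable : forall t : R, 0 <= t <= 1 -> measurable_fun setT (X t) ;
  fbm_gaussian : gaussian_process P X ;
  fbm_centered : forall t : R, 0 <= t <= 1 -> 'E_P[X t]%E = 0%E ;
  fbm_covariance : forall t s : R, 0 <= t <= 1 -> 0 <= s <= 1 ->
    'E_P[fun w => (X t w * X s w)%R]%E =
    (2^-1 * (s `^ (2 * H) + t `^ (2 * H) - `|s - t| `^ (2 * H)))%:E ;
  fbm_continuous : forall w, {within `[0, 1], continuous (X ^~ w)} }.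

End gaussian.

Section generalized_lebesgue_stieltjes.
Context {R : realType}.
Implicit Types (alpha t : R) (f g : R -> R).

Definition Gamma (x : R) : R :=
  \int[leb]_(u in `]0, +oo[) (u `^ (x - 1) * expR (- u)).

Definition gls_norm alpha t f : \bar R :=
  (\int[leb]_(s in `]0%R, t[)
     ((`|f s| / s `^ alpha)%:E +
      \int[leb]_(z in `]0%R, s[) (`|f s - f z| / (s - z) `^ (1 + alpha))%:E))%E.

(* The library's integral of a non-measurable function is a junk value,
   hence the explicit measurability condition. *)
Definition gls_integrable alpha t f : Prop :=
  measurable_fun `[0, t] f /\ (gls_norm alpha t f < +oo)%E.

(* Weyl form of \int_0^t f dg, meaningful when [gls_integrable alpha t f] and
   [g] is Hoelder continuous of some order > 1 - alpha: then the integral in [u]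
   over ]0, x[ is finite for almost every [x], the one over ]x, t[ for every
   [x], and the outer integrand is integrable. *)
Definition gls_integral alpha t f g : R :=
  (Gamma (1 - alpha) * Gamma alpha)^-1 *
  \int[leb]_(x in `]0, t[)
    ((f x / x `^ alpha +
      alpha * \int[leb]_(u in `]0, x[) ((f x - f u) / (x - u) `^ (1 + alpha))) *
     ((g t - g x) / (t - x) `^ (1 - alpha) +
      (1 - alpha) *
        \int[leb]_(u in `]x, t[) ((g u - g x) / (u - x) `^ (2 - alpha)))).

End generalized_lebesgue_stieltjes.

Section market.
Context {d : measure_display} {T : measurableType d} {R : realType}.
Implicit Types (P : probability T R) (X r : R -> T -> R).

Definition time_outcome : set (R * T) := `[0%R, 1%R]%classic `*` [set: T].

Definition measurable_process X : Prop :=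
  measurable_fun time_outcome (fun p : R * T => X p.1 p.2).

Definition bond r (t : R) (w : T) : R :=
  expR (\int[leb]_(s in `[0, t]) r s w).

Definition stock (S0 mu sigma : R) (BH : R -> T -> R) (t : R) (w : T) : R :=
  S0 * expR (mu * t + sigma * BH t w).

Definition completed_filtration P (B S : R -> T -> R) (t : R) : set (set T) :=
  <<s [set A | exists (u : R) (V : set R), [/\ 0 <= u <= t, measurable V &
                 A = B u @^-1` V \/ A = S u @^-1` V]]
      `|` P.-negligible >>.

Definition predictable_rectangle (F : R -> set (set T)) : set (set (R * T)) :=
  [set C | (exists2 A, F 0 A & C = [set 0] `*` A) \/
           (exists (s t : R) A, [/\ 0 <= s, s < t, t <= 1, F s A &
              C = `]s, t]%classic `*` A])].

Definition predictable (F : R -> set (set T)) X : Prop :=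
  preimage_set_system time_outcome (fun p : R * T => X p.1 p.2) measurable `<=`
  <<s time_outcome, predictable_rectangle F >>.

Definition portfolio_value (B S pi0 pi1 : R -> T -> R) (t : R) (w : T) : R :=
  pi0 t w * B t w + pi1 t w * S t w.

(* One [alpha] serves all times [t], as [gls_norm alpha t f] is nondecreasing
   in [t]; the value of the integral does not depend on [alpha]. *)
Definition self_financing P (H S0 mu sigma : R) (BH r pi0 pi1 : R -> T -> R) :
    Prop :=
  let B := bond r in
  let S := stock S0 mu sigma BH in
  let V := portfolio_value B S pi0 pi1 in
  exists2 alpha : R, 1 - H < alpha < 2^-1 &
  {ae P, forall w, forall t : R, 0 <= t <= 1 ->
    let f := fun u : R => pi0 u w * r u w * B u w + pi1 u w * mu * S u w in
    let h := fun u : R => sigma * pi1 u w * S u w in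
    [/\ leb.-integrable `[0, t] (EFin \o f),
        gls_integrable alpha t h &
        V t w = V 0 w + \int[leb]_(u in `[0, t]) f u
                + gls_integral alpha t h (BH ^~ w)]}.

End market.

(* Main.v *)
(** Let [J_t = mu t + sigma B^H_t - int_0^t r] be the discounted log-price.  Holding [xi B / S]
    shares makes the discounted value [D = V / B] satisfy [dD = xi dJ]: since [H > 1/2] the
    calculus is pathwise, without Ito correction.  Only step strategies
    [xi = sum_k c_k 1_(]s_k, s_k+1])] are used.  For these the generalized Lebesgue-Stieltjes
    integral of [xi B] is computed from Marchaud derivatives and Fubini's theorem; all that is
    asked of the paths is that a singular double integral be finite, which holds almost surely
    because [E |B^H_u - B^H_x| <= |u - x|^H].

    On a block [[t_n, t_n+1]] of length [2^-(n+1)], cut into small pieces, the strategy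
    [xi = 2 w (J_(s_i) - J_(t_n))] gains [w ((Delta J)^2 - sum_i (Delta_i J)^2)].  The sum of
    squares is negligible for fine meshes because [H > 1/2], and [|Delta J|] is at least of the
    order of the length of the block with probability close to 1: the increments of [B^H]
    are of the larger order [2^-(n H)] and have a Gaussian density, whereas the drift, whose
    rate is bounded, is only of the order of the length.  With a suitable weight [w] a block thus gains
    at least 1 with probability tending to 1, so almost surely some block does.  Scaling the
    strategy on each block by the missing wealth [max(0, 1 - D)] yields [D >= 1] from the first
    successful block on, after which nothing is traded; hence [V_1 >= exp(- K)] where [K]
    bounds [|r|]. *)
From HB Require Import structures.
Require Import Defs.
From mathcomp Require Import all_boot all_order all_algebra.
From mathcomp Require Import all_classical all_reals all_analysis.
From mathcomp Require Import measurable_realfun ring lra.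

Set Implicit Arguments.
Unset Strict Implicit.
Unset Printing Implicit Defensive.

Import Order.TTheory GRing.Theory Num.Theory.
Import numFieldNormedType.Exports.

Local Open Scope classical_set_scope.
Local Open Scope ring_scope.

Local Notation leb := (@lebesgue_measure _).

(** * Integrals over real intervals *)

(** The portfolio must be defined on every path before it is known which block succeeds, and its
    integrals must exist up to time 1, where the blocks accumulate. The stopping rule settles both:
    along almost every path the strategy is a finite list of jumps, so only finite lists are
    integrated, path by path, and the portfolio is the upper limit of the partial strategies, which
    is predictable and almost surely that of an eventually constant sequence. The jump times lie on
    deterministic grids; hence the singular double integral is controlled at countably many times,
    outside one null set. The integral rests on one identity: the right Marchaud derivative of the
    path, integrated against (x - a)^(- al), the left derivative of a unit jump at a, is B(1 - al,
    al) times the increment of the path from a to t. Multiplying the jump by the Lipschitz function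
    exp(int r) turns it into a superposition of jumps, to which Fubini's theorem applies. All blocks
    fail with at most the probability that a given one does, and for the n-th block this is of order
    2^(- n (1 - H)). *)

Lemma leb_ae_imply (R : realType) (P Q : R -> Prop) :
  {ae leb, forall x : R, P x} -> (forall x, P x -> Q x) -> {ae leb, forall x : R, Q x}.
Proof.
move=> [N [mN N0 subN]] PQ; exists N; split => // x /= hx.
by apply: subN => /= /PQ.
Qed.

Section integrable_real.
Context d (T : measurableType d) (R : realType) (mu : {measure set T -> \bar R}).
Implicit Types (D : set T) (f h : T -> R).

Lemma integrable_mulrl D f (k : R) : measurable D ->
  mu.-integrable D (fun x => (f x)%:E) ->
  mu.-integrable D (fun x => (k * f x)%:E).
Proof.
move=> mD fi; have := integrableZl mD k fi.
by apply: eq_integrable => // x _; rewrite EFinM.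
Qed.

Lemma integrable_addr D f h : measurable D ->
  mu.-integrable D (fun x => (f x)%:E) -> mu.-integrable D (fun x => (h x)%:E) ->
  mu.-integrable D (fun x => (f x + h x)%:E).
Proof.
move=> mD fi hi; have := integrableD mD fi hi.
by apply: eq_integrable => // x _; rewrite EFinD.
Qed.

Lemma integrable_dom D f h : measurable D -> measurable_fun D f ->
  (forall x, D x -> `|f x| <= h x) ->
  mu.-integrable D (fun x => (h x)%:E) -> mu.-integrable D (fun x => (f x)%:E).
Proof.
move=> mD mf fh; apply: le_integrable => //; first exact/measurable_EFinP.
by move=> x Dx; rewrite lee_fin (le_trans (fh x Dx)) // ler_norm.
Qed.

Lemma integrable_ge0 D f : measurable D -> measurable_fun D f -> (forall x, D x -> 0 <= f x) ->
  (\int[mu]_(x in D) (f x)%:E < +oo)%E -> mu.-integrable D (fun x => (f x)%:E).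
Proof.
move=> mD mf f0 foo; apply/integrableP; split; first exact/measurable_EFinP.
rewrite (eq_integral (fun x => (f x)%:E)) // => x; rewrite inE => Dx.
by rewrite gee0_abs // lee_fin f0.
Qed.

End integrable_real.

(* The Lebesgue measure lives on an alias of [R] as a measurable type; the
   following instances spare unification problems. *)
Section lebesgue_integrable.
Context {R : realType}.
Implicit Types (D : set R) (f h : R -> R).

Lemma lebi_mulrl D f (k : R) : measurable D ->
  leb.-integrable D (fun x : R => (f x)%:E) ->
  leb.-integrable D (fun x : R => (k * f x)%:E).
Proof. by move=> mD fi; apply: integrable_mulrl. Qed.

Lemma lebiD D f h : measurable D ->
  leb.-integrable D (fun x : R => (f x)%:E) -> leb.-integrable D (fun x : R => (h x)%:E) ->
  leb.-integrable D (fun x : R => (f x + h x)%:E).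
Proof. by move=> mD fi hi; apply: integrable_addr. Qed.

Lemma lebi_dom D f h : measurable D -> measurable_fun D f ->
  (forall x, D x -> `|f x| <= h x) ->
  leb.-integrable D (fun x : R => (h x)%:E) -> leb.-integrable D (fun x : R => (f x)%:E).
Proof. by move=> mD mf fh; apply: integrable_dom. Qed.

Lemma lebi_ge0 D f : measurable D -> measurable_fun D f -> (forall x, D x -> 0 <= f x) ->
  (\int[leb]_(x in D) (f x)%:E < +oo)%E -> leb.-integrable D (fun x : R => (f x)%:E).
Proof. by move=> mD mf f0 foo; apply: integrable_ge0. Qed.

Lemma leb_le_normr_Rintegral D f : measurable D ->
  leb.-integrable D (fun x : R => (f x)%:E) ->
  `|\int[leb]_(x in D) f x| <= \int[leb]_(x in D) `|f x|.
Proof. by move=> mD fi; apply: le_normr_Rintegral. Qed.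

Lemma leb_dominated_convergence D (f_ : nat -> R -> R) f h : measurable D ->
  (forall n, measurable_fun D (f_ n)) -> measurable_fun D f ->
  {ae leb, forall x : R, D x -> f_ n x @[n --> \oo] --> f x} ->
  leb.-integrable D (fun x : R => (h x)%:E) ->
  {ae leb, forall x : R, D x -> forall n, `|f_ n x| <= h x} ->
  leb.-integrable D (fun x : R => (f x)%:E) /\
  \int[leb]_(x in D) f_ n x @[n --> \oo] --> \int[leb]_(x in D) f x.
Proof.
move=> mD mf_ mf cf hi fh.
have [|||||i1 _ c1] := @dominated_convergence _ _ _ leb D mD
  (fun n (x : R) => (f_ n x)%:E) (fun x : R => (f x)%:E) (fun x : R => (h x)%:E).
- by move=> n; apply/measurable_EFinP; exact: mf_.
- exact/measurable_EFinP.
- apply: (leb_ae_imply cf) => x h1 /h1 h2; apply: cvg_EFin => //; exact: nearW.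
- exact: hi.
- by apply: (leb_ae_imply fh) => x h1 n Dx; rewrite lee_fin; apply: h1.
split=> //; apply: fine_cvg; rewrite fineK //.
exact: integrable_fin_num.
Qed.

End lebesgue_integrable.

Lemma powR_nincr {R : realType} (p x y : R) : p <= 0 -> 0 < x -> x <= y ->
  y `^ p <= x `^ p.
Proof.
move=> p0 x0 xy; have y0 := lt_le_trans x0 xy.
rewrite -[p]opprK 2!(powRN _ (- p)) lef_pV2 ?posrE ?powR_gt0 //.
by rewrite ge0_ler_powR ?nnegrE ?oppr_ge0 // ltW.
Qed.

Section misc.
Context d1 d2 (T1 : measurableType d1) (T2 : measurableType d2) (R : realType).
Variables (m1 : {sigma_finite_measure set T1 -> \bar R})
  (m2 : {sigma_finite_measure set T2 -> \bar R}).

Lemma fubini_tonelli_setX (A : set T1) (B : set T2) (F : T1 * T2 -> \bar R) :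
  measurable A -> measurable B -> measurable_fun (A `*` B) F ->
  (forall z, (A `*` B) z -> 0 <= F z)%E ->
  (\int[m1]_(x in A) \int[m2]_(y in B) F (x, y) =
   \int[m2]_(y in B) \int[m1]_(x in A) F (x, y))%E.
Proof.
move=> mA mB mF F0; rewrite integral_mkcond [RHS]integral_mkcond.
transitivity (\int[m1]_x \int[m2]_y (F \_ (A `*` B)) (x, y))%E.
  apply: eq_integral => x _; rewrite patchE; case: ifPn => xA.
    rewrite [LHS]integral_mkcond; apply: eq_integral => y _.
    by rewrite !patchE in_setX xA.
  by rewrite integral0_eq // => y _; rewrite patchE in_setX (negbTE xA).
rewrite fubini_tonelli.
- apply: eq_integral => y _; rewrite patchE; case: ifPn => yB.
    rewrite [RHS]integral_mkcond; apply: eq_integral => x _.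
    by rewrite !patchE in_setX yB andbT.
  by rewrite integral0_eq // => x _; rewrite patchE in_setX (negbTE yB) andbF.
- have mAB := measurableX mA mB.
  exact: ((measurable_restrictT F mAB).1 mF).
- exact: erestrict_ge0.
Qed.

Lemma measurable_powR_comp (D : set T1) (f : T1 -> R) p : measurable_fun D f ->
  measurable_fun D (fun x => f x `^ p).
Proof. by move=> mf; exact: (measurableT_comp (@measurable_powR R p) mf). Qed.

Lemma measurable_expR_comp (D : set T1) (f : T1 -> R) : measurable_fun D f ->
  measurable_fun D (fun x => expR (f x)).
Proof. by move=> mf; exact: (measurableT_comp (@measurable_expR R) mf). Qed.

Lemma powRDp (x r s : R) : 0 < x -> x `^ (r + s) = x `^ r * x `^ s.
Proof. by move=> x0; rewrite powRD // (gt_eqF x0) implybT. Qed.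

End misc.

Lemma bounded_integrable (R : realType) (D : set R) (f : R -> R) (M a b : R) :
  measurable D -> D `<=` `[a, b]%classic -> measurable_fun D f ->
  (forall x, D x -> `|f x| <= M) -> leb.-integrable D (EFin \o f).
Proof.
move=> mD Dab mf fM; apply: measurable_bounded_integrable => //.
  apply: (@le_lt_trans _ _ (leb `[a, b]%classic)).
    by apply: le_measure; rewrite ?inE.
  by rewrite lebesgue_measure_itv /=; case: ifP => _; rewrite -?EFinB ltry.
exists M; split; first exact: num_real.
by move=> N MN x Dx; apply: le_trans (fM x Dx) (ltW MN).
Qed.

(** * Tonelli's and Fubini's theorems on the triangle a < x < u < b *)

Section triangle.
Context {R : realType}.
Implicit Types (a b : R) (F : R * R -> \bar R).

Definition triangle a b : set (R * R) := [set p | (a < p.1) && (p.1 < p.2) && (p.2 < b)].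

Lemma measurable_triangle a b : measurable (triangle a b).
Proof.
have mb (f : R * R -> bool) : measurable_fun setT f -> measurable [set p | f p].
  by move=> mf; rewrite -[X in measurable X]setTI; apply: mf.
apply: mb; apply: measurable_and; first apply: measurable_and.
- exact: measurable_fun_ltr.
- exact: measurable_fun_ltr.
- exact: measurable_fun_ltr.
Qed.

Let triangleE1 a b F x : (fun u => (F \_ (triangle a b)) (x, u)) =
  if a < x then (fun u => F (x, u)) \_ `]x, b[ else cst 0%E.
Proof.
apply/funext => u; rewrite patchE; have [ax|ax] := boolP (a < x).
  rewrite patchE; suff -> : ((x, u) \in triangle a b) = (u \in `]x, b[%classic) by [].
  by apply/idP/idP; rewrite !inE /triangle /= in_itv /= ax.
by case: ifPn => //; rewrite inE /triangle /= (negbTE ax).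
Qed.

Let triangleE2 a b F u : (fun x => (F \_ (triangle a b)) (x, u)) =
  if u < b then (fun x => F (x, u)) \_ `]a, u[ else cst 0%E.
Proof.
apply/funext => x; rewrite patchE; have [ax|ax] := boolP (u < b).
  rewrite patchE; suff -> : ((x, u) \in triangle a b) = (x \in `]a, u[%classic) by [].
  by apply/idP/idP; rewrite !inE /triangle /= in_itv /= ax ?andbT.
by case: ifPn => //; rewrite inE /triangle /= (negbTE ax) ?andbF.
Qed.

Let int1 a b F : (fun x => \int[leb]_u (F \_ (triangle a b)) (x, u))%E =
  (fun x => \int[leb]_(u in `]x, b[) F (x, u))%E \_ `]a, b[.
Proof.
apply/funext => x; rewrite [LHS](_ : _ =
    \int[leb]_u ((fun u => (F \_ (triangle a b)) (x, u)) u))%E //.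
rewrite triangleE1 patchE; have [ax|ax] := boolP (a < x).
  rewrite -integral_mkcond; case: ifPn => //; rewrite notin_setE /= in_itv /= ax /=.
  by move=> /negP; rewrite -leNgt => bx; rewrite set_itv_ge ?integral_set0 // bnd_simp -leNgt.
by rewrite integral0; case: ifPn => //; rewrite inE /= in_itv /= (negbTE ax).
Qed.

Let int2 a b F : (fun u => \int[leb]_x (F \_ (triangle a b)) (x, u))%E =
  (fun u => \int[leb]_(x in `]a, u[) F (x, u))%E \_ `]a, b[.
Proof.
apply/funext => u; rewrite [LHS](_ : _ =
    \int[leb]_x ((fun x => (F \_ (triangle a b)) (x, u)) x))%E //.
rewrite triangleE2 patchE; have [ub|ub] := boolP (u < b).
  rewrite -integral_mkcond; case: ifPn => //; rewrite notin_setE /= in_itv /= ub andbT.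
  by move=> /negP; rewrite -leNgt => bx; rewrite set_itv_ge ?integral_set0 // bnd_simp -leNgt.
by rewrite integral0; case: ifPn => //; rewrite inE /= in_itv /= (negbTE ub) andbF.
Qed.

Let mpatch a b F : measurable_fun setT F ->
  measurable_fun setT (F \_ (triangle a b)).
Proof.
by move=> mF; apply/(measurable_restrictT _ _).1 => //;
  [exact: measurable_triangle|exact: measurable_funTS].
Qed.

(** Extended by zero outside the triangle, [F] is integrated over the whole plane; [int1] and [int2]
    identify the two iterated integrals with those over the slices of the triangle. *)
Lemma triangle_tonelli a b F : measurable_fun setT F -> (forall p, 0 <= F p)%E ->
  (\int[leb]_(x in `]a, b[) \int[leb]_(u in `]x, b[) F (x, u) =
   \int[leb]_(u in `]a, b[) \int[leb]_(x in `]a, u[) F (x, u))%E.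
Proof.
move=> mF F0; rewrite integral_mkcond [RHS]integral_mkcond -int1 -int2.
apply: (@fubini_tonelli _ _ _ _ _ leb leb (F \_ (triangle a b))); first exact: mpatch.
by move=> p; apply: erestrict_ge0.
Qed.

Lemma triangle_iterated a b F :
  (\int[leb]_x \int[leb]_u (F \_ (triangle a b)) (x, u) =
   \int[leb]_(x in `]a, b[) \int[leb]_(u in `]x, b[) F (x, u))%E.
Proof. by rewrite [RHS]integral_mkcond -int1. Qed.

Lemma measurable_triangle_tonelli1 a b F : measurable_fun setT F -> (forall p, 0 <= F p)%E ->
  measurable_fun `]a, b[ (fun x => \int[leb]_(u in `]x, b[) F (x, u))%E.
Proof.
move=> mF F0; apply/(measurable_restrictT _ _).2 => //; rewrite -int1.
apply: (@measurable_fun_fubini_tonelli_F _ _ _ _ _ leb (F \_ (triangle a b))); first exact: mpatch.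
by move=> p; apply: erestrict_ge0.
Qed.

Lemma measurable_triangle_tonelli2 a b F : measurable_fun setT F -> (forall p, 0 <= F p)%E ->
  measurable_fun `]a, b[ (fun u => \int[leb]_(x in `]a, u[) F (x, u))%E.
Proof.
move=> mF F0; apply/(measurable_restrictT _ _).2 => //; rewrite -int2.
apply: (@measurable_fun_fubini_tonelli_G _ _ _ _ _ leb (F \_ (triangle a b))); first exact: mpatch.
by move=> p; apply: erestrict_ge0.
Qed.

Variables (a b : R) (f : R * R -> R).
Hypothesis mf : measurable_fun setT f.
Hypothesis fi :
  (\int[leb]_(x in `]a, b[) \int[leb]_(u in `]x, b[) `|f (x, u)|%:E < +oo)%E.

Let F := EFin \o f.

Let iF : (leb \x leb)%E.-integrable setT (F \_ (triangle a b)).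
Proof.
have mF : measurable_fun setT (F \_ (triangle a b)).
  by apply: mpatch; exact/measurable_EFinP.
apply/(@integrable12ltyP _ _ _ _ _ leb leb _ mF).
move: fi; rewrite integral_mkcond; congr (_ < _)%E; apply: eq_integral => x _.
rewrite -(int1 a b (fun p => `|f p|%:E)); apply: eq_integral => u _.
by rewrite !patchE; case: ifPn => //=; rewrite normr0.
Qed.

Lemma triangle_ae_integrable1 : {ae leb, forall x : R, x \in `]a, b[ ->
  leb.-integrable `]x, b[ (fun u => (f (x, u))%:E)}.
Proof.
have := ae_integrable1 iF; apply: filterS => x /= h; rewrite in_itv /= => /andP[ax xb].
apply/(integrable_mkcond _ _).2 => //; move: h; rewrite triangleE1 ax.
by [].
Qed.

Lemma triangle_ae_integrable2 : {ae leb, forall u : R, u \in `]a, b[ ->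
  leb.-integrable `]a, u[ (fun x => (f (x, u))%:E)}.
Proof.
have := ae_integrable2 iF; apply: filterS => x /= h; rewrite in_itv /= => /andP[ax xb].
apply/(integrable_mkcond _ _).2 => //; move: h; rewrite triangleE2 xb.
by [].
Qed.

(** Where the inner integral is infinite, [fine] returns 0. So the real-valued inner integral is
    bounded in absolute value by the extended one, which Fubini's theorem makes integrable. *)
Lemma triangle_integrable1 : leb.-integrable `]a, b[
  (fun x => (\int[leb]_(u in `]x, b[) f (x, u))%:E).
Proof.
have := integrable_fubini_F iF.
rewrite /fubini_F int1 => /(integrable_mkcond _ _).2 h.
have {}h := h (measurable_itv _).
have mh := measurable_int _ h.
apply/integrableP; split.
  by apply/measurable_EFinP; apply: measurableT_comp => //.
have /integrableP[_ hoo] := h; apply: (le_lt_trans _ hoo); apply: ge0_le_integral => //.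
- by apply: measurableT_comp => //; apply/measurable_EFinP; apply: measurableT_comp.
- exact/measurableT_comp.
- by move=> x _; rewrite /Rintegral /=; case: (integral _ _ _) => [s| |] //=; rewrite normr0 leey.
Qed.

Lemma triangle_integrable2 : leb.-integrable `]a, b[
  (fun u => (\int[leb]_(x in `]a, u[) f (x, u))%:E).
Proof.
have := measurable_fubini_G iF.
rewrite /fubini_G int2 => /(measurable_restrictT _ _).2 mh.
have {}mh := mh (measurable_itv _).
have mN : measurable_fun setT (fun p => `|f p|%:E).
  by apply/measurable_EFinP; apply: measurableT_comp.
apply/integrableP; split.
  by apply/measurable_EFinP; apply: measurableT_comp => //.
move: fi; rewrite (triangle_tonelli a b mN)// => hoo.
apply: (le_lt_trans _ hoo); apply: ge0_le_integral => //.
- by apply: measurableT_comp => //; apply/measurable_EFinP; apply: measurableT_comp.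
- have h0 p : (0 <= `|f p|%:E)%E by rewrite lee_fin.
  by have h := measurable_triangle_tonelli2 mN h0; exact: h.
- move=> x _; apply: (@le_trans _ _ (`|\int[leb]_(z in `]a, x[) (f (z, x))%:E|)%E).
    by rewrite /Rintegral /=; case: (integral _ _ _) => [s| |] //=; rewrite normr0 leey.
  by apply: le_abse_integral => //; apply/measurable_EFinP/measurable_funTS/measurableT_comp.
Qed.

Lemma triangle_fubini :
  \int[leb]_(x in `]a, b[) \int[leb]_(u in `]x, b[) f (x, u) =
  \int[leb]_(u in `]a, b[) \int[leb]_(x in `]a, u[) f (x, u).
Proof.
rewrite /Rintegral; congr fine.
transitivity (\int[leb]_x \int[leb]_u (F \_ (triangle a b)) (x, u))%E.
  rewrite [RHS](_ : _ = \int[leb]_x ((fun x => \int[leb]_u (F \_ (triangle a b)) (x, u)) x))%E //.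
  rewrite int1 -integral_mkcond; apply: ae_eq_integral => //.
  - by have /measurable_int := triangle_integrable1.
  - have := measurable_int _ (integrable_fubini_F iF).
    by rewrite /fubini_F int1 => /(measurable_restrictT _ _).2; apply.
  - have [N [mN N0 subN]] := triangle_ae_integrable1.
    exists N; split => // x /= hx; apply: subN => /= h; apply: hx => xab.
    by rewrite fineK //; apply: integrable_fin_num => //; apply: h; rewrite ?inE.
rewrite (Fubini iF).
rewrite [LHS](_ : _ = \int[leb]_u ((fun u => \int[leb]_x (F \_ (triangle a b)) (x, u)) u))%E //.
rewrite int2 -integral_mkcond; apply: ae_eq_integral => //.
- have := measurable_fubini_G iF.
  by rewrite /fubini_G int2 => /(measurable_restrictT _ _).2; apply.
- by have /measurable_int := triangle_integrable2.
- have [N [mN N0 subN]] := triangle_ae_integrable2.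
  exists N; split => // x /= hx; apply: subN => /= h; apply: hx => xab.
  by rewrite fineK //; apply: integrable_fin_num => //; apply: h; rewrite ?inE.
Qed.

End triangle.

(** * Improper integrals of powers *)

Section improper.
Context {R : realType}.
Implicit Types (a b c e al u p x : R) (f F : R -> R).

(** The antiderivative has one-sided limits at the ends, where [f] itself may be unbounded. The
    fundamental theorem is applied on closed subintervals increasing to []a, b[], and monotone
    convergence concludes. *)
Lemma ge0_FTC_open f F a b (la lb : R) : a < b ->
  (forall x, a < x < b -> 0 <= f x) ->
  (forall x, a < x < b -> {for x, continuous f}) ->
  (forall x, a < x < b -> is_derive x 1 F (f x)) ->
  F x @[x --> a^'+] --> la -> F x @[x --> b^'-] --> lb ->
  (\int[leb]_(x in `]a, b[) (f x)%:E = (lb - la)%:E)%E.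
Proof.
move=> ab f0 cf dF Fa Fb.
(* A denominator of at least 3 gives [2 e n < b - a], so every closed subinterval is
   nondegenerate. *)
pose e n := (b - a) / n.+3%:R.
have e0 n : 0 < e n by rewrite divr_gt0 ?subr_gt0.
have e2 n : e n * 2 < b - a.
  rewrite /e mulrAC ltr_pdivrMr // ltr_pM2l ?subr_gt0 // ltr_nat //.
have cvge : e n @[n --> \oo] --> 0.
  rewrite -(mulr0 (b - a)); apply: cvgMr.
  apply: (@cvg_trans _ ((fun n => n.+1%:R^-1 : R) (n + 2)%N @[n --> \oo])).
    by apply: near_eq_cvg; apply: nearW => n; rewrite addn2.
  by rewrite (cvg_shiftn 2 (fun n => n.+1%:R^-1 : R)); exact: cvg_harmonic.
pose An n : set R := `[a + e n, b - e n]%classic.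
have abn n x : x \in `[a + e n, b - e n] -> a < x < b.
  by rewrite in_itv /=; have := e0 n; move=> *; apply/andP; split; lra.
have mA n : measurable (An n) by exact: measurable_itv.
have UA : \bigcup_n An n = `]a, b[%classic.
  apply/seteqP; split=> [x [n _ /abn]|x]; first by rewrite /= in_itv.
  rewrite /= in_itv /= => /andP[ax xb].
  have : \forall n \near \oo, e n < Num.min (x - a) (b - x).
    apply: (cvgr_lt 0) => //; rewrite lt_min; lra.
  case=> N _ /(_ N (leqnn N)); rewrite lt_min => /andP[h1 h2].
  by exists N => //; rewrite /An /= in_itv /=; apply/andP; split; lra.
have nd : nondecreasing_seq An.
  move=> m n mn; rewrite subsetEset => x; rewrite /An /= !in_itv /= => /andP[h1 h2].
  have : e n <= e m by rewrite /e ler_pM2l ?subr_gt0 // lef_pV2 ?posrE // ler_nat.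
  by move=> *; apply/andP; split; lra.
have mf : measurable_fun `]a, b[ f.
  apply: open_continuous_measurable_fun => //.
  by move=> x; rewrite inE /= in_itv /=; apply: cf.
have subA n : An n `<=` `]a, b[%classic by move=> x /abn; rewrite /= in_itv.
have c1 : (\int[leb]_(x in An n) (f x)%:E @[n --> \oo] -->
   \int[leb]_(x in `]a, b[) (f x)%:E)%E.
  rewrite -UA; apply: ge0_nondecreasing_set_cvg_integral => //.
    by move=> n; apply: measurable_funS (_ : measurable_fun `]a, b[ _) => //; apply/measurable_EFinP.
  by move=> n x /abn; rewrite lee_fin; apply: f0.
have cn : forall n, (\int[leb]_(x in An n) (f x)%:E = (F (b - e n) - F (a + e n))%:E)%E.
  move=> n; rewrite (@continuous_FTC2 _ f F) ?EFinB //.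
  - by have := e2 n; lra.
  - apply: continuous_in_subspaceT => x; rewrite inE => /abn; apply: cf.
  - have h x : x \in `[a + e n, b - e n] -> {for x, continuous F}.
      move=> /abn /dF h; apply: differentiable_continuous; apply/derivable1_diffP.
      exact: ex_derive.
    split.
    + move=> x xx; have /dF h1 : a < x < b by apply: abn; apply: subset_itv_oo_cc xx.
      exact: ex_derive.
    + apply: cvg_at_right_filter; apply: h; rewrite in_itv /= lexx /=.
      by have := e2 n; lra.
    + apply: cvg_at_left_filter; apply: h; rewrite in_itv /= lexx andbT.
      by have := e2 n; lra.
  - move=> x xx; have /dF h1 : a < x < b by apply: abn; apply: subset_itv_oo_cc xx.
    by rewrite derive1E derive_val.
have c2 : ((F (b - e n) - F (a + e n))%:E @[n --> \oo] --> (lb - la)%:E)%E.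
  apply: cvg_EFin; first exact: nearW.
  apply: cvgB.
  - have /cvg_at_leftP := Fb; apply; split.
      by move=> n; have := e0 n; lra.
    rewrite -[X in _ --> X]subr0; apply: cvgB => //; exact: cvg_cst.
  - have /cvg_at_rightP := Fa; apply; split.
      by move=> n; have := e0 n; lra.
    rewrite -[X in _ --> X]addr0; apply: cvgD => //; exact: cvg_cst.
move: c1; under eq_cvg do rewrite cn; move=> c1.
exact: (cvg_unique _ c1 c2).
Qed.

Lemma is_derive_powR_subr a x p : a < x ->
  is_derive x 1 (fun y => (y - a) `^ p) (p * (x - a) `^ (p - 1)).
Proof.
move=> ax; have := @is_derive1_powR R p (x - a); rewrite subr_gt0 => /(_ ax) H.
have H2 : is_derive x (1 : R) (fun y => y - a) 1 by apply: is_derive_eq; rewrite subr0.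
by have := @is_derive1_comp R (fun y => y `^ p) (fun y => y - a) x _ _ H H2; rewrite mulr1.
Qed.

Lemma is_derive_powR_subl b x p : x < b ->
  is_derive x 1 (fun y => (b - y) `^ p) (- (p * (b - x) `^ (p - 1))).
Proof.
move=> xb; have := @is_derive1_powR R p (b - x); rewrite subr_gt0 => /(_ xb) H.
have H2 : is_derive x (1 : R) (fun y => b - y) (- 1).
  by apply: is_derive_eq; rewrite add0r mul1r.
by have := @is_derive1_comp R (fun y => y `^ p) (fun y => b - y) x _ _ H H2; rewrite mulrN1.
Qed.

Lemma is_derive_continuous F x (l : R) : is_derive x (1 : R) F l -> {for x, continuous F}.
Proof.
by move=> h; apply: differentiable_continuous; apply/derivable1_diffP; exact: ex_derive.
Qed.

Lemma cvg_powR_subr a p : 0 < p -> (x - a) `^ p @[x --> a^'+] --> (0 : R).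
Proof.
move=> p0; apply/cvg_at_rightP => u [ua uc].
have /cvg_at_rightP h := @powR_cvg0 R p p0.
apply: (h (fun n => u n - a)); split; first by move=> n; rewrite subr_gt0.
by rewrite -[X in _ --> X](subrr a); apply: cvgB => //; exact: cvg_cst.
Qed.

Lemma cvg_powR_subl b p : 0 < p -> (b - x) `^ p @[x --> b^'-] --> (0 : R).
Proof.
move=> p0; apply/cvg_at_leftP => u [ua uc].
have /cvg_at_rightP h := @powR_cvg0 R p p0.
apply: (h (fun n => b - u n)); split; first by move=> n; rewrite subr_gt0.
by rewrite -[X in _ --> X](subrr b); apply: cvgB => //; exact: cvg_cst.
Qed.

Lemma integral_powR_subr a b p : a <= b -> -1 < p ->
  (\int[leb]_(x in `]a, b[) ((x - a) `^ p)%:E = ((b - a) `^ (p + 1) / (p + 1))%:E)%E.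
Proof.
rewrite le_eqVlt => /predU1P[<-{b}|ab] p1.
  by rewrite set_itvoo0 integral_set0 subrr powR0 ?mul0r //; lra.
have dF x : a < x < b -> is_derive x 1 (fun y => (y - a) `^ (p + 1) / (p + 1)) ((x - a) `^ p).
  move=> /andP[ax _]; have H := is_derive_powR_subr (p + 1) ax.
  rewrite addrK in H; apply: is_derive_eq; rewrite /GRing.scale /=; field; lra.
have cf x : a < x < b -> {for x, continuous (fun y => (y - a) `^ p)}.
  by move=> /andP[ax _]; apply: is_derive_continuous (is_derive_powR_subr p ax).
have p1' : 0 < p + 1 by lra.
have Fa : (y - a) `^ (p + 1) / (p + 1) @[y --> a^'+] --> (0 : R).
  rewrite -[X in _ --> X](mul0r (p + 1)^-1); apply: cvgMl; exact: cvg_powR_subr.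
have Fb : (y - a) `^ (p + 1) / (p + 1) @[y --> b^'-] --> (b - a) `^ (p + 1) / (p + 1).
  apply: cvg_at_left_filter; apply: cvgMl.
  exact: is_derive_continuous (is_derive_powR_subr (p + 1) ab).
by rewrite (ge0_FTC_open ab _ cf dF Fa Fb) ?subr0 // => x _; exact: powR_ge0.
Qed.

Lemma integral_powR_subl a b p : a <= b -> -1 < p ->
  (\int[leb]_(x in `]a, b[) ((b - x) `^ p)%:E = ((b - a) `^ (p + 1) / (p + 1))%:E)%E.
Proof.
rewrite le_eqVlt => /predU1P[<-{b}|ab] p1.
  by rewrite set_itvoo0 integral_set0 subrr powR0 ?mul0r //; lra.
have dF x : a < x < b -> is_derive x 1 (fun y => (b - y) `^ (p + 1) * - (p + 1)^-1) ((b - x) `^ p).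
  move=> /andP[_ ax]; have H := is_derive_powR_subl (p + 1) ax.
  rewrite addrK in H; apply: is_derive_eq; rewrite /GRing.scale /=; field; lra.
have cf x : a < x < b -> {for x, continuous (fun y => (b - y) `^ p)}.
  by move=> /andP[_ ax]; apply: is_derive_continuous (is_derive_powR_subl p ax).
have p1' : 0 < p + 1 by lra.
have Fb : (b - y) `^ (p + 1) * - (p + 1)^-1 @[y --> b^'-] --> (0 : R).
  rewrite -[X in _ --> X](mul0r (- (p + 1)^-1)); apply: cvgMl; exact: cvg_powR_subl.
have Fa : (b - y) `^ (p + 1) * - (p + 1)^-1 @[y --> a^'+] --> (b - a) `^ (p + 1) * - (p + 1)^-1.
  apply: cvg_at_right_filter; apply: cvgMl.
  exact: is_derive_continuous (is_derive_powR_subl (p + 1) ab).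
rewrite (ge0_FTC_open ab _ cf dF Fa Fb) ?sub0r ?mulrN ?opprK // => x _; exact: powR_ge0.
Qed.

Lemma integral_powR_subl_lt a b c p : a <= b -> b < c -> p + 1 != 0 ->
  (\int[leb]_(x in `]a, b[) ((c - x) `^ p)%:E =
   (((c - a) `^ (p + 1) - (c - b) `^ (p + 1)) / (p + 1))%:E)%E.
Proof.
rewrite le_eqVlt => /predU1P[<-{b}|ab] bc p1.
  by rewrite set_itvoo0 integral_set0 subrr mul0r.
have dF x : a < x < b -> is_derive x 1 (fun y => (c - y) `^ (p + 1) * - (p + 1)^-1) ((c - x) `^ p).
  move=> /andP[_ xb]; have xc := lt_trans xb bc.
  have H := is_derive_powR_subl (p + 1) xc.
  by rewrite addrK in H; apply: is_derive_eq; rewrite /GRing.scale /=; field.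
have cf x : a < x < b -> {for x, continuous (fun y => (c - y) `^ p)}.
  by move=> /andP[_ xb]; apply: is_derive_continuous (is_derive_powR_subl p (lt_trans xb bc)).
have Fx x : x < c -> (c - y) `^ (p + 1) * - (p + 1)^-1 @[y --> x] --> (c - x) `^ (p + 1) * - (p + 1)^-1.
  by move=> xc; apply: cvgMl; exact: is_derive_continuous (is_derive_powR_subl (p + 1) xc).
have Fa := cvg_at_right_filter (Fx _ (lt_trans ab bc)).
have Fb := cvg_at_left_filter (Fx _ bc).
rewrite (ge0_FTC_open ab _ cf dF Fa Fb); first by congr EFin; field.
by move=> x _; exact: powR_ge0.
Qed.

Lemma integral_powR_subr_lt a b c p : a <= b -> c < a -> p + 1 != 0 ->
  (\int[leb]_(x in `]a, b[) ((x - c) `^ p)%:E =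
   (((b - c) `^ (p + 1) - (a - c) `^ (p + 1)) / (p + 1))%:E)%E.
Proof.
rewrite le_eqVlt => /predU1P[<-{b}|ab] ca p1.
  by rewrite set_itvoo0 integral_set0 subrr mul0r.
have dF x : a < x < b -> is_derive x 1 (fun y => (y - c) `^ (p + 1) / (p + 1)) ((x - c) `^ p).
  move=> /andP[ax _]; have H := is_derive_powR_subr (p + 1) (lt_trans ca ax).
  by rewrite addrK in H; apply: is_derive_eq; rewrite /GRing.scale /=; field.
have cf x : a < x < b -> {for x, continuous (fun y => (y - c) `^ p)}.
  by move=> /andP[ax _]; apply: is_derive_continuous (is_derive_powR_subr p (lt_trans ca ax)).
have Fx x : c < x -> (y - c) `^ (p + 1) / (p + 1) @[y --> x] --> (x - c) `^ (p + 1) / (p + 1).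
  by move=> xc; apply: cvgMl; exact: is_derive_continuous (is_derive_powR_subr (p + 1) xc).
have Fa := cvg_at_right_filter (Fx _ ca).
have Fb := cvg_at_left_filter (Fx _ (lt_trans ca ab)).
rewrite (ge0_FTC_open ab _ cf dF Fa Fb); first by congr EFin; field.
by move=> x _; exact: powR_ge0.
Qed.

(* The integrand is the derivative of
   [((x - a) / (u - x + e)) `^ (1 - al) / ((1 - al) * (u - a + e))]. *)
Lemma integral_powR_beta al e a u : 0 < al < 1 -> 0 < e -> a < u ->
  (\int[leb]_(x in `]a, u[) ((x - a) `^ (- al) * (u - x + e) `^ (al - 2))%:E =
   ((u - a) `^ (1 - al) * e `^ (al - 1) / ((1 - al) * (u - a + e)))%:E)%E.
Proof.
move=> /andP[al0 al1] e0 au.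
pose F y := (y - a) `^ (1 - al) * (u + e - y) `^ (al - 1) / ((1 - al) * (u - a + e)).
have dF x : a < x < u -> is_derive x 1 F ((x - a) `^ (- al) * (u - x + e) `^ (al - 2)).
  move=> /andP[ax xu]; have H1 := is_derive_powR_subr (1 - al) ax.
  have xue : x < u + e by lra.
  have H2 := is_derive_powR_subl (al - 1) xue.
  apply: is_derive_eq; rewrite /GRing.scale /=.
  rewrite (_ : 1 - al - 1 = - al); last by lra.
  rewrite (_ : al - 1 - 1 = al - 2); last by lra.
  rewrite (_ : 1 - al = - al + 1); last by lra.
  rewrite (_ : al - 1 = al - 2 + 1); last by lra.
  rewrite (_ : u - x + e = u + e - x); last by lra.
  rewrite !(powRD (x := _ - _)) ?powRr1; try lra; try by apply/implyP => _; lra.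
  by field; apply/andP; split; lra.
have cf x : a < x < u -> {for x, continuous (fun y => (y - a) `^ (- al) * (u - y + e) `^ (al - 2))}.
  move=> /andP[ax xu]; apply: cvgM.
    exact: is_derive_continuous (is_derive_powR_subr _ ax).
  under eq_fun do rewrite addrAC; rewrite addrAC.
  have xue : x < u + e by lra.
  exact: is_derive_continuous (is_derive_powR_subl _ xue).
have Fa : F y @[y --> a^'+] --> (0 : R).
  have aue : a < u + e by lra.
  rewrite -(mul0r ((u + e - a) `^ (al - 1) / ((1 - al) * (u - a + e)))).
  under eq_fun do rewrite /F -mulrA.
  apply: cvgM; first by apply: cvg_powR_subr; lra.
  apply: cvgMl; apply: cvg_at_right_filter.
  exact: is_derive_continuous (is_derive_powR_subl _ aue).
have Fb : F y @[y --> u^'-] --> F u.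
  have aue : u < u + e by lra.
  apply: cvg_at_left_filter; apply: cvgMl; apply: cvgM.
    exact: is_derive_continuous (is_derive_powR_subr _ au).
  exact: is_derive_continuous (is_derive_powR_subl _ aue).
rewrite (ge0_FTC_open au _ cf dF Fa Fb).
  by rewrite subr0 /F (_ : u + e - u = e) //; lra.
by move=> x _; rewrite mulr_ge0 ?powR_ge0.
Qed.

End improper.

(** * The Beta integral B(1 - alpha, alpha) *)

Section gamma.
Context {R : realType}.
Implicit Types (a c e al p t x : R).

Let affine a c : R -> measurableTypeR R := fun x => a + c * x.

(** Lebesgue measure is [c] times its image under x -> a + c x, because the two measures agree on
    half-open intervals; what remains is integration against an image measure. *)
Lemma ge0_integral_affine a c (f : R -> \bar R) : 0 < c ->
  measurable_fun setT f -> (forall x, 0 <= f x)%E ->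
  (\int[leb]_(x in `]a, +oo[) f x = c%:E * \int[leb]_(x in `]0%R, +oo[) f (a + c * x)%R)%E.
Proof.
move=> c0 mf f0.
have mphi : measurable_fun setT (affine a c).
  by apply: measurable_funD => //; apply: measurable_funM.
pose mu0 : {measure set (measurableTypeR R) -> \bar R} :=
  mscale (NngNum (ltW c0)) (pushforward leb (affine a c)).
pose mu := mu0 mphi.
have muE (A : set R) : measurable A -> leb A = mu A.
  apply: lebesgue_measure_unique => X -[[y z] _ <-] /=.
  rewrite /mu /mu0 /mscale /= /pushforward.
  rewrite (_ : affine a c @^-1` _ = `](y - a) / c, (z - a) / c]%classic); last first.
    apply/seteqP; split=> x; rewrite /affine /= !in_itv /= ltr_pdivrMr // ler_pdivlMr //.
      by move=> /andP[? ?]; apply/andP; split; lra.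
    by move=> /andP[? ?]; apply/andP; split; lra.
  rewrite !lebesgue_measure_itv /= !lte_fin ltr_pM2r ?invr_gt0 // ltrBrDr subrK.
  case: ifP => _; last by rewrite mule0.
  by rewrite -!EFinB -EFinM; congr EFin; field; lra.
rewrite (eq_measure_integral mu); last by move=> A mA _; exact: muE.
rewrite ge0_integral_mscale //=; last exact: measurable_funTS.
rewrite ge0_integral_pushforward //=; last exact: measurable_funTS.
congr (_ * _)%E; congr (integral _ _ _).
by apply/seteqP; split=> x; rewrite /affine /= !in_itv /= !andbT ltrDl pmulr_rgt0.
Qed.

Lemma Rintegral_affine a c (f : R -> R) : 0 < c -> measurable_fun setT f ->
  leb.-integrable `]a, +oo[ (EFin \o f) ->
  \int[leb]_(x in `]a, +oo[) f x = c * \int[leb]_(x in `]0, +oo[) f (a + c * x).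
Proof.
move=> c0 mf fi; have mf' : measurable_fun setT (EFin \o f) by exact/measurable_EFinP.
have mfa : measurable_fun setT (fun x => f (a + c * x)).
  by apply: (measurableT_comp mf); apply: measurable_funD => //; apply: measurable_funM.
have iX : leb.-integrable `]0, +oo[ (fun x => (f (a + c * x))%:E).
  apply/integrableP; split; first by apply/measurable_funTS/measurable_EFinP; exact: mfa.
  have /integrableP[_] := fi; rewrite (ge0_integral_affine _ c0) //; last first.
    by apply: measurableT_comp.
  set X := (integral _ _ _); rewrite /= -!ge0_fin_numE ?mule_ge0 ?lee_fin ?(ltW c0) ?integral_ge0 //.
  by case: X => [s| |] //; rewrite (gt0_muley, gt0_muleNy) ?lte_fin.
rewrite -RintegralZl // /Rintegral; congr fine.
under [RHS]eq_integral do rewrite EFinM.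
rewrite integralZl //.
rewrite integralE [X in (_ = _ * X)%E]integralE.
rewrite (ge0_integral_affine _ c0 (measurable_funepos mf')) //.
rewrite (ge0_integral_affine _ c0 (measurable_funeneg mf')) //.
have E (X Y : \bar R) : X \is a fin_num -> (c%:E * X - c%:E * Y = c%:E * (X - Y))%E.
  by move=> hx; rewrite muleBr // fin_num_adde_defr.
have hp : (\int[leb]_(x in `]0%R, +oo[) (fun x : R => (f (a + c * x))%:E)^\+ x)%E \is a fin_num.
  exact: integrable_pos_fin_num.
transitivity (c%:E * (\int[leb]_(x in `]0%R, +oo[) (fun x : R => (f (a + c * x))%:E)^\+ x) -
    c%:E * (\int[leb]_(x in `]0%R, +oo[) (fun x : R => (f (a + c * x))%:E)^\- x))%E.
  congr (_ * _ - _ * _)%E; apply: eq_integral => x _; first by rewrite !funeposE.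
  by rewrite !funenegE.
exact: E.
Qed.

Lemma integral_expR_scale c : 0 < c ->
  (\int[leb]_(x in `]0%R, +oo[) (expR (- (c * x)))%:E = c^-1%:E)%E.
Proof.
move=> c0.
have mE : measurable_fun setT (fun x : R => (expR (- (c * x)))%:E).
  by apply/measurable_EFinP; apply: measurableT_comp => //; apply: measurable_funN; apply: measurable_funM.
have := integral_exponential_pdf c0.
rewrite (_ : (fun x => (exponential_pdf c x)%:E) = (fun x => c%:E * (expR (- (c * x)))%:E)%E \_ `[0%R, +oo[); last first.
  apply/funext => x; rewrite /exponential_pdf !patchE; case: ifPn => // _.
  by rewrite mulNr EFinM.
rewrite -integral_mkcond -integral_itv_obnd_cbnd; last first.
  by apply: measurable_funTS; apply: emeasurable_funM.
rewrite ge0_integralZl //; first last.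
- by rewrite lee_fin ltW.
- exact: measurable_funTS.
move=> h; rewrite -[LHS]mul1e -(_ : c^-1%:E * c%:E = 1)%E; last by rewrite -EFinM mulVf // gt_eqF.
by rewrite -muleA h mule1.
Qed.

(** Below 1 the integrand is at most u^p, and from 1 on it is at most exp(- u) since [p <= 0]. *)
Lemma Gamma_ltoo p : -1 < p <= 0 ->
  (\int[leb]_(u in `]0%R, +oo[) (u `^ p * expR (- u))%:E < +oo)%E.
Proof.
move=> /andP[p1 p0].
have m1 : measurable_fun setT (fun u : R => u `^ p) by exact: measurable_powR.
have m2 : measurable_fun setT (fun u : R => expR (- (1 * u))).
  by apply: measurableT_comp => //; apply: measurable_funN; apply: measurable_funM.
have m2' : measurable_fun setT (fun u : R => expR (- u)).
  by apply: measurableT_comp => //; exact: measurable_funN.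
pose k1 := (fun u : R => (u `^ p)%:E) \_ `]0%R, 1%R[.
have mk1 : measurable_fun setT k1.
  by apply/(measurable_restrictT _ _).1 => //; apply/measurable_funTS/measurable_EFinP.
have k10 u : (0 <= k1 u)%E by apply: erestrict_ge0 => v _; rewrite lee_fin powR_ge0.
apply: (@le_lt_trans _ _ (\int[leb]_(u in `]0%R, +oo[) (k1 u + (expR (- (1 * u)))%:E))%E).
  apply: ge0_le_integral => //.
  - by move=> x _; rewrite lee_fin mulr_ge0 ?powR_ge0 ?expR_ge0.
  - by apply/measurable_funTS/measurable_EFinP/measurable_funM.
  - by apply/measurable_funTS; apply: emeasurable_funD => //; exact/measurable_EFinP.
  move=> x; rewrite /= in_itv /= andbT => x0; rewrite /k1 patchE mul1r.
  case: ifPn => [_|].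
    rewrite -EFinD lee_fin; apply: (@le_trans _ _ (x `^ p)); last by rewrite lerDl expR_ge0.
    by rewrite ler_piMr ?powR_ge0 // -expR0 ler_expR oppr_le0 ltW.
  rewrite notin_setE /= in_itv /= x0 /= => /negP; rewrite -leNgt => x1.
  rewrite add0e lee_fin ler_piMl ?expR_ge0 //.
  by rewrite -[leRHS](powRr0 x) ler_powR.
rewrite ge0_integralD //; last 2 first.
- exact: measurable_funTS.
- by apply/measurable_funTS/measurable_EFinP.
rewrite integral_expR_scale // invr1.
rewrite /k1 -integral_mkcondr (_ : _ `&` _ = `]0, 1[%classic); last first.
  by apply/seteqP; split=> x; rewrite /= !in_itv /= ?andbT; [case|move=> /andP[-> ->]].
under eq_integral do rewrite -[X in (X `^ _)%R]subr0.
by rewrite integral_powR_subr // -EFinD ltry.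
Qed.

(* With [s = t * w] the product of the two Gamma integrals becomes
   [\int_w w `^ (- al) \int_t expR (- (1 + w) * t)]. *)
Lemma Gamma_prod al : 0 < al < 1 ->
  ((\int[leb]_(u in `]0%R, +oo[) (u `^ (- al) * expR (- u))%:E) *
   (\int[leb]_(u in `]0%R, +oo[) (u `^ (al - 1) * expR (- u))%:E) =
   \int[leb]_(w in `]0%R, +oo[) (w `^ (- al) * (1 + w) `^ (-1))%:E)%E.
Proof.
move=> /andP[al0 al1].
have mp p : measurable_fun setT (fun u : R => u `^ p) by exact: measurable_powR.
have mexp : measurable_fun setT (fun u : R => expR (- u)).
  by apply: measurableT_comp => //; exact: measurable_funN.
have mg p : measurable_fun setT (fun u : R => (u `^ p * expR (- u))%:E).
  by apply/measurable_EFinP; apply: measurable_funM.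
have g0 p u : (0 <= (u `^ p * expR (- u))%:E :> \bar R)%E.
  by rewrite lee_fin mulr_ge0 ?powR_ge0 ?expR_ge0.
pose h (z : R * R) := z.2 `^ (- al) * expR (- ((1 + z.2) * z.1)).
have mh : measurable_fun setT h.
  apply: measurable_funM; first exact: measurable_powR_comp.
  by apply: measurableT_comp => //; apply: measurable_funN; apply: measurable_funM => //; exact: measurable_funD.
pose D : set R := `]0, +oo[%classic.
have mD : measurable D by exact: measurable_itv.
have D_ x : D x -> 0 < x by rewrite /D /= in_itv /= andbT.
rewrite muleC -ge0_integralZr //; first last.
- by apply: integral_ge0.
- by apply: measurable_funTS; exact: mg.
transitivity (\int[leb]_(t in D) \int[leb]_(w in D) (h (t, w))%:E)%E.
  apply: eq_integral => t; rewrite inE => /D_ t0.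
  rewrite (ge0_integral_affine _ t0 (mg _)) // muleA -ge0_integralZl //; first last.
  + by rewrite mule_ge0 ?lee_fin ?(ltW t0) // mulr_ge0 ?powR_ge0 ?expR_ge0.
  + by apply: measurable_funTS; apply: measurableT_comp (mg _) _; apply: measurable_funD => //; apply: measurable_funM.
  apply: eq_integral => w; rewrite inE => /D_ w0.
  rewrite -!EFinM; congr EFin; rewrite /h /= add0r powRM ?ltW //.
  have E : t `^ (al - 1) * (t * t `^ (- al)) = 1.
    by rewrite -{2}(powRr1 (ltW t0)) -!powRDp // (_ : al - 1 + (1 - al) = 0) ?powRr0; last lra.
  have -> : expR (- ((1 + w) * t)) = expR (- t) * expR (- (t * w)).
    by rewrite -expRD; congr expR; ring.
  transitivity (t `^ (al - 1) * (t * t `^ (- al)) * (w `^ (- al) * (expR (- t) * expR (- (t * w))))).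
    by ring.
  by rewrite E mul1r.
rewrite (@fubini_tonelli_setX _ _ _ _ _ leb leb D D (EFin \o h)) //; last 2 first.
- by apply: measurable_funTS; apply/measurable_EFinP.
- by move=> z _; rewrite lee_fin mulr_ge0 ?powR_ge0 ?expR_ge0.
apply: eq_integral => w; rewrite inE => /D_ w0 /=.
under eq_integral do rewrite /h /= EFinM.
rewrite ge0_integralZl ?lee_fin ?powR_ge0 //; first last.
- by apply/measurable_funTS/measurable_EFinP/measurable_expR_comp; apply: measurable_funN; apply: measurable_funM.
by rewrite integral_expR_scale ?EFinM ?powR_inv1 //; lra.
Qed.

(** The Beta function at (1 - al, al), in its form on the half-line: this is the form in which it
    appears as the mass of the kernels of [cvg_beta_kernel]. *)
Definition beta_cst al : R := \int[leb]_(w in `]0, +oo[) (w `^ (- al) * (1 + w) `^ (-1)).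

Lemma integrable_beta_cst al : 0 < al < 1 ->
  leb.-integrable `]0, +oo[ (fun w : R => (w `^ (- al) * (1 + w) `^ (-1))%:E).
Proof.
move=> al01.
have m : measurable_fun setT (fun w : R => w `^ (- al) * (1 + w) `^ (-1)).
  apply: measurable_funM; first exact: measurable_powR.
  by apply: measurable_powR_comp; exact: measurable_funD.
apply/integrableP; split; first by apply/measurable_funTS/measurable_EFinP.
rewrite (_ : (\int[_]_(x in _) _)%E = \int[leb]_(w in `]0%R, +oo[) (w `^ (- al) * (1 + w) `^ (-1))%:E)%E; last first.
  apply: eq_integral => w; rewrite inE /= in_itv /= andbT => w0.
  by rewrite ger0_norm // mulr_ge0 ?powR_ge0.
rewrite -Gamma_prod //.
move: al01 => /andP[al0 al1].
have g0 p u : (0 <= (u `^ p * expR (- u))%:E :> \bar R)%E.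
  by rewrite lee_fin mulr_ge0 ?powR_ge0 ?expR_ge0.
have h p : -1 < p <= 0 -> (\int[leb]_(u in `]0%R, +oo[) (u `^ p * expR (- u))%:E)%E \is a fin_num.
  by move=> p01; rewrite ge0_fin_numE ?integral_ge0 // Gamma_ltoo.
by rewrite -ge0_fin_numE ?mule_ge0 ?integral_ge0 // fin_numM // h //; lra.
Qed.

(** On []0, 1[] the integrand is at least 1/2. Positivity allows the division by the product of
    Gamma values in [gls_integral]. *)
Lemma beta_cst_gt0 al : 0 < al < 1 -> 0 < beta_cst al.
Proof.
move=> al01; have al01' := al01; move: al01' => /andP[al0 al1].
have iB := integrable_beta_cst al01.
have iS : leb.-integrable `]0, 1[ (fun w : R => (w `^ (- al) * (1 + w) `^ (-1))%:E).
  by apply: integrableS iB => //; apply: subset_itvl.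
apply: (@lt_le_trans _ _ (\int[leb]_(w in `]0, 1[) (2^-1))).
  by rewrite Rintegral_cst //= lebesgue_measure_itv /= lte01 /=; lra.
apply: (@le_trans _ _ (\int[leb]_(w in `]0, 1[) (w `^ (- al) * (1 + w) `^ (-1)))).
  apply: le_Rintegral => //.
    apply: (@bounded_integrable _ _ _ 2^-1 0 1) => //; first exact: subset_itv_oo_cc.
    by move=> x _; rewrite ger0_norm.
  move=> w; rewrite /= in_itv /= => /andP[w0 w1].
  rewrite powR_inv1; last by lra.
  have -> : 2^-1 = 1 * 2^-1 :> R by rewrite mul1r.
  apply: ler_pM; rewrite ?invr_ge0 ?lef_pV2 ?posrE //; try lra.
  by rewrite powRN -[leLHS]invr1 lef_pV2 ?posrE ?powR_gt0 // -[leRHS](powRr0 w) ger_powR ?w0 //; lra.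
rewrite /Rintegral; apply: fine_le.
- exact: integrable_fin_num.
- exact: integrable_fin_num.
- apply: ge0_subset_integral => //; last exact: subset_itvl.
    exact: measurable_int iB.
  by move=> x _; rewrite lee_fin mulr_ge0 ?powR_ge0.
Qed.

Lemma Gamma_mul_onem al : 0 < al < 1 -> Gamma (1 - al) * Gamma al = beta_cst al.
Proof.
move=> al01; have al01' := al01; move: al01' => /andP[al0 al1].
have g0 p u : (0 <= (u `^ p * expR (- u))%:E :> \bar R)%E.
  by rewrite lee_fin mulr_ge0 ?powR_ge0 ?expR_ge0.
pose I p : \bar R := (\int[leb]_(u in `]0%R, +oo[) (u `^ p * expR (- u))%:E)%E.
have fI p : -1 < p <= 0 -> I p \is a fin_num.
  by move=> p01; rewrite ge0_fin_numE ?integral_ge0 // Gamma_ltoo.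
have -> : Gamma (1 - al) = fine (I (- al)).
  by rewrite /Gamma (_ : 1 - al - 1 = - al) //; lra.
have -> : Gamma al = fine (I (al - 1)) by [].
rewrite -fineM ?fI //; try lra.
by rewrite /I Gamma_prod.
Qed.

(* The kernels [e `^ al * (v - a) `^ (- al) / (v - a + e)] are an approximate
   identity at [a], of total mass [beta_cst al]. *)
Lemma cvg_beta_kernel al a t (G : R -> R) (M : R) : 0 < al < 1 -> a < t ->
  measurable_fun setT G -> {for a, continuous G} ->
  (forall v, `|G v| <= M) ->
  \int[leb]_(v in `]a, t[)
    (G v * (harmonic n `^ al * (v - a) `^ (- al) * (v - a + harmonic n) `^ (-1)))
    @[n --> \oo] --> G a * beta_cst al.
Proof.
move=> al01 at_ mG cG GM; have al01' := al01; move: al01' => /andP[al0 al1].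
pose e n : R := harmonic n.
have e0 n : 0 < e n by rewrite invr_gt0.
(* The substitution v = a + [e n] w removes [e n] from the kernel: only the argument of [G] and the
   cut-off at [t] still depend on n, and [k n] is dominated by a multiple of the Beta integrand. *)
pose k n w := G (a + e n * w) * (if a + e n * w < t then 1 else 0) * (w `^ (- al) * (1 + w) `^ (-1)).
pose f n v := G v * (if v < t then 1 else 0) * (e n `^ al * (v - a) `^ (- al) * (v - a + e n) `^ (-1)).
have mf n : measurable_fun setT (f n).
  apply: measurable_funM.
    apply: measurable_funM => //; apply: measurable_fun_ifT => //.
    exact: measurable_fun_ltr.
  apply: measurable_funM; last by apply: measurable_powR_comp; do ! apply: measurable_funD => //.
  by apply: measurable_funM => //; apply: measurable_powR_comp; apply: measurable_funB.
have fk n w : 0 < w -> e n * f n (a + e n * w) = k n w.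
  move=> w0; rewrite /f /k.
  have -> : a + e n * w - a = e n * w by ring.
  have -> : e n * w + e n = e n * (1 + w) by ring.
  have en0 := e0 n.
  rewrite !powRM ?ltW //; last by lra.
  have E : e n `^ al * e n `^ (- al) = 1 by rewrite -powRDp // subrr powRr0.
  have E2 : e n * e n `^ (-1) = 1 by rewrite powR_inv1 ?ltW // mulfV // gt_eqF.
  set g := G _; set i := if _ then _ else _; set p := w `^ _; set q := (1 + w) `^ _.
  transitivity (e n `^ al * e n `^ (- al) * (e n * e n `^ (-1)) * (g * i * (p * q))); first by ring.
  by rewrite E E2 !mul1r.
pose b w : R := w `^ (- al) * (1 + w) `^ (-1).
have b0 w : 0 <= b w by rewrite mulr_ge0 ?powR_ge0.
have iB : leb.-integrable `]0, +oo[ (EFin \o b) := integrable_beta_cst al01.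
have M0 : 0 <= M by apply: le_trans (GM 0); exact: normr_ge0.
have kM n w : `|k n w| <= M * b w.
  rewrite /k -/(b w) normrM [`|b w|]ger0_norm // ler_wpM2r // normrM.
  rewrite -[leRHS]mulr1 ler_pM // ; case: ifP; rewrite ?normr1 ?normr0 //.
have iM : leb.-integrable `]0, +oo[ (fun w => (M * b w)%:E) .
  by apply: lebi_mulrl.
have mfa n : measurable_fun setT (fun w => f n (a + e n * w)).
  by apply: measurableT_comp (mf n) _; apply: measurable_funD => //; apply: measurable_funM.
have i1 n : leb.-integrable `]0, +oo[ (fun w => (f n (a + e n * w))%:E).
  have h : leb.-integrable `]0, +oo[ (fun w => ((e n)^-1 * (M * b w))%:E).
    by apply: lebi_mulrl.
  apply: le_integrable h => //; first by apply/measurable_funTS/measurable_EFinP; exact: mfa.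
  move=> w; rewrite /= in_itv /= andbT => w0; rewrite lee_fin.
  have -> : f n (a + e n * w) = (e n)^-1 * k n w.
    by rewrite -fk // mulrA mulVf ?mul1r // gt_eqF.
  by rewrite normrM [leRHS]normrM ler_wpM2l // (le_trans (kM n w)) // ler_norm.
have fi n : leb.-integrable `]a, +oo[ (EFin \o f n).
  have /integrableP[_ hoo] := i1 n.
  apply/integrableP; split; first by apply/measurable_funTS/measurable_EFinP; exact: mf.
  rewrite (ge0_integral_affine _ (e0 n)) //; last first.
    by apply: measurableT_comp => //; apply/measurable_EFinP; exact: mf.
  by apply: lte_mul_pinfty; rewrite ?lee_fin ?(ltW (e0 n)).
have E n : \int[leb]_(v in `]a, t[)
    (G v * (e n `^ al * (v - a) `^ (- al) * (v - a + e n) `^ (-1))) = \int[leb]_(w in `]0, +oo[) k n w.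
  transitivity (\int[leb]_(v in `]a, +oo[) f n v).
    rewrite (_ : `]a, t[%classic = `]a, +oo[%classic `&` `]-oo, t[%classic); last first.
      apply/seteqP; split=> x; rewrite /= !in_itv /= ?andbT; first by move=> /andP.
      by case=> -> ->.
    rewrite Rintegral_mkcondr; apply: eq_Rintegral => v _; rewrite /f patchE.
    have -> : (v \in `]-oo, t[%classic) = (v < t) by apply/idP/idP; rewrite inE /= in_itv.
    by case: ifP; rewrite ?mulr1 // mulr0 mul0r.
  rewrite (Rintegral_affine (e0 n)) // -RintegralZl //; last exact: i1.
  by apply: eq_Rintegral => w; rewrite inE /= in_itv /= andbT => /fk.
rewrite (_ : (fun n => _) = (fun n => \int[leb]_(w in `]0, +oo[) k n w)); last by apply/funext/E.
have mk n : measurable_fun setT (k n).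
  apply: measurable_funM; last first.
    apply: measurable_funM; first exact: measurable_powR.
    by apply: measurable_powR_comp; exact: measurable_funD.
  have mw : measurable_fun setT (fun w => a + e n * w).
    by apply: measurable_funD => //; apply: measurable_funM.
  apply: measurable_funM; first exact: (measurableT_comp mG mw).
  by apply: measurable_fun_ifT => //; apply: measurable_fun_ltr.
have iG : leb.-integrable `]0, +oo[ (fun w => (G a * b w)%:E) .
  by apply: lebi_mulrl.
have ke w : 0 < w -> k n w @[n --> \oo] --> G a * b w.
  move=> w0; apply: cvgMl.
  have cw : a + e n * w @[n --> \oo] --> a.
    rewrite -[X in _ --> X]addr0; apply: cvgD; first exact: cvg_cst.
    by rewrite -[X in _ --> X](mul0r w); apply: cvgMl; exact: cvg_harmonic.
  rewrite -[X in _ --> X]mulr1; apply: cvgM.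
    exact: (cvg_comp (fun n => a + e n * w) G cw cG).
  apply: cvg_near_cst; near=> n; rewrite ifT //.
  by near: n; apply: (cvgr_lt a) => //.
rewrite /beta_cst -RintegralZl //.
apply: fine_cvg; rewrite fineK; last exact: integrable_fin_num iG.
apply: (@dominated_cvg _ _ _ leb `]0%R, +oo[%classic _ (fun n => EFin \o k n)
  (fun w => (G a * b w)%:E) (fun w => (M * b w)%:E)) => //.
- by move=> n; apply/measurable_funTS/measurable_EFinP; exact: mk.
- move=> w; rewrite /= in_itv /= andbT => w0; apply: cvg_EFin; first exact: nearW.
  exact: ke.
- by move=> n w _; rewrite lee_fin.
Unshelve. all: by end_near. Qed.

End gamma.

(** * The Marchaud integral of a step *)

Section marchaud.
Context {R : realType}.
Implicit Types (a e t u v x : R).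
Variables (al M : R) (g : R -> R).
Hypotheses (al01 : 0 < al < 1) (cg : continuous g) (gM : forall x, `|g x| <= M).

Let al0 : 0 < al. Proof. by case/andP: al01. Qed.
Let al1 : al < 1. Proof. by case/andP: al01. Qed.

Ltac alra := have ? := al0; have ? := al1; lra.

Let mg : measurable_fun setT g.
Proof. exact: continuous_measurable_fun. Qed.

Let M0 : 0 <= M. Proof. by apply: le_trans (gM 0); exact: normr_ge0. Qed.

Lemma measurable_triangle_Rintegral1 a t (f : R * R -> R) : measurable_fun setT f ->
  measurable_fun `]a, t[ (fun x => \int[leb]_(u in `]x, t[) f (x, u)).
Proof.
move=> mf; have mf' : measurable_fun setT (EFin \o f) by exact/measurable_EFinP.
rewrite /Rintegral; apply: measurableT_comp => //.
rewrite (_ : (fun x => _) = fun x => (\int[leb]_(u in `]x, t[) (EFin \o f)^\+ (x, u) -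
    \int[leb]_(u in `]x, t[) (EFin \o f)^\- (x, u))%E); last first.
  apply/funext => x; rewrite integralE; congr (_ - _)%E; apply: eq_integral => u _.
    by rewrite !funeposE.
  by rewrite !funenegE.
apply: emeasurable_funB.
  exact: (measurable_triangle_tonelli1 (measurable_funepos mf')).
exact: (measurable_triangle_tonelli1 (measurable_funeneg mf')).
Qed.

(** The second factor of the integrand of [gls_integral]: up to sign and the factor 1 / Gamma(al),
    the right Marchaud derivative of order 1 - al of [g] minus its value at [t]. *)
Definition marchaud t x : R :=
  (g t - g x) / (t - x) `^ (1 - al) +
  (1 - al) * \int[leb]_(u in `]x, t[) ((g u - g x) / (u - x) `^ (2 - al)).

Let marchaudE t x : marchaud t x = (g t - g x) * (t - x) `^ (al - 1) +
  (1 - al) * \int[leb]_(u in `]x, t[) ((g u - g x) * (u - x) `^ (al - 2)).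
Proof.
rewrite /marchaud -powRN opprB; congr (_ + _ * _).
by apply: eq_Rintegral => u _; rewrite -powRN opprB.
Qed.

Let kern (z : R * R) : R := (g z.2 - g z.1) * (z.2 - z.1) `^ (al - 2).

Let mkern : measurable_fun setT kern.
Proof.
apply: measurable_funM; first by apply: measurable_funB; apply: measurableT_comp.
by apply: measurable_powR_comp; apply: measurable_funB.
Qed.

Lemma measurable_marchaud a t : measurable_fun `]a, t[ (marchaud t).
Proof.
have -> : marchaud t = fun x => (g t - g x) * (t - x) `^ (al - 1) +
    (1 - al) * \int[leb]_(u in `]x, t[) kern (x, u) by apply/funext => x; rewrite marchaudE.
apply: measurable_funD.
  apply: measurable_funTS; apply: measurable_funM; first exact: measurable_funB.
  by apply: measurable_powR_comp; apply: measurable_funB.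
by apply: measurable_funM => //; exact: (measurable_triangle_Rintegral1 mkern).
Qed.

(** The condition imposed on the path. The weight (x - a)^(- al) is the left Marchaud derivative of
    a unit jump at [a], so this makes the integral of such a jump against [g] absolutely
    convergent. *)
Definition marchaud_finite a t : Prop :=
  (\int[leb]_(x in `]a, t[) \int[leb]_(u in `]x, t[)
     ((x - a) `^ (- al) * (`|g u - g x| * (u - x) `^ (al - 2)))%:E < +oo)%E.

Let mstd (f : R -> R) p : measurable_fun setT f ->
  measurable_fun setT (fun x => f x `^ p).
Proof. exact: measurable_powR_comp. Qed.

Lemma integrable_powR_beta a t : a < t ->
  leb.-integrable `]a, t[ (fun x => ((x - a) `^ (- al) * (t - x) `^ (al - 1))%:E).
Proof.
move=> at_; pose c := (t - a) / 2; have c0 : 0 < c by rewrite /c; alra.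
have mp a' p : measurable_fun setT (fun x : R => (x - a') `^ p).
  by apply: mstd; apply: measurable_funB.
have mp' a' p : measurable_fun setT (fun x : R => (a' - x) `^ p).
  by apply: mstd; apply: measurable_funB.
have i1 : leb.-integrable `]a, t[ (fun x => ((x - a) `^ (- al))%:E).
  apply/integrableP; split; first by apply/measurable_funTS/measurable_EFinP; exact: mp.
  under eq_integral do rewrite /= ger0_norm ?powR_ge0 //.
  by rewrite integral_powR_subr ?ltry ?ltW //; alra.
have i2 : leb.-integrable `]a, t[ (fun x => ((t - x) `^ (al - 1))%:E).
  apply/integrableP; split; first by apply/measurable_funTS/measurable_EFinP; exact: mp'.
  under eq_integral do rewrite /= ger0_norm ?powR_ge0 //.
  by rewrite integral_powR_subl ?ltry ?ltW //; alra.
have i12 := lebiD (measurable_itv _)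
  (lebi_mulrl (c `^ (al - 1)) (measurable_itv _) i1)
  (lebi_mulrl (c `^ (- al)) (measurable_itv _) i2).
apply: lebi_dom i12 => //.
  by apply/measurable_funTS/measurable_funM; [exact: mp|exact: mp'].
move=> x; rewrite /= in_itv /= => /andP[ax xt].
rewrite !ger0_norm ?addr_ge0 ?mulr_ge0 ?powR_ge0 //.
have dec p (y : R) : p <= 0 -> c <= y -> y `^ p <= c `^ p.
  by move=> p0 cy; apply: powR_nincr.
have [xc|xc] := leP x (a + c).
  apply: (@le_trans _ _ (c `^ (al - 1) * (x - a) `^ (- al))); last by rewrite lerDl mulr_ge0 ?powR_ge0.
  rewrite mulrC ler_wpM2r ?powR_ge0 // dec //; rewrite /c in xc *; alra.
apply: (@le_trans _ _ (c `^ (- al) * (t - x) `^ (al - 1))); last by rewrite lerDr mulr_ge0 ?powR_ge0.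
by rewrite ler_wpM2r ?powR_ge0 // dec //; alra.
Qed.

Section step.
Variables (a t : R).
Hypotheses (at_ : a < t) (fin : marchaud_finite a t).

Let G x := g t - g x.
Let wk (z : R * R) : R := (z.1 - a) `^ (- al) * kern z.

Let mwk : measurable_fun setT wk.
Proof.
by apply: measurable_funM => //; apply: measurable_powR_comp; apply: measurable_funB.
Qed.

Let wfin : (\int[leb]_(x in `]a, t[) \int[leb]_(u in `]x, t[) `|wk (x, u)|%:E < +oo)%E.
Proof.
have E : (\int[leb]_(x in `]a, t[) \int[leb]_(u in `]x, t[) `|wk (x, u)|%:E)%E =
    (\int[leb]_(x in `]a, t[) \int[leb]_(u in `]x, t[)
       ((x - a) `^ (- al) * (`|g u - g x| * (u - x) `^ (al - 2)))%:E)%E.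
  apply: eq_integral => x _; apply: eq_integral => u _; congr EFin.
  by rewrite /wk /kern /= !normrM [`|_ `^ (- al)|]ger0_norm ?powR_ge0 // [`|_ `^ (al - 2)|]ger0_norm ?powR_ge0.
by rewrite E; exact: fin.
Qed.

Let ae_kern : {ae leb, forall x : R, x \in `]a, t[ ->
  leb.-integrable `]x, t[ (fun u => (kern (x, u))%:E)}.
Proof.
have h0 := triangle_ae_integrable1 mwk wfin.
have h1 := leb_ae_imply h0.
apply: h1 => x /= h xat.
have {}h := h xat.
move: (xat); rewrite in_itv /= => /andP[ax xt].
have := lebi_mulrl ((x - a) `^ al) (measurable_itv _) h.
apply: eq_integrable => // u _; congr EFin.
by rewrite /wk /= mulrA -powRDp ?subr_gt0 // subrr powRr0 mul1r.
Qed.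

Let e n : R := harmonic n.
Let e0 n : 0 < e n. Proof. by rewrite invr_gt0. Qed.

Let kerne n (z : R * R) : R := (g z.2 - g z.1) * (z.2 - z.1 + e n) `^ (al - 2).

(** The Marchaud derivative with all distances enlarged by [e n]. The kernel becomes bounded, so the
    difference of values of [g] may be split and Fubini's theorem applied to each part; the original
    kernel serves as dominating function when [e n] tends to 0. *)
Let K n x := G x * (t - x + e n) `^ (al - 1) +
  (1 - al) * \int[leb]_(u in `]x, t[) kerne n (x, u).

Let mkerne n : measurable_fun setT (kerne n).
Proof.
apply: measurable_funM; first by apply: measurable_funB; apply: measurableT_comp.
by apply: measurable_powR_comp; apply: measurable_funD => //; apply: measurable_funB.
Qed.

Let cvg_e : e n @[n --> \oo] --> 0. Proof. exact: cvg_harmonic. Qed.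

Let cvg_powR_e y p : 0 < y -> (y + e n) `^ p @[n --> \oo] --> y `^ p.
Proof.
move=> y0; have ye : y + e n @[n --> \oo] --> y.
  by rewrite -[X in _ --> X]addr0; apply: cvgD => //; exact: cvg_cst.
apply: (cvg_comp _ (fun z => z `^ p) ye).
exact: is_derive_continuous (is_derive1_powR p y0).
Qed.

Let powRe y p n : p <= 0 -> 0 < y -> (y + e n) `^ p <= y `^ p.
Proof.
by move=> p0 y0; apply: powR_nincr => //; rewrite lerDl ltW.
Qed.

Let cvg_K x : a < x < t -> leb.-integrable `]x, t[ (fun u => (kern (x, u))%:E) ->
  K n x @[n --> \oo] --> marchaud t x.
Proof.
move=> /andP[ax xt] ik; rewrite marchaudE; apply: cvgD.
  by apply: cvgMr; apply: cvg_powR_e; rewrite subr_gt0.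
apply: cvgMr; apply: fine_cvg.
rewrite fineK; last exact: integrable_fin_num ik.
have iN : leb.-integrable `]x, t[ (fun u => `|kern (x, u)|%:E).
  by have := integrable_abse ik.
apply: (@dominated_cvg _ _ _ leb `]x, t[%classic _ (fun n u => (kerne n (x, u))%:E)
  (fun u => (kern (x, u))%:E) (fun u => `|kern (x, u)|%:E)) => //.
- by move=> n; apply/measurable_funTS/measurable_EFinP; apply: (measurableT_comp (mkerne n)).
- move=> u; rewrite /= in_itv /= => /andP[xu ut]; apply: cvg_EFin; first exact: nearW.
  by apply: cvgMr; apply: cvg_powR_e; rewrite subr_gt0.
- move=> n u; rewrite /= in_itv /= => /andP[xu ut]; rewrite lee_fin /kerne /kern !normrM /=.
  rewrite ler_wpM2l // !ger0_norm ?powR_ge0 // powRe ?subr_gt0 //; alra.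
Qed.

(** Write g u - g x = G x - G u. The power integral that multiplies [G x] is explicit, and its
    boundary term at [t] cancels the first summand of [K n x]. *)
Let KE n x : a < x < t -> K n x = e n `^ (al - 1) * G x -
  (1 - al) * \int[leb]_(u in `]x, t[) (G u * (u - x + e n) `^ (al - 2)).
Proof.
move=> /andP[ax xt]; have e0n := e0 n.
have mp : measurable_fun setT (fun u : R => (u - x + e n) `^ (al - 2)).
  by apply: mstd; apply: measurable_funD => //; apply: measurable_funB.
have pe u : x < u -> (u - x + e n) `^ (al - 2) <= e n `^ (al - 2).
  by move=> xu; apply: powR_nincr => //; alra.
have i1 : leb.-integrable `]x, t[ (fun u : R => ((u - x + e n) `^ (al - 2))%:E).
  apply: (@bounded_integrable _ _ _ (e n `^ (al - 2)) x t) => //.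
  - exact: subset_itv_oo_cc.
  - exact: measurable_funTS.
  - move=> u; rewrite /= in_itv /= => /andP[xu ut].
    by rewrite ger0_norm ?powR_ge0 // pe.
have GM u : `|G u| <= M + M by rewrite /G (le_trans (ler_normB _ _)) // lerD.
have i2 : leb.-integrable `]x, t[ (fun u : R => (G u * (u - x + e n) `^ (al - 2))%:E).
  apply: (@bounded_integrable _ _ _ ((M + M) * e n `^ (al - 2)) x t) => //.
  - exact: subset_itv_oo_cc.
  - by apply: measurable_funTS; apply: measurable_funM => //; apply: measurable_funB.
  - move=> u; rewrite /= in_itv /= => /andP[xu ut].
    by rewrite normrM ler_pM // ger0_norm ?powR_ge0 // pe.
rewrite /K; have -> : \int[leb]_(u in `]x, t[) kerne n (x, u) =
  G x * \int[leb]_(u in `]x, t[) ((u - x + e n) `^ (al - 2)) -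
  \int[leb]_(u in `]x, t[) (G u * (u - x + e n) `^ (al - 2)).
  rewrite -RintegralZl // -RintegralB //; last exact: lebi_mulrl.
  apply: eq_Rintegral => u _; rewrite /kerne /G /=; ring.
have -> : \int[leb]_(u in `]x, t[) ((u - x + e n) `^ (al - 2)) =
    (e n `^ (al - 1) - (t - x + e n) `^ (al - 1)) / (1 - al).
  transitivity (fine (\int[leb]_(u in `]x, t[) ((u - (x - e n)) `^ (al - 2))%:E)%E).
    by congr fine; apply: eq_integral => u _; congr (_ `^ _)%:E; ring.
  rewrite integral_powR_subr_lt ?ltW //=; try alra.
    rewrite (_ : al - 2 + 1 = al - 1); last by ring.
    rewrite (_ : t - (x - e n) = t - x + e n); last by ring.
    rewrite (_ : x - (x - e n) = e n); last by ring.
    by field; apply/andP; split; alra.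
by field; alra.
Qed.

Let w x : R := (x - a) `^ (- al).
Let w0 x : 0 <= w x. Proof. exact: powR_ge0. Qed.
Let mw : measurable_fun setT w.
Proof. by apply: mstd; apply: measurable_funB. Qed.
Let iw : leb.-integrable `]a, t[ (fun x : R => (w x)%:E).
Proof.
apply: lebi_ge0 => //; first exact: measurable_funTS.
by rewrite /w integral_powR_subr ?ltry ?ltW //; alra.
Qed.
Let GM u : `|G u| <= M + M.
Proof. by rewrite /G (le_trans (ler_normB _ _)) // lerD. Qed.
Let mG : measurable_fun setT G. Proof. exact: measurable_funB. Qed.

Let mK n : measurable_fun `]a, t[ (K n).
Proof.
apply: measurable_funD.
  apply: measurable_funTS; apply: measurable_funM => //.
  by apply: mstd; apply: measurable_funD => //; apply: measurable_funB.
by apply: measurable_funM => //; exact: (measurable_triangle_Rintegral1 (mkerne n)).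
Qed.

(** A bound uniform in n, since negative powers decrease when distances grow. Its right-hand side is
    integrable: the first term as a Beta integrand, the second by [fin]. *)
Let K_le n x : a < x < t -> leb.-integrable `]x, t[ (fun u : R => (kern (x, u))%:E) ->
  `|w x * K n x| <= (M + M) * (w x * (t - x) `^ (al - 1)) +
    (1 - al) * \int[leb]_(u in `]x, t[) `|wk (x, u)|.
Proof.
move=> /andP[ax xt] ik.
have iN : leb.-integrable `]x, t[ (fun u : R => `|kern (x, u)|%:E) by have := integrable_abse ik.
have ke u : `]x, t[%classic u -> `|kerne n (x, u)| <= `|kern (x, u)|.
  rewrite /= in_itv /= => /andP[xu ut]; rewrite /kerne /kern !normrM /=.
  by rewrite ler_wpM2l // !ger0_norm ?powR_ge0 // powRe ?subr_gt0 //; alra.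
have ike : leb.-integrable `]x, t[ (fun u : R => (kerne n (x, u))%:E).
  apply: lebi_dom iN => //.
  by apply: measurable_funTS; exact: (measurableT_comp (mkerne n)).
have ikeN : leb.-integrable `]x, t[ (fun u : R => `|kerne n (x, u)|%:E) by have := integrable_abse ike.
have -> : \int[leb]_(u in `]x, t[) `|wk (x, u)| = w x * \int[leb]_(u in `]x, t[) `|kern (x, u)|.
  rewrite -RintegralZl //; apply: eq_Rintegral => u _.
  by rewrite /wk normrM ger0_norm ?powR_ge0.
rewrite normrM [`|w x|]ger0_norm // mulrCA [(1 - al) * _]mulrCA -mulrDr ler_wpM2l //.
rewrite (le_trans (ler_normD _ _)) // lerD //.
  rewrite normrM ler_pM // ger0_norm ?powR_ge0 // powRe ?subr_gt0 //; alra.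
rewrite normrM ger0_norm; last by alra.
rewrite ler_wpM2l //; first by alra.
apply: le_trans (leb_le_normr_Rintegral (measurable_itv _) ike) _.
exact: le_Rintegral.
Qed.

Let marchaud_dct : leb.-integrable `]a, t[ (fun x : R => (w x * marchaud t x)%:E) /\
  \int[leb]_(x in `]a, t[) (w x * K n x) @[n --> \oo] -->
  \int[leb]_(x in `]a, t[) (w x * marchaud t x).
Proof.
pose h x := (M + M) * (w x * (t - x) `^ (al - 1)) +
  (1 - al) * \int[leb]_(u in `]x, t[) `|wk (x, u)|.
have ih : leb.-integrable `]a, t[ (fun x : R => (h x)%:E).
  apply: lebiD => //; apply: lebi_mulrl => //; first exact: integrable_powR_beta.
  apply: (triangle_integrable1 (f := fun z => `|wk z|)); first exact: measurableT_comp.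
  have E : (\int[leb]_(x in `]a, t[) \int[leb]_(u in `]x, t[) `| `|wk (x, u)| |%:E =
    \int[leb]_(x in `]a, t[) \int[leb]_(u in `]x, t[) `|wk (x, u)|%:E)%E.
    by apply: eq_integral => x _; apply: eq_integral => u _; rewrite normr_id.
  by rewrite E; exact: wfin.
apply: leb_dominated_convergence ih _ => //.
- by move=> n; apply: measurable_funM => //; exact: measurable_funTS.
- by apply: measurable_funM; [exact: measurable_funTS|exact: measurable_marchaud].
- have h1 := leb_ae_imply ae_kern; apply: h1 => x hx xat.
  have {}hx := hx xat; rewrite /= in_itv /= in xat.
  by apply: cvgMr; apply: cvg_K.
- have h1 := leb_ae_imply ae_kern; apply: h1 => x hx xat n.
  have {}hx := hx xat; rewrite /= in_itv /= in xat.
  exact: K_le.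
Qed.

(** After [KE] and Fubini's theorem, the integral over x is that of [integral_powR_beta]. The factor
    of [G v] is then e^(al - 1) (v - a)^(- al) (1 - (v - a) / (v - a + e)) with e = [e n], which is
    the kernel on the right. *)
Let wKE n : \int[leb]_(x in `]a, t[) (w x * K n x) =
  \int[leb]_(v in `]a, t[) (G v * (e n `^ al * (v - a) `^ (- al) * (v - a + e n) `^ (-1))).
Proof.
have e0n := e0 n.
pose f (z : R * R) : R := w z.1 * (G z.2 * (z.2 - z.1 + e n) `^ (al - 2)).
have mf : measurable_fun setT f.
  apply: measurable_funM; first exact: measurableT_comp.
  apply: measurable_funM; first exact: measurableT_comp.
  by apply: measurable_powR_comp; apply: measurable_funD => //; apply: measurable_funB.
have pe y : 0 < y -> (y + e n) `^ (al - 2) <= e n `^ (al - 2).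
  by move=> y0; apply: powR_nincr => //; alra.
pose C := (M + M) * e n `^ (al - 2) * (t - a).
have ffin : (\int[leb]_(x in `]a, t[) \int[leb]_(u in `]x, t[) `|f (x, u)|%:E < +oo)%E.
  have /integrableP[_] := lebi_mulrl C (measurable_itv _) iw.
  apply: le_lt_trans; apply: ge0_le_integral => //.
  - by move=> x _; apply: integral_ge0 => u _; rewrite lee_fin.
  - have mN : measurable_fun setT (fun z => `|f z|%:E).
      by apply/measurable_EFinP; apply: measurableT_comp.
    have N0 z : (0 <= `|f z|%:E)%E by rewrite lee_fin.
    exact: (measurable_triangle_tonelli1 mN N0).
  - by apply/measurable_funTS; apply: measurableT_comp => //; apply/measurable_EFinP; apply: measurable_funM.
  move=> x; rewrite /= in_itv /= => /andP[ax xt].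
  apply: (@le_trans _ _ (\int[leb]_(u in `]x, t[) (w x * ((M + M) * e n `^ (al - 2)))%:E)%E).
    apply: ge0_le_integral => //.
    - by apply/measurable_funTS/measurable_EFinP; apply: measurableT_comp => //; exact: (measurableT_comp mf).
    move=> u; rewrite /= in_itv /= => /andP[xu ut].
    rewrite lee_fin /f /= normrM [`|w x|]ger0_norm // ler_wpM2l // normrM ler_pM //.
    by rewrite ger0_norm ?powR_ge0 // pe ?subr_gt0.
  rewrite integral_cst //= lebesgue_measure_itv /= lte_fin xt -EFinB -EFinM lee_fin.
  have ta : 0 <= t - a by alra.
  have MM : 0 <= M + M by rewrite addr_ge0.
  rewrite ger0_norm; last by rewrite /C !mulr_ge0 ?powR_ge0.
  rewrite [leRHS]mulrC /C [leRHS]mulrA ler_wpM2l //; first by rewrite !mulr_ge0 ?powR_ge0.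
  alra.
have inner u : a < u -> \int[leb]_(x in `]a, u[) f (x, u) =
    G u * ((u - a) `^ (1 - al) * e n `^ (al - 1) / ((1 - al) * (u - a + e n))).
  move=> au; rewrite /Rintegral.
  transitivity (\int[leb]_(x in `]a, u[) (G u * (w x * (u - x + e n) `^ (al - 2)))).
    by apply: eq_Rintegral => x _; rewrite /f /=; ring.
  have B := integral_powR_beta al01 e0n au.
  rewrite RintegralZl //; first by rewrite /Rintegral /w B.
  apply: lebi_ge0 => //.
  - apply: measurable_funTS; apply: measurable_funM => //.
    by apply: mstd; apply: measurable_funD => //; apply: measurable_funB.
  - by move=> x _; rewrite mulr_ge0 ?powR_ge0.
  - by rewrite /w B ltry.
have i2 : leb.-integrable `]a, t[
    (fun u : R => (G u * ((u - a) `^ (1 - al) * e n `^ (al - 1) / ((1 - al) * (u - a + e n))))%:E).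
  have := triangle_integrable2 mf ffin; apply: eq_integrable => // u.
  by rewrite inE /= in_itv /= => /andP[au _]; rewrite inner.
have iwG : leb.-integrable `]a, t[ (fun x : R => (w x * G x)%:E).
  apply: lebi_dom (lebi_mulrl (M + M) (measurable_itv _) iw) => //.
    by apply: measurable_funTS; apply: measurable_funM.
  by move=> x _; rewrite normrM mulrC ler_pM // ger0_norm.
transitivity (\int[leb]_(x in `]a, t[) (e n `^ (al - 1) * (w x * G x) -
    (1 - al) * \int[leb]_(u in `]x, t[) f (x, u))).
  apply: eq_Rintegral => x; rewrite inE /= in_itv /= => xat; rewrite KE //.
  move: xat => /andP[ax xt].
  have -> : \int[leb]_(u in `]x, t[) f (x, u) =
      w x * \int[leb]_(u in `]x, t[) (G u * (u - x + e n) `^ (al - 2)).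
    rewrite -RintegralZl //; apply: (@bounded_integrable _ _ _ ((M + M) * e n `^ (al - 2)) x t) => //.
    - exact: subset_itv_oo_cc.
    - apply: measurable_funTS; apply: measurable_funM => //.
      by apply: mstd; apply: measurable_funD => //; apply: measurable_funB.
    - move=> u; rewrite /= in_itv /= => /andP[xu ut].
      by rewrite normrM ler_pM // ger0_norm ?powR_ge0 // pe ?subr_gt0.
  ring.
have i1 := triangle_integrable1 mf ffin.
rewrite RintegralB //; last 2 first.
- exact: lebi_mulrl.
- exact: lebi_mulrl.
rewrite [X in _ - X]RintegralZl // (triangle_fubini mf ffin).
have -> : \int[leb]_(u in `]a, t[) \int[leb]_(x in `]a, u[) f (x, u) = \int[leb]_(u in `]a, t[)
    (G u * ((u - a) `^ (1 - al) * e n `^ (al - 1) / ((1 - al) * (u - a + e n)))).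
  by apply: eq_Rintegral => u; rewrite inE /= in_itv /= => /andP[au _]; rewrite inner.
rewrite -[X in _ - X]RintegralZl // -RintegralB //; last 2 first.
- exact: lebi_mulrl.
- exact: lebi_mulrl.
apply: eq_Rintegral => v; rewrite inE /= in_itv /= => /andP[av vt].
have va : 0 < v - a by rewrite subr_gt0.
rewrite /w powR_inv1; last by alra.
rewrite (_ : 1 - al = - al + 1) ?(powRDp _ _ va) ?powRr1 ?ltW //; last by ring.
have -> : e n `^ al = e n `^ (al - 1) * e n.
  transitivity (e n `^ (al - 1 + 1)); first by rewrite subrK.
  by rewrite powRDp // powRr1 // ltW.
field; apply/andP; split; alra.
Qed.

Lemma integrable_marchaud_step :
  leb.-integrable `]a, t[ (fun x : R => ((x - a) `^ (- al) * marchaud t x)%:E).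
Proof. exact: marchaud_dct.1. Qed.

(** Let n tend to infinity in [wKE]: the left side converges by domination, and the kernels on the
    right concentrate at [a]. After normalization this says that a unit jump at [a] integrates to g
    t - g a. *)
Lemma Rintegral_marchaud_step :
  \int[leb]_(x in `]a, t[) ((x - a) `^ (- al) * marchaud t x) = (g t - g a) * beta_cst al.
Proof.
have := marchaud_dct.2; under eq_cvg do rewrite wKE; move=> c1.
have cG : {for a, continuous G} by apply: cvgB; [exact: cvg_cst|exact: cg].
exact: (cvg_unique _ c1 (cvg_beta_kernel al01 at_ mG cG GM)).
Qed.

End step.
End marchaud.

(** * Absolutely continuous functions with bounded density *)

(* Refining a subdivision halves the total of a quadratically small additive error. *)
Lemma additive_quadratic_eq0 {R : realType} (E : R -> R -> R) (C : R) :
  (forall x y z, x <= y -> y <= z -> E x z = E x y + E y z) ->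
  (forall x y, x <= y -> `|E x y| <= C * (y - x) ^+ 2) ->
  forall x y, x <= y -> E x y = 0.
Proof.
move=> addE; have half c : (forall x y, x <= y -> `|E x y| <= c * (y - x) ^+ 2) ->
    forall x y, x <= y -> `|E x y| <= c / 2 * (y - x) ^+ 2.
  move=> hc x y xy; have xm : x <= (x + y) / 2 by lra.
  have my : (x + y) / 2 <= y by lra.
  rewrite (addE _ _ _ xm my); apply: (le_trans (ler_normD _ _)).
  apply: (le_trans (lerD (hc _ _ xm) (hc _ _ my))); rewrite le_eqVlt; apply/orP; left.
  by apply/eqP; field.
move=> hC; have hn n x y : x <= y -> `|E x y| <= C / 2 ^+ n * (y - x) ^+ 2.
  elim: n x y => [|n ih] x y xy; first by rewrite expr0 divr1 hC.
  have -> : C / 2 ^+ n.+1 = C / 2 ^+ n / 2 by rewrite exprSr invfM mulrA.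
  exact: half xy.
move=> x y xy; apply/eqP; rewrite -normr_le0.
have c0 : (fun n => C / 2 ^+ n * (y - x) ^+ 2) @ \oo --> (0 : R).
  have -> : (0 : R) = C * 0 * (y - x) ^+ 2 by rewrite mulr0 mul0r.
  apply: cvgMl; apply: cvgMr; under eq_fun do rewrite -exprVn.
  by apply: cvg_expr; rewrite ger0_norm; lra.
rewrite -(cvg_lim (@Rhausdorff R) c0); apply: limr_ge; first by apply/cvg_ex; exists 0.
by apply: nearW => n; apply: hn.
Qed.

Section density.
Context {R : realType}.
Implicit Types (F G p q : R -> R) (x y : R).

(** An integral identity rather than a derivative, because the densities met here, such as the
    interest rate, are merely measurable. *)
Definition has_density F p := forall x y, x <= y ->
  F y - F x = \int[leb]_(v in `]x, y[) p v.

Lemma bounded_integrable_oo p (L x y : R) : measurable_fun setT p ->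
  (forall u, x < u < y -> `|p u| <= L) -> leb.-integrable `]x, y[ (fun v : R => (p v)%:E).
Proof.
move=> mp pL; apply: (@bounded_integrable _ _ _ L x y) => //.
- exact: subset_itv_oo_cc.
- exact: measurable_funTS.
Qed.

Lemma le_normr_Rintegral_cst p (L x y : R) : x <= y -> measurable_fun setT p ->
  (forall u, x < u < y -> `|p u| <= L) ->
  `|\int[leb]_(v in `]x, y[) p v| <= L * (y - x).
Proof.
move=> xy mp pL; have [->|xny] := eqVneq x y.
  by rewrite set_itvoo0 Rintegral_set0 normr0 subrr mulr0.
have {xny}xy' : x < y by rewrite lt_neqAle xny.
have L0 : 0 <= L by apply: le_trans (pL ((x + y) / 2) _); rewrite ?normr_ge0 //; apply/andP; split; lra.
have ip := bounded_integrable_oo mp pL.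
apply: (le_trans (leb_le_normr_Rintegral (measurable_itv _) ip)).
have iL : leb.-integrable `]x, y[ (fun v : R => L%:E).
  by apply: (@bounded_integrable_oo (cst L) L) => // u _; rewrite ger0_norm.
apply: (@le_trans _ _ (\int[leb]_(v in `]x, y[) L)).
  apply: le_Rintegral => //; first exact: (integrable_abse ip).
by rewrite Rintegral_cst //= lebesgue_measure_itv /= lte_fin xy' -EFinB.
Qed.

Lemma Rintegral_oo_cat p (L x y z : R) : x <= y -> y <= z -> measurable_fun setT p ->
  (forall u, x < u < z -> `|p u| <= L) ->
  \int[leb]_(v in `]x, z[) p v = \int[leb]_(v in `]x, y[) p v + \int[leb]_(v in `]y, z[) p v.
Proof.
move=> xy yz mp pL; have [<-|xny] := eqVneq x y.
  by rewrite set_itvoo0 Rintegral_set0 add0r.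
have [->|ynz] := eqVneq y z; first by rewrite set_itvoo0 Rintegral_set0 addr0.
have {xny}xy' : x < y by rewrite lt_neqAle xny.
have {ynz}yz' : y < z by rewrite lt_neqAle ynz.
have ip := bounded_integrable_oo mp pL.
have := @Rintegral_itvB R p (BRight x) (BLeft z) y ip.
rewrite !bnd_simp => /(_ (ltW xy') yz') /(canRL (subrK _)) ->; rewrite addrC; congr (_ + _).
rewrite Rintegral_itv_bndo_bndc //.
by apply: integrableS ip => //; apply: subset_itvl; rewrite bnd_simp.
Qed.

Lemma lipschitz_of_density F p L x y : measurable_fun setT p -> (forall u, `|p u| <= L) ->
  has_density F p -> x <= y -> `|F y - F x| <= L * (y - x).
Proof. by move=> mp pL dF xy; rewrite dF //; exact: le_normr_Rintegral_cst. Qed.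

Lemma density_continuous F p L : measurable_fun setT p -> (forall u, `|p u| <= L) ->
  has_density F p -> continuous F.
Proof.
move=> mp pL dF; have lip := lipschitz_of_density mp pL dF.
have L0 : 0 <= L by apply: le_trans (pL 0); exact: normr_ge0.
have L1 : 0 < L + 1 by lra.
move=> x; apply/cvgrPdist_le => e e0; near=> y.
have h : `|F x - F y| <= L * `|x - y|.
  have [xy|/ltW yx] := leP x y.
    by rewrite distrC [`|x - y|]distrC (ger0_norm (_ : 0 <= y - x)) ?subr_ge0 // lip.
  by rewrite (ger0_norm (_ : 0 <= x - y)) ?subr_ge0 // lip.
apply: (le_trans h).
apply: (@le_trans _ _ ((L + 1) * `|x - y|)); first by rewrite ler_wpM2r //; lra.
rewrite mulrC -ler_pdivlMr //; near: y.
apply/nbhs_ballP; exists (e / (L + 1)) => /=; first exact: divr_gt0.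
by move=> y /= /ltW.
Unshelve. all: by end_near. Qed.

Lemma density_le F p L x y u : measurable_fun setT p -> (forall u, `|p u| <= L) ->
  has_density F p -> x <= u <= y -> `|F u| <= `|F x| + L * (y - x).
Proof.
move=> mp pL dF /andP[xu uy]; have L0 : 0 <= L by apply: le_trans (pL 0); exact: normr_ge0.
rewrite -(subrK (F x) (F u)) addrC; apply: (le_trans (ler_normD _ _)).
rewrite lerD2l; apply: (le_trans (lipschitz_of_density mp pL dF xu)).
by rewrite ler_wpM2l // lerB.
Qed.

(** The defect [E x y] of the product rule is additive over adjacent intervals. Since F y G y - F x
    G x = G x (F y - F x) + F y (G y - G x), it is the integral of terms of order y - x, hence
    quadratically small, hence 0. *)
Lemma density_product F G p q L : measurable_fun setT p -> measurable_fun setT q ->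
  (forall u, `|p u| <= L) -> (forall u, `|q u| <= L) ->
  has_density F p -> has_density G q ->
  has_density (fun x => F x * G x) (fun x => p x * G x + F x * q x).
Proof.
move=> mp mq pL qL dF dG.
have L0 : 0 <= L by apply: le_trans (pL 0); exact: normr_ge0.
have mF := continuous_measurable_fun (density_continuous mp pL dF).
have mG := continuous_measurable_fun (density_continuous mq qL dG).
have lF := lipschitz_of_density mp pL dF; have lG := lipschitz_of_density mq qL dG.
have ms : measurable_fun setT (fun x => p x * G x + F x * q x).
  by apply: measurable_funD; apply: measurable_funM.
have bs x y u : x < u < y -> `|p u * G u + F u * q u| <=
    L * (`|G x| + L * (y - x)) + (`|F x| + L * (y - x)) * L.
  move=> /andP[/ltW xu /ltW uy]; have xuy : x <= u <= y by rewrite xu.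
  apply: (le_trans (ler_normD _ _)); rewrite !normrM.
  by apply: lerD; apply: ler_pM => //; exact: (density_le mp pL dF) || exact: (density_le mq qL dG).
pose E x y := F y * G y - F x * G x - \int[leb]_(u in `]x, y[) (p u * G u + F u * q u).
suff E0 x y : x <= y -> E x y = 0 by move=> x y /E0 /eqP; rewrite subr_eq0 => /eqP.
apply: (@additive_quadratic_eq0 _ E (L * L + L * L)).
  by move=> {}x {}y z xy yz; rewrite /E (Rintegral_oo_cat xy yz ms (@bs x z)); ring.
move=> {}x {}y xy; have yx0 : 0 <= y - x by rewrite subr_ge0.
have i1 : leb.-integrable `]x, y[ (fun u : R => (p u)%:E).
  by apply: (@bounded_integrable_oo _ L) => // u _.
have i2 : leb.-integrable `]x, y[ (fun u : R => (q u)%:E).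
  by apply: (@bounded_integrable_oo _ L) => // u _.
have is_ := bounded_integrable_oo ms (@bs x y).
have -> : E x y = \int[leb]_(u in `]x, y[) (G x * p u + F y * q u - (p u * G u + F u * q u)).
  rewrite RintegralB //; last by apply: lebiD => //; apply: lebi_mulrl.
  rewrite RintegralD //; [|exact: lebi_mulrl|exact: lebi_mulrl].
  by rewrite !RintegralZl // -dF // -dG // /E; ring.
rewrite expr2 mulrA; apply: le_normr_Rintegral_cst => //.
  by apply: measurable_funB => //; apply: measurable_funD; apply: measurable_funM.
move=> u /andP[/ltW xu /ltW uy].
have -> : G x * p u + F y * q u - (p u * G u + F u * q u) =
    p u * - (G u - G x) + q u * (F y - F u) by ring.
apply: (le_trans (ler_normD _ _)); rewrite !normrM mulrDl normrN -!mulrA.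
apply: lerD; apply: ler_pM => //.
  by apply: (le_trans (lG _ _ xu)); rewrite ler_wpM2l // lerB.
by apply: (le_trans (lF _ _ uy)); rewrite ler_wpM2l // lerB.
Qed.

Lemma expR_taylor1 (m x y : R) : x <= m -> y <= m ->
  `|expR y - expR x - expR x * (y - x)| <= expR m * (y - x) ^+ 2.
Proof.
move=> xm ym; have e1 (u v : R) : expR u * (v - u) <= expR v - expR u.
  rewrite lerBrDl -{1}[expR u]mulr1 -mulrDr -[in leRHS](subrKC u v) expRD.
  by rewrite ler_pM2l ?expR_gt0 // expR_ge1Dx.
have h1 := e1 x y; have h2 := e1 y x.
rewrite ger0_norm ?subr_ge0 //.
apply: (@le_trans _ _ ((expR y - expR x) * (y - x))); first by lra.
have [xy|yx] := leP x y.
  apply: (@le_trans _ _ (expR y * (y - x) * (y - x))); first by rewrite ler_wpM2r //; lra.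
  by rewrite -mulrA -expr2 ler_wpM2r ?sqr_ge0 // ler_expR.
apply: (@le_trans _ _ (expR x * (x - y) * (x - y))); last first.
  by rewrite -mulrA -expr2 (_ : (x - y) ^+ 2 = (y - x) ^+ 2) ?ler_wpM2r ?sqr_ge0 ?ler_expR //; ring.
rewrite -(opprB x y) mulrN -mulNr ler_wpM2r //; lra.
Qed.

(** As for products, the defect of the chain rule is additive and quadratically small: one
    contribution is the Taylor remainder of the exponential, the other the variation of [expR \o F]
    over the interval. *)
Lemma density_expR F p L M : measurable_fun setT p -> (forall u, `|p u| <= L) ->
  (forall u, F u <= M) -> has_density F p ->
  has_density (expR \o F) (fun x => p x * expR (F x)).
Proof.
move=> mp pL FM dF; have L0 : 0 <= L by apply: le_trans (pL 0); exact: normr_ge0.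
have mF := continuous_measurable_fun (density_continuous mp pL dF).
have lF := lipschitz_of_density mp pL dF.
have ms : measurable_fun setT (fun x => p x * expR (F x)).
  by apply: measurable_funM => //; exact: measurable_expR_comp.
have bs x y u : x < u < y -> `|p u * expR (F u)| <= L * expR M.
  by move=> _; rewrite normrM ler_pM // ger0_norm ?expR_ge0 // ler_expR.
pose E x y := expR (F y) - expR (F x) - \int[leb]_(u in `]x, y[) (p u * expR (F u)).
suff E0 x y : x <= y -> E x y = 0 by move=> x y /E0 /eqP; rewrite subr_eq0 => /eqP.
pose C := L * L * expR M.
have eM u v : u <= v -> `|expR (F v) - expR (F u)| <= L * expR M * (v - u).
  move=> uv; have [h|/ltW h] := leP (F u) (F v).
    rewrite ger0_norm ?subr_ge0 ?ler_expR //.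
    have := expR_ge1Dx (F u - F v); have ev := expR_gt0 (F v).
    move=> /(ler_wpM2l (ltW ev)); rewrite -expRD subrKC => hh.
    apply: (@le_trans _ _ (expR (F v) * (F v - F u))); first by lra.
    rewrite mulrAC [leRHS]mulrC ler_pM ?expR_ge0 ?ler_expR ?subr_ge0 //.
    by apply: le_trans (lF _ _ uv); exact: ler_norm.
  rewrite distrC ger0_norm ?subr_ge0 ?ler_expR //.
  have := expR_ge1Dx (F v - F u); have ev := expR_gt0 (F u).
  move=> /(ler_wpM2l (ltW ev)); rewrite -expRD subrKC => hh.
  apply: (@le_trans _ _ (expR (F u) * (F u - F v))); first by lra.
  rewrite mulrAC [leRHS]mulrC ler_pM ?expR_ge0 ?ler_expR ?subr_ge0 //.
  by apply: le_trans (lF _ _ uv); rewrite distrC; exact: ler_norm.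
apply: (@additive_quadratic_eq0 _ E (C + C)).
  by move=> {}x {}y z xy yz; rewrite /E (Rintegral_oo_cat xy yz ms (@bs x z)); ring.
move=> {}x {}y xy; have yx0 : 0 <= y - x by rewrite subr_ge0.
have i1 : leb.-integrable `]x, y[ (fun u : R => (p u)%:E).
  by apply: (@bounded_integrable_oo _ L) => // u _.
have is_ := bounded_integrable_oo ms (@bs x y).
have -> : E x y = (expR (F y) - expR (F x) - expR (F x) * (F y - F x)) +
    \int[leb]_(u in `]x, y[) (expR (F x) * p u - p u * expR (F u)).
  rewrite RintegralB //; last exact: lebi_mulrl.
  by rewrite RintegralZl // -dF // /E; ring.
apply: (le_trans (ler_normD _ _)); rewrite mulrDl lerD //.
  apply: (le_trans (expR_taylor1 (FM _) (FM _))).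
  rewrite /C mulrAC [leRHS]mulrC ler_wpM2l ?expR_ge0 // -expr2 -exprMn.
  by rewrite -real_normK ?num_real // ler_pXn2r ?nnegrE ?mulr_ge0 // lF.
rewrite expr2 mulrA; apply: le_normr_Rintegral_cst => //.
  by apply: measurable_funB => //; apply: measurable_funM.
move=> u /andP[/ltW xu /ltW uy].
rewrite mulrC -mulrBr normrM distrC /C -!mulrA; apply: ler_pM => //.
by apply: (le_trans (eM _ _ xu)); rewrite mulrA ler_wpM2l ?mulr_ge0 ?expR_ge0 // lerB.
Qed.

End density.

Lemma lebi_eq {R : realType} (D : set R) (f g : R -> \bar R) : measurable D ->
  (forall x, D x -> f x = g x) -> leb.-integrable D f -> leb.-integrable D g.
Proof.
by move=> mD fg; apply: eq_integrable => // x; rewrite inE => /fg.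
Qed.

Lemma lebi_ae_fin {R : realType} (D : set R) (f : R -> \bar R) : measurable D ->
  leb.-integrable D f -> {ae leb, forall x : R, D x -> f x \is a fin_num}.
Proof. by move=> mD fi; exact: (integrable_ae _ fi). Qed.

Lemma lebi_restrict {R : realType} (E D : set R) (f : R -> R) : measurable E ->
  measurable D -> leb.-integrable (E `&` D) (fun x : R => (f x)%:E) ->
  leb.-integrable E (fun x : R => ((f \_ D) x)%:E).
Proof.
move=> mE mD h; have := (@integrable_restrict _ _ _ leb D mD E mE (EFin \o f)).1 h.
by apply: lebi_eq => // x _; rewrite !patchE; case: ifP.
Qed.

(** The inequality is strict: a position taken at time [a] is held only after [a], so that step
    strategies are left-continuous and predictable. *)
Definition after {R : realType} (a u : R) : R := if a < u then 1 else 0.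

Lemma measurable_after {R : realType} (a : R) : measurable_fun setT (after a).
Proof. by apply: measurable_fun_ifT => //; exact: measurable_fun_ltr. Qed.

(** * Integral of a jump multiplied by a Lipschitz function *)

Section composite.
Context {R : realType}.
Implicit Types (a t u v x : R).
Variables (al M L : R) (g b phi : R -> R).
Hypotheses (al01 : 0 < al < 1) (cg : continuous g) (gM : forall x, `|g x| <= M).
Hypotheses (mphi : measurable_fun setT phi) (phiL : forall x, `|phi x| <= L).
Hypothesis bE : has_density b phi.
Hypothesis bM : forall x, `|b x| <= M.

Let al0 : 0 < al. Proof. by case/andP: al01. Qed.
Let al1 : al < 1. Proof. by case/andP: al01. Qed.
Ltac alra := have ? := al0; have ? := al1; lra.
Let M0 : 0 <= M. Proof. by apply: le_trans (gM 0); exact: normr_ge0. Qed.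
Let L0 : 0 <= L. Proof. by apply: le_trans (phiL 0); exact: normr_ge0. Qed.

Let iphi x y : leb.-integrable `]x, y[ (fun v : R => (phi v)%:E).
Proof.
apply: (@bounded_integrable _ _ _ L x y) => //; first exact: subset_itv_oo_cc.
exact: measurable_funTS.
Qed.

Let lip x y := @lipschitz_of_density _ _ phi L x y mphi phiL bE.

Let cb : continuous b. Proof. exact: density_continuous mphi phiL bE. Qed.

Let mb : measurable_fun setT b. Proof. exact: continuous_measurable_fun. Qed.

Let h a u := after a u * b u.

Let mh a : measurable_fun setT (h a).
Proof. by apply: measurable_funM => //; exact: (measurable_after a). Qed.

Let ipow x : 0 < x -> leb.-integrable `]0, x[ (fun u : R => ((x - u) `^ (- al))%:E).
Proof.
move=> x0; apply: lebi_ge0 => //.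
- by apply: measurable_funTS; apply: measurable_powR_comp; exact: measurable_funB.
- by move=> u _; exact: powR_ge0.
- by rewrite integral_powR_subl ?ltry ?ltW //; alra.
Qed.

Let h_le a x u : 0 <= a -> a < x -> 0 < u < x ->
  `|(h a x - h a u) * (x - u) `^ (- (1 + al))| <=
  L * (x - u) `^ (- al) + M * (x - a) `^ (- (1 + al)).
Proof.
move=> a_0 ax /andP[u0 ux]; rewrite /h /after ax mul1r normrM [`|_ `^ _|]ger0_norm ?powR_ge0 //.
have [au|ua] := ltP a u.
  rewrite mul1r; apply: (@le_trans _ _ (L * (x - u) `^ (- al))); last first.
    by rewrite lerDl mulr_ge0 ?powR_ge0.
  have xu : 0 < x - u by rewrite subr_gt0.
  apply: (@le_trans _ _ (L * (x - u) * (x - u) `^ (- (1 + al)))).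
    by rewrite ler_wpM2r ?powR_ge0 // lip // ltW.
  rewrite -mulrA -{1}(powRr1 (ltW xu)) -powRDp // (_ : 1 + - (1 + al) = - al) //; ring.
rewrite mul0r subr0; apply: (@le_trans _ _ (M * (x - a) `^ (- (1 + al)))); last first.
  by rewrite lerDr mulr_ge0 ?powR_ge0.
by rewrite ler_pM ?powR_ge0 // powR_nincr ?subr_gt0 //; alra.
Qed.

Lemma integrable_after_inner a x : 0 <= a -> 0 < x ->
  leb.-integrable `]0, x[ (fun u : R => ((h a x - h a u) * (x - u) `^ (- (1 + al)))%:E).
Proof.
move=> a_0 x0; have mk : measurable_fun setT (fun u => (h a x - h a u) * (x - u) `^ (- (1 + al))).
  apply: measurable_funM; first exact: (measurable_funB (measurable_cst _) (mh a)).
  by apply: measurable_powR_comp; exact: measurable_funB.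
have [ax|xa] := ltP a x; last first.
  apply: (@bounded_integrable _ _ _ 0 0 x) => //; first exact: subset_itv_oo_cc.
    exact: measurable_funTS.
  move=> u; rewrite /= in_itv /= => /andP[u0 ux].
  by rewrite /h /after ltNge xa ltNge (ltW (lt_le_trans ux xa)) /= !mul0r subrr mul0r normr0.
apply: (@lebi_dom _ _ _ (fun u => L * (x - u) `^ (- al) + M * (x - a) `^ (- (1 + al)))) => //.
- exact: measurable_funTS.
- by move=> u; rewrite /= in_itv /=; exact: h_le.
apply: lebiD => //; first by apply: lebi_mulrl => //; exact: ipow.
apply: (@bounded_integrable _ _ _ (M * (x - a) `^ (- (1 + al))) 0 x) => //.
  exact: subset_itv_oo_cc.
by move=> u _; rewrite ger0_norm // mulr_ge0 ?powR_ge0.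
Qed.

(* The left Marchaud derivative of [b] times the indicator of [ ]a, +oo[ ]: a jump of
   size [b a] at [a] plus a superposition of jumps [phi v dv]. *)
Lemma after_inner a x : 0 <= a -> a < x ->
  h a x * x `^ (- al) +
  al * \int[leb]_(u in `]0, x[) ((h a x - h a u) * (x - u) `^ (- (1 + al))) =
  b a * (x - a) `^ (- al) + \int[leb]_(v in `]a, x[) (phi v * (x - v) `^ (- al)).
Proof.
move=> a_0 ax; have x0 : 0 < x by exact: le_lt_trans ax.
have xa : 0 < x - a by rewrite subr_gt0.
have iI := integrable_after_inner a_0 x0.
have i2 : leb.-integrable `]a, x[ (fun u : R => ((h a x - h a u) * (x - u) `^ (- (1 + al)))%:E).
  by apply: integrableS iI => //; apply: subset_itvr; rewrite bnd_simp.
have kx p : measurable_fun setT (fun u => (x - u) `^ p).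
  by apply: measurable_powR_comp; exact: measurable_funB.
have al_n0 : - (1 + al) + 1 != 0 by rewrite lt_eqF //; alra.
have al_n : - (1 + al) + 1 = - al by ring.
have ilt v c : v < x -> c <= v -> leb.-integrable `]c, v[ (fun u : R => ((x - u) `^ (- (1 + al)))%:E) /\
    \int[leb]_(u in `]c, v[) ((x - u) `^ (- (1 + al))) = ((x - v) `^ (- al) - (x - c) `^ (- al)) / al.
  move=> vx cv; have E := integral_powR_subl_lt cv vx al_n0.
  split; last by rewrite /Rintegral E /= al_n; field; alra.
  apply: lebi_ge0 => //; first by apply: measurable_funTS; exact: kx.
    by move=> u _; exact: powR_ge0.
  by rewrite E ltry.
have E1 : \int[leb]_(u in `]0, a]) ((h a x - h a u) * (x - u) `^ (- (1 + al))) =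
    b x * (((x - a) `^ (- al) - x `^ (- al)) / al).
  have [i0 E0] := ilt _ _ ax a_0; rewrite subr0 in E0.
  transitivity (\int[leb]_(u in `]0, a]) (b x * (x - u) `^ (- (1 + al)))).
    apply: eq_Rintegral => u; rewrite inE /= in_itv /= => /andP[u0 ua].
    by rewrite /h /after ax ltNge ua mul1r mul0r subr0.
  rewrite -Rintegral_itv_bndo_bndc; last exact: lebi_mulrl.
  by rewrite RintegralZl // E0.
have ia : leb.-integrable `]a, x[ (fun u : R => ((x - u) `^ (- al))%:E).
  by apply: integrableS (ipow x0) => //; apply: subset_itvr; rewrite bnd_simp.
have iphia : leb.-integrable `]a, x[ (fun v : R => (phi v * (x - v) `^ (- al))%:E).
  apply: lebi_dom (lebi_mulrl L (measurable_itv _) ia) => //.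
    by apply: measurable_funTS; apply: measurable_funM.
  by move=> v _; rewrite normrM ler_pM // ger0_norm ?powR_ge0.
(* To the right of [a], b x - b u is the integral of [phi] over []u, x[]; exchanging the two
   integrals leaves an elementary power integral in u. *)
have E2 : \int[leb]_(u in `]a, x[) ((h a x - h a u) * (x - u) `^ (- (1 + al))) =
    (\int[leb]_(v in `]a, x[) (phi v * (x - v) `^ (- al)) - (x - a) `^ (- al) * (b x - b a)) / al.
  pose f (z : R * R) := phi z.2 * (x - z.1) `^ (- (1 + al)).
  have mf : measurable_fun setT f.
    apply: measurable_funM; first exact: measurableT_comp.
    by apply: measurable_powR_comp; exact: measurable_funB.
  have ffin : (\int[leb]_(u in `]a, x[) \int[leb]_(v in `]u, x[) `|f (u, v)|%:E < +oo)%E.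
    have mN : measurable_fun setT (fun z => `|f z|%:E).
      by apply/measurable_EFinP; apply: measurableT_comp.
    have N0 z : (0 <= `|f z|%:E)%E by rewrite lee_fin.
    have /integrableP[_] := lebi_mulrl L (measurable_itv _) ia.
    apply: le_lt_trans; apply: ge0_le_integral => //.
    - by move=> u _; apply: integral_ge0 => v _; exact: N0.
    - exact: (measurable_triangle_tonelli1 mN N0).
    - apply/measurable_funTS; apply: measurableT_comp => //; apply/measurable_EFinP.
      by apply: measurable_funM => //; exact: kx.
    move=> u; rewrite /= in_itv /= => /andP[au ux].
    have xu : 0 < x - u by rewrite subr_gt0.
    apply: (@le_trans _ _ (\int[leb]_(v in `]u, x[) (L * (x - u) `^ (- (1 + al)))%:E)%E).
      apply: ge0_le_integral => //.
        by apply/measurable_funTS/measurable_EFinP; apply: measurableT_comp => //; exact: (measurableT_comp mf).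
      move=> v _; rewrite lee_fin /f /= normrM ler_pM // ger0_norm ?powR_ge0 //.
    rewrite integral_cst //= lebesgue_measure_itv /= lte_fin ux -EFinB -EFinM lee_fin.
    rewrite ger0_norm ?mulr_ge0 ?powR_ge0 // -mulrA ler_wpM2l //.
    by rewrite -{2}(powRr1 (ltW xu)) -powRDp // al_n.
  transitivity (\int[leb]_(u in `]a, x[) \int[leb]_(v in `]u, x[) f (u, v)).
    apply: eq_Rintegral => u; rewrite inE /= in_itv /= => /andP[au ux].
    by rewrite /h /after ax au !mul1r bE ?ltW // -RintegralZr.
  rewrite triangle_fubini //.
  transitivity (\int[leb]_(v in `]a, x[) (al^-1 * (phi v * (x - v) `^ (- al)) -
      ((x - a) `^ (- al) / al) * phi v)).
    apply: eq_Rintegral => v; rewrite inE /= in_itv /= => /andP[av vx].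
    have [iv Ev] := ilt _ _ vx (ltW av).
    by rewrite /f /= RintegralZl // Ev; field; alra.
  rewrite RintegralB //; [|exact: lebi_mulrl|exact: lebi_mulrl].
  rewrite !RintegralZl // -bE ?ltW //; field; alra.
have := @Rintegral_itvB R _ (BRight 0) (BLeft x) a iI.
rewrite !bnd_simp => /(_ a_0 ax) /(canRL (subrK _)) ->.
rewrite E1 E2 /h /after ax mul1r; field; alra.
Qed.

Section outer.
Variable t : R.
Hypothesis t0 : 0 < t.
Hypothesis fin0 : marchaud_finite al g 0 t.
Local Notation K := (marchaud al g t).

Let iK : leb.-integrable `]0, t[ (fun x : R => (K x)%:E).
Proof.
have := integrable_abse (integrable_marchaud_step al01 cg gM t0 fin0).
move=> /(lebi_mulrl (t `^ al) (measurable_itv _)).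
apply: lebi_dom => //; first exact: measurable_marchaud.
move=> x; rewrite /= in_itv /= subr0 => /andP[x0 xt].
rewrite normrM [`|_ `^ _|]ger0_norm ?powR_ge0 // mulrA ler_peMl //.
have -> : 1 = x `^ al * x `^ (- al) by rewrite -powRDp // subrr powRr0.
by rewrite ler_wpM2r ?powR_ge0 // ge0_ler_powR ?nnegrE ?ltW.
Qed.

Let gap (z : R * R) : R := `|g z.2 - g z.1| * (z.2 - z.1) `^ (al - 2).

Let mgap : measurable_fun setT gap.
Proof.
have mg := continuous_measurable_fun cg.
apply: measurable_funM.
  by apply: measurableT_comp => //; apply: measurable_funB; apply: (measurableT_comp mg).
by apply: measurable_powR_comp; apply: measurable_funB.
Qed.

Let H x : \bar R := (\int[leb]_(u in `]x, t[) (gap (x, u))%:E)%E.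

Let gap0 z : (0 <= (gap z)%:E)%E. Proof. by rewrite lee_fin mulr_ge0 ?powR_ge0. Qed.

Let H0 x : (0 <= H x)%E. Proof. exact: integral_ge0. Qed.

Let mH : measurable_fun `]0, t[ H.
Proof.
have mE : measurable_fun setT (EFin \o gap) by exact/measurable_EFinP.
exact: (measurable_triangle_tonelli1 mE gap0).
Qed.

Let inner_gap (c : R) x : 0 <= c ->
  (\int[leb]_(u in `]x, t[) (c * (`|g u - g x| * (u - x) `^ (al - 2)))%:E = c%:E * H x)%E.
Proof.
move=> c0; under eq_integral do rewrite EFinM.
rewrite ge0_integralZl //; last by move=> u _; exact: (gap0 (x, u)).
apply/measurable_funTS/measurable_EFinP.
have mg := continuous_measurable_fun cg.
apply: measurable_funM; first by apply: measurableT_comp => //; exact: measurable_funB.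
by apply: measurable_powR_comp; exact: measurable_funB.
Qed.

(** Integrate the condition over its base point v. The integral of (x - v)^(- al) over v in []0, x[]
    is x^(1 - al) / (1 - al), at most a constant times the weight x^(- al) of the base point 0. So
    finiteness at 0 yields finiteness at almost every v. *)
Lemma ae_marchaud_finite : {ae leb, forall v : R, v \in `]0, t[ -> marchaud_finite al g v t}.
Proof.
pose Ht := H \_ `]0, t[.
have mHt : measurable_fun setT Ht by apply/(measurable_restrictT _ _).1.
have Ht0 x : (0 <= Ht x)%E by apply: erestrict_ge0.
pose F (z : R * R) : \bar R := (((z.2 - z.1) `^ (- al))%:E * Ht z.2)%E.
have mF : measurable_fun setT F.
  apply: emeasurable_funM; last exact: (measurableT_comp mHt).
  by apply/measurable_EFinP; apply: measurable_powR_comp; exact: measurable_funB.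
have F0 z : (0 <= F z)%E by rewrite mule_ge0 ?lee_fin ?powR_ge0.
have mI := measurable_triangle_tonelli1 mF F0.
have fin : (\int[leb]_(v in `]0%R, t[) \int[leb]_(x in `]v, t[) F (v, x) < +oo)%E.
  have -> := triangle_tonelli 0 t mF F0.
  have C0 : 0 <= t / (1 - al) by rewrite divr_ge0 ?ltW //; alra.
  have : ((t / (1 - al))%:E * \int[leb]_(x in `]0%R, t[) ((x `^ (- al))%:E * H x) < +oo)%E.
    apply: lte_mul_pinfty => //; move: fin0; rewrite /marchaud_finite => fin0'.
    apply: le_lt_trans fin0'; rewrite le_eqVlt; apply/orP; left; apply/eqP.
    by apply: eq_integral => x _; rewrite subr0 inner_gap ?powR_ge0.
  apply: le_lt_trans; rewrite -ge0_integralZl //; first last.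
  - by move=> x _; rewrite mule_ge0 ?lee_fin ?powR_ge0.
  - apply: emeasurable_funM => //; apply/measurable_funTS/measurable_EFinP.
    exact: measurable_powR.
  apply: ge0_le_integral => //.
  - by move=> x _; exact: integral_ge0.
  - exact: (measurable_triangle_tonelli2 mF F0).
  - apply: emeasurable_funM => //; apply: emeasurable_funM => //.
    by apply/measurable_funTS/measurable_EFinP; exact: measurable_powR.
  move=> x xt; have := xt; rewrite /= in_itv /= => /andP[x0 x_t].
  rewrite /F /=; under eq_integral do rewrite muleC.
  have mp : measurable_fun setT (fun u : R => (x - u) `^ (- al)).
    by apply: measurable_powR_comp; exact: measurable_funB.
  rewrite ge0_integralZl //; first last.
  - by move=> u _; rewrite lee_fin powR_ge0.
  - exact/measurable_funTS/measurable_EFinP.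
  rewrite (integral_powR_subl (ltW x0)); last by alra.
  rewrite /Ht patchE mem_set // muleC muleA -EFinM lee_wpmul2r // lee_fin subr0.
  rewrite (powRDp _ _ x0) (powRr1 (ltW x0)) [leRHS]mulrAC (_ : - al + 1 = 1 - al); last by ring.
  rewrite ler_wpM2r ?invr_ge0 //; first by alra.
  by rewrite mulrC ler_wpM2r ?powR_ge0 // ltW.
have iI : leb.-integrable `]0, t[ (fun v : R => (\int[leb]_(x in `]v, t[) F (v, x))%E).
  apply/integrableP; split; first exact: mI.
  apply: le_lt_trans fin; rewrite le_eqVlt; apply/orP; left; apply/eqP.
  by apply: eq_integral => v _; rewrite gee0_abs //; exact: integral_ge0.
have [N [mN N0 subN]] := lebi_ae_fin (measurable_itv _) iI.
exists N; split => // v /= hv; apply: subN => /= hfin; apply: hv => vt.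
have {}hfin := hfin vt; move: (vt); rewrite in_itv /= => /andP[v0 v_t].
rewrite /marchaud_finite -ge0_fin_numE; last first.
  apply: integral_ge0 => x _; apply: integral_ge0 => u _.
  by rewrite lee_fin !mulr_ge0 ?powR_ge0.
apply: etrans hfin; congr (_ \is a fin_num); apply: eq_integral => x.
rewrite inE /= in_itv /= => /andP[vx xt]; rewrite inner_gap ?powR_ge0 // /F /= /Ht patchE mem_set //=.
by rewrite in_itv /= xt (lt_trans v0 vx).
Qed.

(** The first factor of the integrand of [gls_integral]: the left Marchaud derivative of order [al],
    up to the factor 1 / Gamma(1 - al). *)
Definition gls_left (f : R -> R) x : R := f x / x `^ al +
  al * \int[leb]_(u in `]0, x[) ((f x - f u) / (x - u) `^ (1 + al)).

Let gls_leftE (f : R -> R) x : gls_left f x = f x * x `^ (- al) +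
  al * \int[leb]_(u in `]0, x[) ((f x - f u) * (x - u) `^ (- (1 + al))).
Proof.
rewrite /gls_left -powRN; congr (_ + _ * _).
by apply: eq_Rintegral => u _; rewrite -powRN.
Qed.

(** The integral of [h a] against [g], integrated by parts: a jump of size [b a] at [a] and
    infinitesimal jumps [phi v dv] at the later times v, where a unit jump at v contributes g t - g
    v. *)
Definition after_integral a : R :=
  if a < t then b a * (g t - g a) + \int[leb]_(v in `]a, t[) (phi v * (g t - g v)) else 0.

(** By [after_inner] the left derivative of [h a] is a superposition of those of jumps. Fubini's
    theorem reduces the claim to [Rintegral_marchaud_step] at [a], where finiteness is assumed, and
    at almost every later time v, where it comes from [ae_marchaud_finite]. *)
Lemma gls_left_after a : 0 <= a -> (a < t -> marchaud_finite al g a t) ->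
  leb.-integrable `]0, t[ (fun x : R => (gls_left (h a) x * K x)%:E) /\
  \int[leb]_(x in `]0, t[) (gls_left (h a) x * K x) = beta_cst al * after_integral a.
Proof.
move=> a_0 fina; have Z x : x <= a -> gls_left (h a) x = 0.
  move=> xa; rewrite gls_leftE /h /after ltNge xa /= !mul0r add0r.
  transitivity (al * \int[leb]_(u in `]0, x[) (cst 0 : R -> R) u); last first.
    by rewrite Rintegral_cst // mul0r mulr0.
  congr (_ * _); apply: eq_Rintegral => u.
  rewrite inE /= in_itv /= => /andP[_ ux].
  by rewrite ltNge (ltW (lt_le_trans ux xa)) /= mul0r subrr mul0r.
have [at_|ta] := ltP a t; last first.
  have Z' x : x \in `]0, t[%classic -> gls_left (h a) x * K x = 0.
    by rewrite inE /= in_itv /= => /andP[_ xt]; rewrite Z ?mul0r // (ltW (lt_le_trans xt ta)).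
  rewrite /after_integral ltNge ta /= mulr0; split.
    have i0 : leb.-integrable `]0, t[ (fun x : R => 0%:E).
      apply: (@bounded_integrable _ _ _ 0 0 t) => //; first exact: subset_itv_oo_cc.
      by move=> x _; rewrite normr0.
    by apply: eq_integrable i0 => // x xt; rewrite Z'.
  transitivity (\int[leb]_(x in `]0, t[) (cst 0 : R -> R) x); first exact: eq_Rintegral.
  by rewrite Rintegral_cst // mul0r.
have {}fina := fina at_.
have sub : `]a, t[%classic `<=` `]0, t[%classic by apply: subset_itvr; rewrite bnd_simp.
have eI : `]0, t[%classic `&` `]a, t[%classic = `]a, t[%classic.
  by apply/setIidPr.
have E0 x : x \in `]0, t[%classic ->
    gls_left (h a) x * K x = ((fun x => gls_left (h a) x * K x) \_ `]a, t[) x.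
  rewrite inE /= in_itv /= => /andP[x0 xt]; rewrite patchE; case: ifPn => //.
  rewrite notin_setE /= in_itv /= xt andbT => /negP; rewrite -leNgt => xa.
  by rewrite Z ?mul0r.
pose Kt := K \_ `]a, t[.
have mKt : measurable_fun setT Kt.
  by apply/(measurable_restrictT _ _).1 => //; apply: measurable_marchaud.
pose f (z : R * R) := phi z.1 * ((z.2 - z.1) `^ (- al) * Kt z.2).
have mf : measurable_fun setT f.
  apply: measurable_funM; first exact: measurableT_comp.
  apply: measurable_funM; last exact: (measurableT_comp mKt).
  by apply: measurable_powR_comp; exact: measurable_funB.
have iKa : leb.-integrable `]a, t[ (fun x : R => (K x)%:E) by apply: integrableS iK.
have ffin : (\int[leb]_(v in `]a, t[) \int[leb]_(x in `]v, t[) `|f (v, x)|%:E < +oo)%E.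
  have mN : measurable_fun setT (fun z => `|f z|%:E).
    by apply/measurable_EFinP; apply: measurableT_comp.
  have N0 z : (0 <= `|f z|%:E)%E by rewrite lee_fin.
  have -> := triangle_tonelli a t mN N0.
  have /integrableP[_] := lebi_mulrl (L * ((t - a) `^ (1 - al) / (1 - al))) (measurable_itv _) iKa.
  apply: le_lt_trans; apply: ge0_le_integral => //.
  - by move=> x _; apply: integral_ge0 => v _; exact: N0.
  - exact: (measurable_triangle_tonelli2 mN N0).
  - apply: measurableT_comp => //; apply/measurable_EFinP.
    by apply: measurable_funM => //; exact: measurable_marchaud.
  move=> x axt; have := axt; rewrite /= in_itv /= => /andP[ax x_t].
  apply: (@le_trans _ _ (\int[leb]_(v in `]a, x[) ((L * `|K x|)%:E * ((x - v) `^ (- al))%:E))%E).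
    apply: ge0_le_integral => //.
    - have mfx : measurable_fun setT (fun v : R => f (v, x)).
        rewrite /f /=; move: (Kt x) => k; apply: (measurable_funM mphi); apply: measurable_funM => //.
        by apply: measurable_powR_comp; exact: measurable_funB.
      by apply/measurable_funTS/measurable_EFinP; exact: (measurableT_comp (@normr_measurable R setT) mfx).
    - apply: emeasurable_funM => //; apply/measurable_funTS/measurable_EFinP.
      by apply: measurable_powR_comp; exact: measurable_funB.
    move=> v _; rewrite -EFinM lee_fin /f /= /Kt patchE mem_set // !normrM.
    rewrite [`|_ `^ _|]ger0_norm ?powR_ge0 // mulrCA mulrC [leRHS]mulrC.
    by rewrite [leRHS]mulrC ler_wpM2r ?powR_ge0 // ler_wpM2r.
  have mp : measurable_fun setT (fun u : R => (x - u) `^ (- al)).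
    by apply: measurable_powR_comp; exact: measurable_funB.
  rewrite ge0_integralZl //; first last.
  - by rewrite lee_fin mulr_ge0.
  - by move=> u _; rewrite lee_fin powR_ge0.
  - exact/measurable_funTS/measurable_EFinP.
  rewrite (integral_powR_subl (ltW ax)); last by alra.
  rewrite -EFinM lee_fin normrM [in leRHS]ger0_norm; last first.
    by rewrite mulr_ge0 // divr_ge0 ?powR_ge0 //; alra.
  rewrite [leLHS]mulrAC ler_wpM2r // ler_wpM2l // (_ : - al + 1 = 1 - al); last by ring.
  by rewrite ler_wpM2r ?invr_ge0 ?ge0_ler_powR ?nnegrE //; alra.
have inner x : a < x < t -> \int[leb]_(v in `]a, x[) f (v, x) =
    \int[leb]_(v in `]a, x[) (phi v * (x - v) `^ (- al)) * K x.
  move=> axt; have x0 : 0 < x by case/andP: axt => /(le_lt_trans a_0).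
  rewrite -RintegralZr //; last first.
    have ia : leb.-integrable `]a, x[ (fun u : R => ((x - u) `^ (- al))%:E).
      by apply: integrableS (ipow x0) => //; apply: subset_itvr; rewrite bnd_simp.
    apply: lebi_dom (lebi_mulrl L (measurable_itv _) ia) => //.
      apply: measurable_funTS; apply: measurable_funM => //.
      by apply: measurable_powR_comp; exact: measurable_funB.
    by move=> v _; rewrite normrM ler_pM // ger0_norm ?powR_ge0.
  by apply: eq_Rintegral => v _; rewrite /f /= /Kt patchE mem_set //= mulrA.
have ibnd : leb.-integrable `]a, t[ (fun v : R => (phi v * (g t - g v))%:E).
  apply: (@bounded_integrable _ _ _ (L * (M + M)) a t) => //; first exact: subset_itv_oo_cc.
    apply/measurable_funTS/measurable_funM => //; apply: measurable_funB => //.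
    exact: continuous_measurable_fun.
  by move=> v _; rewrite normrM ler_pM // (le_trans (ler_normB _ _)) // lerD.
have outer : \int[leb]_(v in `]a, t[) \int[leb]_(x in `]v, t[) f (v, x) =
    beta_cst al * \int[leb]_(v in `]a, t[) (phi v * (g t - g v)).
  rewrite -RintegralZl //; rewrite /Rintegral; congr fine.
  apply: ae_eq_integral => //.
  - by apply/measurable_EFinP; have /integrableP[/measurable_EFinP] := triangle_integrable1 mf ffin.
  - by apply/measurable_EFinP; have /integrableP[/measurable_EFinP] := lebi_mulrl (beta_cst al) (measurable_itv _) ibnd.
  have h1 := leb_ae_imply ae_marchaud_finite; apply: h1 => v finv /= vt.
  have v0t : v \in `]0, t[ by move: vt; rewrite !in_itv /= => /andP[av ->]; rewrite (le_lt_trans a_0 av).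
  have vlt : v < t by move: v0t; rewrite in_itv /= => /andP[].
  have finv' := finv v0t.
  congr EFin; rewrite [RHS]mulrCA [beta_cst _ * _]mulrC -(Rintegral_marchaud_step al01 cg gM vlt finv').
  rewrite -RintegralZl //; last exact: (integrable_marchaud_step al01 cg gM vlt finv').
  apply: eq_Rintegral => x; rewrite inE /= in_itv /= => /andP[vx xt].
  rewrite /f /= /Kt patchE mem_set //= in_itv /= xt andbT (lt_trans _ vx) //.
  by move: vt; rewrite in_itv /= => /andP[].
have i2 := triangle_integrable2 mf ffin.
have i1 := integrable_marchaud_step al01 cg gM at_ fina.
have E1 x : x \in `]a, t[%classic -> gls_left (h a) x * K x =
    b a * ((x - a) `^ (- al) * K x) + \int[leb]_(v in `]a, x[) f (v, x).
  rewrite inE /= in_itv /= => axt; rewrite inner // gls_leftE after_inner //; last by case/andP: axt.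
  by ring.
have i12 : leb.-integrable `]a, t[ (fun x : R => (gls_left (h a) x * K x)%:E).
  have := lebiD (measurable_itv _) (lebi_mulrl (b a) (measurable_itv _) i1) i2.
  by apply: eq_integrable => // x xt; rewrite E1.
split.
  have i3 : leb.-integrable `]0, t[
      (fun x : R => (((fun x : R => gls_left (h a) x * K x) \_ `]a, t[) x)%:E).
    by apply: lebi_restrict => //; rewrite eI.
  by apply: (lebi_eq (measurable_itv _) _ i3) => x xt; rewrite -(E0 x (mem_set xt)).
transitivity (\int[leb]_(x in `]0, t[) ((fun x : R => gls_left (h a) x * K x) \_ `]a, t[) x).
  exact: eq_Rintegral.
rewrite -Rintegral_mkcondr eI.
transitivity (\int[leb]_(x in `]a, t[) (b a * ((x - a) `^ (- al) * K x) +
    \int[leb]_(v in `]a, x[) f (v, x))); first exact: eq_Rintegral.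
rewrite RintegralD //; last exact: lebi_mulrl.
rewrite RintegralZl // (Rintegral_marchaud_step al01 cg gM at_ fina).
by rewrite -triangle_fubini // outer /after_integral at_; ring.
Qed.

End outer.

End composite.

(** * The generalized Lebesgue-Stieltjes integral of step strategies *)

Section gls_ok.
Context {R : realType}.
Implicit Types (a t s u x al c : R) (f g : R -> R).

Definition gls_norm_density al f s : \bar R :=
  ((`|f s| / s `^ al)%:E +
   \int[leb]_(z in `]0%R, s[) (`|f s - f z| / (s - z) `^ (1 + al))%:E)%E.

Lemma gls_norm_density_ge0 al f s : (0 <= gls_norm_density al f s)%E.
Proof.
apply: adde_ge0; first by rewrite lee_fin divr_ge0 ?powR_ge0.
by apply: integral_ge0 => z _; rewrite lee_fin divr_ge0 ?powR_ge0.
Qed.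

Let mvariation al f : measurable_fun setT f ->
  measurable_fun setT (fun z : R * R => `|f z.2 - f z.1| / (z.2 - z.1) `^ (1 + al)).
Proof.
move=> mf; under eq_fun do rewrite -powRN; apply: measurable_funM.
  by apply: measurableT_comp => //; apply: measurable_funB; apply: (measurableT_comp mf).
by apply: measurable_powR_comp; exact: measurable_funB.
Qed.

Let mvariation1 al f s : measurable_fun setT f ->
  measurable_fun setT (fun z : R => `|f s - f z| / (s - z) `^ (1 + al)).
Proof.
move=> mf; under eq_fun do rewrite -powRN; apply: measurable_funM.
  by apply: measurableT_comp => //; exact: measurable_funB.
by apply: measurable_powR_comp; exact: measurable_funB.
Qed.

Lemma measurable_gls_norm_density al f t : measurable_fun setT f ->
  measurable_fun `]0, t[ (gls_norm_density al f).
Proof.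
move=> mf; apply: emeasurable_funD.
  apply/measurable_funTS/measurable_EFinP; under eq_fun do rewrite -powRN.
  apply: measurable_funM; first exact: measurableT_comp.
  exact: measurable_powR.
have mE : measurable_fun setT (fun z : R * R => (`|f z.2 - f z.1| / (z.2 - z.1) `^ (1 + al))%:E).
  by apply/measurable_EFinP; exact: mvariation.
apply: (measurable_triangle_tonelli2 mE) => z.
by rewrite lee_fin divr_ge0 ?powR_ge0.
Qed.

Lemma gls_norm_linear al t c f f' : measurable_fun setT f -> measurable_fun setT f' ->
  (gls_norm al t f < +oo)%E -> (gls_norm al t f' < +oo)%E ->
  (gls_norm al t (fun s => c * f s + f' s)%R < +oo)%E.
Proof.
move=> mf mf' fi fi'.
have mD f1 : measurable_fun setT f1 -> measurable_fun `]0, t[ (gls_norm_density al f1).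
  exact: measurable_gls_norm_density.
have mcf : measurable_fun setT (fun s => c * f s + f' s).
  by apply: measurable_funD => //; exact: measurable_funM.
have cE : (0 <= `|c|%:E)%E by rewrite lee_fin.
have bound s : (gls_norm_density al (fun s => c * f s + f' s)%R s <=
    `|c|%:E * gls_norm_density al f s + gls_norm_density al f' s)%E.
  have n0 f1 z : (0 <= (`|f1 s - f1 z| / (s - z) `^ (1 + al))%:E)%E.
    by rewrite lee_fin divr_ge0 ?powR_ge0.
  rewrite ge0_muleDr ?lee_fin ?divr_ge0 ?powR_ge0 //; last exact: integral_ge0.
  rewrite addeACA; apply: leeD.
    rewrite -EFinM -EFinD lee_fin mulrA -mulrDl ler_wpM2r ?invr_ge0 ?powR_ge0 //.
    by rewrite -normrM ler_normD.
  rewrite -ge0_integralZl //; last first.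
    by apply/measurable_funTS/measurable_EFinP; exact: mvariation1.
  rewrite -ge0_integralD //; last 3 first.
  - by move=> z _; rewrite mule_ge0.
  - apply/measurable_funTS; apply: emeasurable_funM => //.
    by apply/measurable_EFinP; exact: mvariation1.
  - by apply/measurable_funTS/measurable_EFinP; exact: mvariation1.
  apply: ge0_le_integral => //.
  - by move=> z _; rewrite lee_fin divr_ge0 ?powR_ge0.
  - by apply/measurable_funTS/measurable_EFinP; exact: (mvariation1 al s mcf).
  - apply/measurable_funTS; apply: emeasurable_funD; last by apply/measurable_EFinP; exact: mvariation1.
    by apply: emeasurable_funM => //; apply/measurable_EFinP; exact: mvariation1.
  move=> z _; rewrite -EFinM -EFinD lee_fin mulrA -mulrDl ler_wpM2r ?invr_ge0 ?powR_ge0 //.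
  rewrite (_ : c * f s + f' s - (c * f z + f' z) = c * (f s - f z) + (f' s - f' z)); last by ring.
  by rewrite -normrM ler_normD.
have : (`|c|%:E * gls_norm al t f + gls_norm al t f' < +oo)%E.
  by apply: lte_add_pinfty fi'; exact: (lte_mul_pinfty cE _ fi).
apply: le_lt_trans; rewrite /gls_norm -ge0_integralZl //; last 2 first.
- exact: mD.
- by move=> s _; exact: gls_norm_density_ge0.
have Z0 f1 s : (0 <= gls_norm_density al f1 s)%E by exact: gls_norm_density_ge0.
rewrite -ge0_integralD //; last 4 first.
- by move=> s _; rewrite mule_ge0 //; exact: Z0.
- by apply: emeasurable_funM => //; exact: mD.
- by move=> s _; exact: Z0.
- exact: mD.
apply: ge0_le_integral => //.
- by move=> s _; exact: Z0.
- exact: mD.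
- by apply: emeasurable_funD; [apply: emeasurable_funM => //; exact: mD|exact: mD].
- by move=> s _; exact: bound.
Qed.

(** Membership with value [I], in a form stable under linear combinations: the real-valued integrals
    are additive only for integrable functions, so integrability of the inner and of the outer
    integrand is carried along. The value is stated before the division by the Gamma product. *)
Record gls_ok al t g f (I : R) : Prop := {
  gls_ok_measurable : measurable_fun setT f ;
  gls_ok_norm : (gls_norm al t f < +oo)%E ;
  gls_ok_inner : forall x, 0 < x -> leb.-integrable `]0, x[
    (fun u : R => ((f x - f u) * (x - u) `^ (- (1 + al)))%:E) ;
  gls_ok_outer : leb.-integrable `]0, t[ (fun x : R => (gls_left al f x * marchaud al g t x)%:E) ;
  gls_ok_val : \int[leb]_(x in `]0, t[) (gls_left al f x * marchaud al g t x) = beta_cst al * I }.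

Let gls_leftE al f x : gls_left al f x = f x * x `^ (- al) +
  al * \int[leb]_(u in `]0, x[) ((f x - f u) * (x - u) `^ (- (1 + al))).
Proof.
rewrite /gls_left -powRN; congr (_ + _ * _).
by apply: eq_Rintegral => u _; rewrite -powRN.
Qed.

Lemma gls_ok_linear al t g c f f' I I' : gls_ok al t g f I -> gls_ok al t g f' I' ->
  gls_ok al t g (fun s => c * f s + f' s) (c * I + I').
Proof.
move=> [mf nf inf of_ vf] [mf' nf' inf' of' vf'].
have inner x : 0 < x -> leb.-integrable `]0, x[
    (fun u : R => (c * ((f x - f u) * (x - u) `^ (- (1 + al))) +
                   (f' x - f' u) * (x - u) `^ (- (1 + al)))%:E).
  by move=> x0; apply: lebiD => //; [apply: lebi_mulrl => //; exact: inf|exact: inf'].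
have E u x : (c * f x + f' x - (c * f u + f' u)) * (x - u) `^ (- (1 + al)) =
    c * ((f x - f u) * (x - u) `^ (- (1 + al))) + (f' x - f' u) * (x - u) `^ (- (1 + al)).
  by ring.
have lin x : 0 < x -> gls_left al (fun s => c * f s + f' s) x = c * gls_left al f x + gls_left al f' x.
  move=> x0; rewrite !gls_leftE; under eq_Rintegral do rewrite E.
  rewrite RintegralD //; [|by apply: lebi_mulrl => //; exact: inf|exact: inf'].
  by rewrite RintegralZl //; [ring|exact: inf].
have lin' x : `]0, t[%classic x -> c * (gls_left al f x * marchaud al g t x) +
    gls_left al f' x * marchaud al g t x =
    gls_left al (fun s => c * f s + f' s) x * marchaud al g t x.
  by rewrite /= in_itv /= => /andP[x0 _]; rewrite lin //; ring.
split.
- by apply: measurable_funD => //; exact: measurable_funM.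
- exact: gls_norm_linear.
- by move=> x x0; apply: (lebi_eq _ _ (inner x x0)) => // u _; rewrite E.
- have := lebiD (measurable_itv _) (lebi_mulrl c (measurable_itv _) of_) of'.
  by apply: (lebi_eq (measurable_itv _)) => x xt; rewrite lin'.
- transitivity (\int[leb]_(x in `]0, t[) (c * (gls_left al f x * marchaud al g t x) +
      gls_left al f' x * marchaud al g t x)).
    by apply: eq_Rintegral => x; rewrite inE => /lin'.
  rewrite RintegralD //; last exact: lebi_mulrl.
  by rewrite RintegralZl // vf vf'; ring.
Qed.

Let i0 (D : set R) : measurable D -> leb.-integrable D (fun=> 0%:E).
Proof. by move=> mD; exact: integrable0. Qed.

Lemma gls_ok0 al t g : gls_ok al t g (cst 0) 0.
Proof.
have L0 x : gls_left al (cst 0) x = 0.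
  rewrite gls_leftE /= mul0r add0r; under eq_Rintegral do rewrite subrr mul0r.
  by rewrite Rintegral_cst // mul0r mulr0.
split.
- exact: measurable_cst.
- rewrite /gls_norm integral0_eq // => s _; rewrite /= normr0 mul0r add0e.
  by rewrite integral0_eq // => z _; rewrite subrr normr0 mul0r.
- move=> x x0; apply: (lebi_eq _ _ (i0 (measurable_itv _))) => // u _.
  by rewrite /= subrr mul0r.
- by apply: (lebi_eq _ _ (i0 (measurable_itv _))) => // x _; rewrite L0 mul0r.
- by under eq_Rintegral do rewrite L0 mul0r; rewrite Rintegral_cst // mul0r mulr0.
Qed.

Lemma gls_okP al t g f I : 0 < al < 1 -> gls_ok al t g f I ->
  gls_integrable al t f /\ gls_integral al t f g = I.
Proof.
move=> al01 [mf nf _ _ vf]; split; first by split => //; exact: measurable_funTS.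
rewrite /gls_integral (Gamma_mul_onem al01).
apply: (@etrans _ _ ((beta_cst al)^-1 * (beta_cst al * I))); first by congr (_ * _).
by rewrite mulKf // gt_eqF // beta_cst_gt0.
Qed.

Section after.
Variables (al M L : R) (g b phi : R -> R).
Hypotheses (al01 : 0 < al < 1) (cg : continuous g) (gM : forall x, `|g x| <= M).
Hypotheses (mphi : measurable_fun setT phi) (phiL : forall x, `|phi x| <= L).
Hypothesis dbphi : has_density b phi.
Hypothesis bM : forall x, `|b x| <= M.

Let al0 : 0 < al. Proof. by case/andP: al01. Qed.
Let al1 : al < 1. Proof. by case/andP: al01. Qed.
Ltac alra := have ? := al0; have ? := al1; lra.
Let M0 : 0 <= M. Proof. by apply: le_trans (gM 0); exact: normr_ge0. Qed.
Let L0 : 0 <= L. Proof. by apply: le_trans (phiL 0); exact: normr_ge0. Qed.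

Let h a u := after a u * b u.

Let mh a : measurable_fun setT (h a).
Proof.
apply: measurable_funM; first exact: measurable_after.
exact: continuous_measurable_fun (density_continuous mphi phiL dbphi).
Qed.

Let variation_before a s : 0 <= a -> a < s ->
  (\int[leb]_(z in `]0%R, a]) (M * (s - z) `^ (- (1 + al)))%:E <= (M / al * (s - a) `^ (- al))%:E)%E.
Proof.
move=> a_0 as_; have mp : measurable_fun setT (fun z : R => (s - z) `^ (- (1 + al))).
  by apply: measurable_powR_comp; exact: measurable_funB.
rewrite -integral_itv_bndo_bndc; last first.
  by apply/measurable_funTS/measurable_EFinP; exact: measurable_funM.
under eq_integral do rewrite EFinM; rewrite ge0_integralZl //; last 2 first.
- exact/measurable_funTS/measurable_EFinP.
- by move=> z _; rewrite lee_fin powR_ge0.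
rewrite integral_powR_subl_lt //; last by rewrite lt_eqF //; alra.
rewrite -EFinM lee_fin subr0 -mulrA ler_wpM2l // (_ : - (1 + al) + 1 = - al); last by ring.
rewrite invrN mulrN -mulNr opprB [leRHS]mulrC ler_wpM2r //; first by rewrite invr_ge0 ltW.
by rewrite gerBl powR_ge0.
Qed.

Let variation_after a s : 0 <= a -> a < s ->
  (\int[leb]_(z in `]a, s[) (L * (s - z) `^ (- al))%:E <= (L * (s `^ (1 - al) / (1 - al)))%:E)%E.
Proof.
move=> a_0 as_; have mp : measurable_fun setT (fun z : R => (s - z) `^ (- al)).
  by apply: measurable_powR_comp; exact: measurable_funB.
under eq_integral do rewrite EFinM; rewrite ge0_integralZl //; last 2 first.
- exact/measurable_funTS/measurable_EFinP.
- by move=> z _; rewrite lee_fin powR_ge0.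
rewrite (integral_powR_subl (ltW as_)); last by alra.
rewrite -EFinM lee_fin (_ : - al + 1 = 1 - al) ?ler_wpM2l //; last by ring.
have s0 : 0 <= s by apply: ltW; exact: le_lt_trans as_.
by rewrite ler_wpM2r ?invr_ge0 ?ge0_ler_powR ?nnegrE //; alra.
Qed.

(** Split at the jump. For z <= a the increment is [b s], bounded by [M]; for z > a the Lipschitz
    bound reduces the singularity to (s - z)^(- al). *)
Let inner_le a s : 0 <= a -> 0 < s ->
  (\int[leb]_(z in `]0%R, s[) (`|h a s - h a z| / (s - z) `^ (1 + al))%:E <=
   (L * (s `^ (1 - al) / (1 - al)) + ((fun s => M / al * (s - a) `^ (- al)) \_ `]a, +oo[) s)%:E)%E.
Proof.
move=> a_0 s0; have ms := mvariation1 al s (mh a).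
have p0 : 0 <= L * (s `^ (1 - al) / (1 - al)).
  by rewrite mulr_ge0 // divr_ge0 ?powR_ge0 //; alra.
rewrite patchE; case: ifPn => [|]; rewrite ?inE ?notin_setE /= in_itv /= andbT; last first.
  move/negP; rewrite -leNgt addr0 => sa; rewrite integral0_eq ?lee_fin // => z /=.
  rewrite in_itv /= => /andP[_ zs].
  by rewrite /h /after ltNge sa ltNge (ltW (lt_le_trans zs sa)) /= !mul0r subrr normr0 mul0r.
move=> as_; have mN (D : set R) : measurable_fun D (fun z : R => (`|h a s - h a z| / (s - z) `^ (1 + al))%:E).
  exact/measurable_funTS/measurable_EFinP.
have n0 z : (0 <= (`|h a s - h a z| / (s - z) `^ (1 + al))%:E)%E.
  by rewrite lee_fin divr_ge0 ?powR_ge0.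
have -> : `]0, s[%classic = `]0, a]%classic `|` `]a, s[%classic.
  apply/seteqP; split => [z|z] /=; rewrite !in_itv /=.
    by move=> /andP[-> ->]; rewrite andbT /=; case: leP => _; [left|right].
  by case=> /andP[z1 z2]; apply/andP; split; lra.
rewrite ge0_integral_setU //=; last first.
  apply/disj_setPS => z [/=]; rewrite !in_itv /= => /andP[_ za] /andP[az _]; lra.
  exact: mN.
rewrite addeC EFinD; apply: leeD.
  apply: le_trans (variation_after a_0 as_).
  apply: ge0_le_integral => //; first exact: mN.
    apply/measurable_funTS/measurable_EFinP/measurable_funM => //.
    by apply: measurable_powR_comp; exact: measurable_funB.
  move=> z; rewrite /= in_itv /= => /andP[az zs].
  rewrite lee_fin -powRN /h /after as_ az !mul1r.
  have sz : 0 < s - z by rewrite subr_gt0.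
  apply: (@le_trans _ _ (L * (s - z) * (s - z) `^ (- (1 + al)))).
    by rewrite ler_wpM2r ?powR_ge0 // (lipschitz_of_density mphi phiL dbphi) // ltW.
  rewrite -mulrA -{1}(powRr1 (ltW sz)) -powRDp // (_ : 1 + - (1 + al) = - al) //; ring.
apply: le_trans (variation_before a_0 as_).
apply: ge0_le_integral => //; first exact: mN.
  apply/measurable_funTS/measurable_EFinP/measurable_funM => //.
  by apply: measurable_powR_comp; exact: measurable_funB.
move=> z; rewrite /= in_itv /= => /andP[z0 za].
rewrite lee_fin -powRN ler_wpM2r ?powR_ge0 // /h /after as_ ltNge za /=.
by rewrite mul1r mul0r subr0.
Qed.

(** The jump costs a multiple of (s - a)^(- al) and the Lipschitz part a bounded amount; both are
    integrable in s because al < 1. *)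
Lemma gls_norm_after a t : 0 <= a -> 0 < t -> (gls_norm al t (h a) < +oo)%E.
Proof.
move=> a_0 t0; pose G s := M * s `^ (- al) + (L * (t `^ (1 - al) / (1 - al)) +
  ((fun s => M / al * (s - a) `^ (- al)) \_ `]a, +oo[) s).
have ip : leb.-integrable `]a, t[ (fun s : R => ((s - a) `^ (- al))%:E).
  have [ta|at_] := leP t a; first by rewrite set_itv_ge ?bnd_simp -?leNgt //; exact: integrable_set0.
  apply: lebi_ge0 => //.
  - by apply: measurable_funTS; apply: measurable_powR_comp; exact: measurable_funB.
  - by move=> s _; exact: powR_ge0.
  - by rewrite (integral_powR_subr (ltW at_)) ?ltry //; alra.
have ip0 : leb.-integrable `]0, t[ (fun s : R => (s `^ (- al))%:E).
  apply: lebi_ge0 => //.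
  - by apply: measurable_funTS; exact: measurable_powR.
  - by move=> s _; exact: powR_ge0.
  - have := @integral_powR_subr R 0 t (- al) (ltW t0); under eq_integral do rewrite subr0.
    by move=> ->; rewrite ?ltry //; alra.
have iG : leb.-integrable `]0, t[ (fun s : R => (G s)%:E).
  apply: lebiD => //; first exact: lebi_mulrl.
  apply: lebiD => //.
    by apply: (@bounded_integrable_oo _ (cst _) `|L * (t `^ (1 - al) / (1 - al))|).
  apply: lebi_restrict => //; rewrite (_ : _ `&` _ = `]a, t[%classic); first exact: lebi_mulrl.
  apply/seteqP; split => s /=; rewrite !in_itv /= ?andbT; first by move=> [/andP[_ ->] ->].
  by move=> /andP[as_ ->]; rewrite as_ (le_lt_trans a_0 as_).
have /integrableP[_] := iG; apply: le_lt_trans.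
have Z0 s : (0 <= gls_norm_density al (h a) s)%E by exact: gls_norm_density_ge0.
apply: ge0_le_integral => //.
- by move=> s _; exact: Z0.
- exact: measurable_gls_norm_density.
- by apply: measurableT_comp => //; have /integrableP[] := iG.
move=> s; rewrite /= in_itv /= => /andP[s0 st].
apply: (@le_trans _ _ (G s)%:E); last by rewrite lee_fin ler_norm.
rewrite /G EFinD; apply: leeD.
  rewrite lee_fin -powRN ler_wpM2r ?powR_ge0 // /h /after.
  by case: ifP => _; rewrite ?mul1r ?mul0r ?normr0.
apply: (le_trans (inner_le a_0 s0)); rewrite lee_fin lerD2r ler_wpM2l //.
by rewrite ler_wpM2r ?invr_ge0 ?ge0_ler_powR ?nnegrE ?ltW //; alra.
Qed.

Lemma gls_ok_after a t : 0 <= a -> 0 < t -> marchaud_finite al g 0 t ->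
  (a < t -> marchaud_finite al g a t) ->
  gls_ok al t g (h a) (after_integral g b phi t a).
Proof.
move=> a_0 t0 fin0 fina.
have [h1 h2] := gls_left_after al01 cg gM mphi phiL dbphi bM t0 fin0 a_0 fina.
split => //; first exact: gls_norm_after.
by move=> x x0; exact: (integrable_after_inner al01 gM mphi phiL dbphi bM a_0 x0).
Qed.

End after.

End gls_ok.

Section marchaud_finite_facts.
Context {R : realType}.
Implicit Types (al a t : R) (g : R -> R).

Lemma marchaud_finite_congr al g g' a t : {in `]a, t[, g =1 g'} ->
  marchaud_finite al g a t -> marchaud_finite al g' a t.
Proof.
move=> gg'; apply: le_lt_trans; rewrite le_eqVlt; apply/orP; left; apply/eqP.
apply: eq_integral => x; rewrite inE /= => xt; apply: eq_integral => u; rewrite inE /= => ux.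
rewrite -(gg' x xt) -(gg' u) //.
by move: xt ux; rewrite !in_itv /= => /andP[ax _] /andP[/(lt_trans ax) -> ->].
Qed.

Lemma marchaud_finite_le al g a t t' : continuous g -> t <= t' ->
  marchaud_finite al g a t' -> marchaud_finite al g a t.
Proof.
move=> cg tt'; apply: le_lt_trans.
have mg := continuous_measurable_fun cg.
pose F (z : R * R) : \bar R := ((z.1 - a) `^ (- al) * (`|g z.2 - g z.1| * (z.2 - z.1) `^ (al - 2)))%:E.
have mF : measurable_fun setT F.
  apply/measurable_EFinP/measurable_funM.
    by apply: measurable_powR_comp; exact: measurable_funB.
  apply: measurable_funM.
    by apply: measurableT_comp => //; apply: measurable_funB; apply: (measurableT_comp mg).
  by apply: measurable_powR_comp; exact: measurable_funB.
have mFx x : measurable_fun setT (fun u : R =>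
    ((x - a) `^ (- al) * (`|g u - g x| * (u - x) `^ (al - 2)))%:E).
  apply/measurable_EFinP; apply: measurable_funM => //; apply: measurable_funM.
    by apply: measurableT_comp => //; exact: measurable_funB.
  by apply: measurable_powR_comp; exact: measurable_funB.
have F0 z : (0 <= F z)%E by rewrite lee_fin !mulr_ge0 ?powR_ge0.
have m1 s s' := measurable_triangle_tonelli1 mF F0 (a := s) (b := s').
apply: (@le_trans _ _ (\int[leb]_(x in `]a, t[) \int[leb]_(u in `]x, t'[) F (x, u))%E).
  apply: ge0_le_integral => //.
  - by move=> x _; apply: integral_ge0 => u _; exact: (F0 (x, u)).
  - exact: m1.
  - by apply: measurable_funS (m1 a t') => //; apply: subset_itvl; rewrite bnd_simp.
  move=> x _; apply: ge0_subset_integral => //.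
    - exact: (measurable_funTS (mFx x)).
    - by move=> u _; exact: (F0 (x, u)).
    by apply: subset_itvl; rewrite bnd_simp.
apply: ge0_subset_integral => //.
- exact: m1.
- by move=> x _; apply: integral_ge0 => u _; exact: (F0 (x, u)).
- by apply: subset_itvl; rewrite bnd_simp.
Qed.

End marchaud_finite_facts.

(** * The wealth equation of a step strategy along one path *)

Section pathwise_step.
Context {R : realType}.
Implicit Types (a t u v x : R).
Variables (al M L K mu sigma : R) (g A rho : R -> R).
Hypotheses (al01 : 0 < al < 1) (cg : continuous g) (gM : forall x, `|g x| <= M).
Hypotheses (mrho : measurable_fun setT rho) (rhoK : forall x, `|rho x| <= K).
Hypotheses (dA : has_density A rho) (AM : forall x, `|A x| <= M).

Definition discounted_log t := mu * t + sigma * g t - A t.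
Local Notation J := discounted_log.

Let b := expR \o A.
Let phi x := rho x * b x.

Let K0 : 0 <= K. Proof. by apply: le_trans (rhoK 0); exact: normr_ge0. Qed.
Let M0 : 0 <= M. Proof. by apply: le_trans (gM 0); exact: normr_ge0. Qed.

Let b_le x : `|b x| <= expR M.
Proof.
rewrite ger0_norm ?expR_ge0 // ler_expR.
by apply: le_trans (AM x); exact: ler_norm.
Qed.

Let gN x : `|g x| <= expR M.
Proof. by apply: (le_trans (gM x)); apply: le_trans (expR_ge1Dx M); rewrite lerDr. Qed.

Let db : has_density b phi.
Proof.
apply: (density_expR (M := M) mrho rhoK) dA => x.
by apply: le_trans (AM x); exact: ler_norm.
Qed.

Let cA : continuous A := density_continuous mrho rhoK dA.
Let mA : measurable_fun setT A. Proof. exact: continuous_measurable_fun. Qed.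
Let mg : measurable_fun setT g. Proof. exact: continuous_measurable_fun. Qed.

Let mb : measurable_fun setT b. Proof. exact: measurable_expR_comp. Qed.

Let mphi : measurable_fun setT phi. Proof. exact: measurable_funM. Qed.

Let phi_le x : `|phi x| <= K * expR M.
Proof. by rewrite normrM ler_pM. Qed.

Let mJ : measurable_fun setT J.
Proof.
apply: measurable_funB => //; apply: measurable_funD; apply: measurable_funM => //.
Qed.

(** The integrand of the Lebesgue part of the self-financing equation when one unit of [J] is held
    after [a]: the value in shares is exp(A), the number of bonds is J u - J a - 1. *)
Definition step_drift a u := (J u - J a - 1) * (rho u * expR (A u)) + mu * expR (A u).

Lemma measurable_step_drift a : measurable_fun setT (step_drift a).
Proof.
apply: measurable_funD; last exact: measurable_funM.
apply: measurable_funM => //; apply: measurable_funB => //; exact: measurable_funB.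
Qed.

Definition step_drift_bound : R :=
  ((`|mu| + `|sigma| * M + M) + (`|mu| + `|sigma| * M + M) + 1) * (K * expR M) + `|mu| * expR M.

Let J_le u : 0 <= u <= 1 -> `|J u| <= `|mu| + `|sigma| * M + M.
Proof.
move=> /andP[u0 u1]; apply: (le_trans (ler_normB _ _)); apply: lerD => //.
apply: (le_trans (ler_normD _ _)); rewrite !normrM; apply: lerD.
  by rewrite ler_piMr // ger0_norm.
by rewrite ler_wpM2l.
Qed.

Lemma step_drift_le a u : 0 <= a <= 1 -> 0 <= u <= 1 -> `|step_drift a u| <= step_drift_bound.
Proof.
move=> a01 u01; apply: (le_trans (ler_normD _ _)); rewrite !normrM; apply: lerD.
  apply: ler_pM => //; last by rewrite -normrM phi_le.
  apply: (le_trans (ler_normB _ _)); rewrite normr1 lerD2r.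
  by apply: (le_trans (ler_normB _ _)); apply: lerD; exact: J_le.
by rewrite ler_wpM2l // b_le.
Qed.

(** The rough term sigma g enters [J] linearly, and its integral already has the form obtained by
    parts; rearranging it is algebra. The product rule is applied to mu u - A u and exp(A), both
    with bounded density. *)
Lemma discounted_step a t : 0 <= a -> a <= t -> t <= 1 ->
  expR (A t) * (J t - J a) =
  \int[leb]_(u in `]a, t[) step_drift a u + sigma * (b a * (g t - g a) +
    \int[leb]_(v in `]a, t[) (phi v * (g t - g v))).
Proof.
move=> a0 at_ t1.
have ib (p : R -> R) C : measurable_fun setT p -> (forall u, a < u < t -> `|p u| <= C) ->
    leb.-integrable `]a, t[ (fun v : R => (p v)%:E).
  exact: bounded_integrable_oo.
have iphi : leb.-integrable `]a, t[ (fun v : R => (phi v)%:E).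
  by apply: (ib _ (K * expR M)) => // u _.
have gB x y : `|g x - g y| <= M + M by apply: (le_trans (ler_normB _ _)); exact: lerD.
have mg1 : measurable_fun setT (fun v => phi v * (g v - g a)).
  by apply: measurable_funM => //; exact: measurable_funB.
have i1 : leb.-integrable `]a, t[ (fun v : R => (phi v * (g v - g a))%:E).
  by apply: (ib _ (K * expR M * (M + M))) => // u _; rewrite normrM ler_pM.
have -> : \int[leb]_(v in `]a, t[) (phi v * (g t - g v)) =
    (g t - g a) * (b t - b a) - \int[leb]_(v in `]a, t[) (phi v * (g v - g a)).
  rewrite (db at_) -RintegralZl // -RintegralB //; last exact: lebi_mulrl.
  by apply: eq_Rintegral => v _; ring.
pose F u := mu * u - A u; pose q u := mu - rho u.
have mq : measurable_fun setT q by exact: measurable_funB.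
have dF : has_density F q.
  move=> x y xy; rewrite /F /q.
  have ir : leb.-integrable `]x, y[ (fun v : R => (rho v)%:E).
    by apply: (@bounded_integrable_oo _ _ K) => // u _.
  have im : leb.-integrable `]x, y[ (fun v : R => mu%:E).
    by apply: (@bounded_integrable_oo _ (cst mu) `|mu|).
  rewrite RintegralB // -dA // Rintegral_cst //= lebesgue_measure_itv /= lte_fin.
  case: ltP => [_|yx]; first by rewrite -EFinB /=; ring.
  by have -> : x = y by [apply/eqP; rewrite eq_le xy yx]; rewrite /=; ring.
have qL u : `|q u| <= `|mu| + K by apply: (le_trans (ler_normB _ _)); exact: lerD.
have L1 : `|mu| + K <= `|mu| + K + K * expR M by rewrite lerDl mulr_ge0 ?expR_ge0.
have L2 : K * expR M <= `|mu| + K + K * expR M by rewrite lerDr addr_ge0.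
have prod := density_product mq mphi (fun u => le_trans (qL u) L1)
  (fun u => le_trans (phi_le u) L2) dF db at_.
have mF : measurable_fun setT F by apply: measurable_funB => //; exact: measurable_funM.
have mp : measurable_fun setT (fun x => q x * b x + F x * phi x).
  by apply: measurable_funD; exact: measurable_funM.
have i2 : leb.-integrable `]a, t[ (fun x : R => (q x * b x + F x * phi x)%:E).
  apply: (ib _ ((`|mu| + K) * expR M + (`|mu| + M) * (K * expR M))) => // u /andP[au ut].
  apply: (le_trans (ler_normD _ _)); rewrite !normrM; apply: lerD; apply: ler_pM => //.
    apply: (le_trans (ler_normB _ _)); apply: lerD => //; rewrite normrM ler_piMr //.
    by rewrite ger0_norm; lra.
  by rewrite -normrM phi_le.
have -> : \int[leb]_(u in `]a, t[) step_drift a u =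
    \int[leb]_(u in `]a, t[) (q u * b u + F u * phi u) +
    sigma * \int[leb]_(u in `]a, t[) (phi u * (g u - g a)) - F a * (b t - b a).
  rewrite (db at_) -!RintegralZl // -RintegralD //; last exact: lebi_mulrl.
  rewrite -RintegralB //; [|by apply: lebiD => //; exact: lebi_mulrl|exact: lebi_mulrl].
  by apply: eq_Rintegral => u _; rewrite /step_drift /J /F /q /phi /b /=; ring.
rewrite -prod /J /F /b /=; ring.
Qed.

Lemma discounted_step_after a t : 0 <= a < 1 -> 0 <= t <= 1 ->
  expR (A t) * (after a t * (J t - J a)) =
  \int[leb]_(u in `]0, t[) (after a u * step_drift a u) + sigma * after_integral g b phi t a.
Proof.
move=> /andP[a0 a1] /andP[t0 t1]; rewrite /after_integral.
have md : measurable_fun setT (fun u => after a u * step_drift a u).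
  by apply: measurable_funM; [exact: measurable_after|exact: measurable_step_drift].
have [at_|ta] := ltP a t; last first.
  rewrite /after ltNge ta /= mul0r mulr0 mulr0 addr0.
  transitivity (\int[leb]_(u in `]0, t[) (cst 0 : R -> R) u); first by rewrite Rintegral_cst // mul0r.
  apply: eq_Rintegral => u; rewrite inE /= in_itv /= => /andP[_ ut].
  by rewrite ltNge (ltW (lt_le_trans ut ta)) /= mul0r.
have bd u : 0 < u < t -> `|after a u * step_drift a u| <= step_drift_bound.
  move=> /andP[u0 ut]; have h : `|step_drift a u| <= step_drift_bound.
    by apply: step_drift_le; apply/andP; split; lra.
  by rewrite /after; case: ifP => _; rewrite ?mul1r // mul0r normr0 (le_trans _ h).
rewrite (Rintegral_oo_cat a0 (ltW at_) md bd) {1}/after at_ mul1r (discounted_step a0 (ltW at_) t1).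
congr (_ + _); rewrite -[LHS]add0r; congr (_ + _).
  transitivity (\int[leb]_(u in `]0, a[) (cst 0 : R -> R) u); first by rewrite Rintegral_cst // mul0r.
  apply: eq_Rintegral => u; rewrite inE /= in_itv /= => /andP[_ ut].
  by rewrite /after ltNge (ltW ut) /= mul0r.
by apply: eq_Rintegral => u; rewrite inE /= in_itv /= => /andP[au _]; rewrite /after au mul1r.
Qed.

Lemma gls_ok_step a t : 0 <= a < 1 -> 0 < t <= 1 ->
  marchaud_finite al g 0 1 -> marchaud_finite al g a 1 ->
  gls_ok al t g (fun u => after a u * expR (A u)) (after_integral g b phi t a).
Proof.
move=> /andP[a0 a1] /andP[t0 t1] fin0 fina.
apply: (gls_ok_after al01 cg gN mphi phi_le db b_le a0 t0).
  exact: (marchaud_finite_le cg t1 fin0).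
by move=> _; exact: (marchaud_finite_le cg t1 fina).
Qed.

Implicit Type s : seq (R * R).

(** A strategy is encoded as a list of trades: the pair (c, a) adds c to the position after time a.
    Opening and closing a position are two trades, and successive blocks are concatenated. *)
Definition steps s u := \sum_(k <- s) k.1 * after k.2 u.
Definition step_gain s t := \sum_(k <- s) k.1 * (after k.2 t * (J t - J k.2)).
Definition steps_drift s u := \sum_(k <- s) k.1 * (after k.2 u * step_drift k.2 u).

Lemma gls_ok_steps s t : 0 < t <= 1 -> marchaud_finite al g 0 1 ->
  (forall k, k \in s -> 0 <= k.2 < 1 /\ marchaud_finite al g k.2 1) ->
  gls_ok al t g (fun u => steps s u * expR (A u))
    (\sum_(k <- s) k.1 * after_integral g b phi t k.2).
Proof.
move=> t01 fin0; elim: s => [|k s ih] hs.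
  rewrite big_nil; rewrite (_ : (fun u => _) = cst 0); first exact: gls_ok0.
  by apply/funext => u; rewrite /steps big_nil mul0r.
have [k2 fink] := hs k (mem_head _ _).
have {}ih := ih (fun k' hk => hs k' (mem_behead (s := k :: s) hk)).
rewrite big_cons; have := gls_ok_linear k.1 (gls_ok_step k2 t01 fin0 fink) ih.
congr (gls_ok al t g _ _); apply/funext => u; rewrite /steps big_cons; ring.
Qed.

Lemma steps_drift_integrable s t : 0 <= t <= 1 -> (forall k, k \in s -> 0 <= k.2 < 1) ->
  leb.-integrable `]0, t[ (fun u : R => (steps_drift s u)%:E) /\
  \int[leb]_(u in `]0, t[) steps_drift s u =
  \sum_(k <- s) k.1 * \int[leb]_(u in `]0, t[) (after k.2 u * step_drift k.2 u).
Proof.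
move=> /andP[t0 t1]; elim: s => [|k s ih] hs.
  split; last first.
    rewrite big_nil; transitivity (\int[leb]_(u in `]0, t[) (cst 0 : R -> R) u).
      by apply: eq_Rintegral => u _; rewrite /steps_drift big_nil.
    by rewrite Rintegral_cst // mul0r.
  apply: (lebi_eq (f := fun=> 0%:E) (measurable_itv _)); last exact: integrable0.
  by move=> u _; rewrite /steps_drift big_nil.
have [ih1 ih2] := ih (fun k' hk => hs k' (mem_behead (s := k :: s) hk)).
have /andP[k0 k1] := hs k (mem_head _ _).
have i1 : leb.-integrable `]0, t[ (fun u : R => (after k.2 u * step_drift k.2 u)%:E).
  apply: (@bounded_integrable_oo _ _ step_drift_bound).
    by apply: measurable_funM; [exact: measurable_after|exact: measurable_step_drift].
  move=> u /andP[u0 ut]; have h : `|step_drift k.2 u| <= step_drift_bound.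
    by apply: step_drift_le; apply/andP; split; lra.
  by rewrite /after; case: ifP => _; rewrite ?mul1r // mul0r normr0 (le_trans _ h).
split.
  have := lebiD (measurable_itv _) (lebi_mulrl k.1 (measurable_itv _) i1) ih1.
  by apply: (lebi_eq (measurable_itv _)) => u _; rewrite /steps_drift big_cons.
rewrite big_cons -ih2 -RintegralZl // -RintegralD //; last exact: lebi_mulrl.
by apply: eq_Rintegral => u _; rewrite /steps_drift big_cons.
Qed.

Lemma step_gain_value s t : 0 <= t <= 1 -> (forall k, k \in s -> 0 <= k.2 < 1) ->
  expR (A t) * step_gain s t = \int[leb]_(u in `]0, t[) steps_drift s u +
    sigma * \sum_(k <- s) k.1 * after_integral g b phi t k.2.
Proof.
move=> t01 hs; have [_ ->] := steps_drift_integrable t01 hs.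
rewrite /step_gain !mulr_sumr -big_split /= big_seq [RHS]big_seq; apply: eq_bigr => k /hs k2.
by rewrite mulrCA discounted_step_after //; ring.
Qed.

(** Identifies the sum of the single-trade drifts with the drift of the portfolio:
    [step_gain - steps] is its number of bonds, and [steps] times exp(A) its value in shares. *)
Lemma steps_driftE s u : steps_drift s u =
  (step_gain s u - steps s u) * rho u * expR (A u) + steps s u * mu * expR (A u).
Proof.
rewrite /steps_drift /step_gain /steps; elim: s => [|k s ih]; first by rewrite !big_nil; ring.
by rewrite !big_cons ih /step_drift; ring.
Qed.

End pathwise_step.

(** * From paths on [0, 1] to functions on the whole line *)

Section pathwise_market.
Context {R : realType}.
Implicit Types (t u x : R).

(** Composition with this retraction onto [0, 1] extends a path to a bounded continuous function on
    the line, as the integration lemmas above require. *)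
Definition clamp x : R := Num.max 0 (Num.min 1 x).

Lemma clamp_itv x : 0 <= clamp x <= 1.
Proof. by rewrite /clamp le_max lexx ge_max ler01 ge_min lexx. Qed.

Lemma clamp_id x : 0 <= x <= 1 -> clamp x = x.
Proof. by move=> /andP[x0 x1]; rewrite /clamp min_r // max_r. Qed.

Lemma clamp_continuous (g : R -> R) : {within `[0, 1], continuous g} -> continuous (g \o clamp).
Proof.
move=> /subspace_continuousP cg x.
have cc : clamp @ x --> clamp x.
  apply: continuous_max; first exact: cvg_cst.
  by apply: continuous_min; [exact: cvg_cst|exact: cvg_id].
apply: cvg_comp (cg _ (clamp_itv x)) => P; rewrite /within /= => /cc.
by apply: (@filterS _ (nbhs x)) => y; apply; exact: clamp_itv.
Qed.

Lemma clamp_bounded (g : R -> R) : {within `[0, 1], continuous g} ->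
  exists M, forall x, `|g (clamp x)| <= M.
Proof.
move=> /clamp_continuous cg.
have cn : {within `[0, 1], continuous (fun x => `|g (clamp x)|)}.
  by apply: continuous_subspaceT => x; apply: cvg_norm; exact: cg.
have [c _ hc] := EVT_max ler01 cn; exists `|g (clamp c)| => x.
rewrite -{1}(clamp_id (clamp_itv x)); apply: hc; rewrite in_itv /=; exact: clamp_itv.
Qed.

Section extended_rate.
Variables (K : R) (rho : R -> R).
Hypotheses (mrho : measurable_fun (`[0, 1]%classic : set R) rho) (rhoK : forall t, 0 <= t <= 1 -> `|rho t| <= K).

Definition rate_ext := rho \_ `[0, 1].
Definition rate_int x := \int[leb]_(u in `]0, x[) rate_ext u.

Lemma measurable_rate_ext : measurable_fun setT rate_ext.
Proof. by apply/(measurable_restrictT _ _).1. Qed.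

Lemma rate_ext_le x : `|rate_ext x| <= K.
Proof.
rewrite /rate_ext patchE; case: ifPn => [|_]; first by rewrite inE /= in_itv /=; exact: rhoK.
by rewrite normr0; apply: le_trans (rhoK (t := 0) _); rewrite ?normr_ge0 // lexx ler01.
Qed.

Lemma rate_extE x : 0 <= x <= 1 -> rate_ext x = rho x.
Proof. by move=> x01; rewrite /rate_ext patchE mem_set //= in_itv. Qed.

Let rate_int_neg x : x <= 0 -> rate_int x = 0.
Proof. by move=> x0; rewrite /rate_int set_itv_ge ?Rintegral_set0 // bnd_simp -leNgt. Qed.

Let rate_int_out x y : y <= 0 \/ 1 <= x -> \int[leb]_(u in `]x, y[) rate_ext u = 0.
Proof.
move=> xy; transitivity (\int[leb]_(u in `]x, y[) (cst 0 : R -> R) u).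
  apply: eq_Rintegral => u; rewrite inE /= in_itv /= => /andP[xu uy].
  rewrite /rate_ext patchE ifF //; apply/negbTE; rewrite notin_setE /= in_itv /=.
  by move=> /andP[u0 u1]; case: xy => ?; lra.
by rewrite Rintegral_cst // mul0r.
Qed.

Lemma rate_int_density : has_density rate_int rate_ext.
Proof.
have cat x y z : x <= y -> y <= z -> \int[leb]_(v in `]x, z[) rate_ext v =
    \int[leb]_(v in `]x, y[) rate_ext v + \int[leb]_(v in `]y, z[) rate_ext v.
  by move=> xy yz; apply: (Rintegral_oo_cat (L := K) xy yz measurable_rate_ext) => u _; exact: rate_ext_le.
move=> x y xy; have [x0|/ltW x0] := leP 0 x.
  by rewrite /rate_int (cat _ _ _ x0 xy) addrAC subrr add0r.
rewrite (rate_int_neg x0) subr0; have [y0|/ltW y0] := leP 0 y.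
  by rewrite (cat _ _ _ x0 y0) rate_int_out ?add0r //; left.
by rewrite rate_int_neg // rate_int_out //; left.
Qed.

Lemma rate_int_le x : `|rate_int x| <= K.
Proof.
have K0 : 0 <= K by apply: le_trans (rhoK (t := 0) _); rewrite ?normr_ge0 // lexx ler01.
have small y : 0 <= y <= 1 -> `|rate_int y| <= K.
  move=> /andP[y0 y1]; apply: (@le_trans _ _ (K * (y - 0))).
    by apply: (le_normr_Rintegral_cst y0 measurable_rate_ext) => u _; exact: rate_ext_le.
  by rewrite subr0 ler_piMr.
have [x0|/ltW x0] := leP 0 x; last by rewrite rate_int_neg // normr0.
have [x1|/ltW x1] := leP x 1; first by apply: small; rewrite x0.
have := rate_int_density x1; rewrite rate_int_out; last by right.
by move=> /eqP; rewrite subr_eq0 => /eqP ->; apply: small; rewrite ler01 lexx.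
Qed.

Lemma rate_intE t : 0 <= t <= 1 -> \int[leb]_(u in `[0, t]) rho u = rate_int t.
Proof.
move=> /andP[t0 t1].
have i1 : leb.-integrable `]0, t[ (fun u : R => (rate_ext u)%:E).
  by apply: (bounded_integrable_oo (L := K) measurable_rate_ext) => u _; exact: rate_ext_le.
have i2 : leb.-integrable `[0, t] (fun u : R => (rate_ext u)%:E).
  apply: (@bounded_integrable _ _ _ K 0 t) => //; first exact: measurable_funTS measurable_rate_ext.
  by move=> u _; exact: rate_ext_le.
transitivity (\int[leb]_(u in `[0, t]) rate_ext u).
  apply: eq_Rintegral => u; rewrite inE /= in_itv /= => /andP[u0 ut].
  by rewrite rate_extE // u0 (le_trans ut t1).
rewrite /rate_int Rintegral_itv_bndo_bndc; last first.
  by apply: integrableS i1 => //.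
rewrite Rintegral_itv_obnd_cbnd //.
by apply: integrableS i2 => //; apply: subset_itvr; rewrite bnd_simp.
Qed.

End extended_rate.

Lemma gls_norm_congr al t f f' : {in `]0, t[, f =1 f'} -> gls_norm al t f = gls_norm al t f'.
Proof.
move=> ff'; apply: eq_integral => x; rewrite inE /= => xt; rewrite -(ff' x xt); congr (_ + _)%E.
apply: eq_integral => u; rewrite inE /= => ux; rewrite -(ff' u) //.
by move: xt ux; rewrite !in_itv /= => /andP[x0 xt] /andP[-> /lt_trans ->].
Qed.

Lemma gls_integral_congr al t f f' g g' : {in `]0, t[, f =1 f'} -> {in `]0, t], g =1 g'} ->
  gls_integral al t f g = gls_integral al t f' g'.
Proof.
move=> ff' gg'; rewrite /gls_integral; apply: congr1; apply: eq_Rintegral => x.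
rewrite inE /= => xt; have := xt; rewrite in_itv /= => /andP[x0 x_t].
rewrite -(ff' x xt) -(gg' t) ?in_itv /= ?lexx ?(lt_trans x0) //.
rewrite -(gg' x) ?in_itv /= ?x0 ?ltW //; congr ((_ + _ * _) * (_ + _ * _)).
  apply: eq_Rintegral => u; rewrite inE /= in_itv /= => /andP[u0 ux]; rewrite -(ff' u) //.
  by rewrite in_itv /= u0 (lt_trans ux).
apply: eq_Rintegral => u; rewrite inE /= in_itv /= => /andP[xu ut]; rewrite -(gg' u) //.
by rewrite in_itv /= (lt_trans x0 xu) ltW.
Qed.

(** Extend the path by [clamp] and the rate by zero; none of the quantities on [0, 1] changes. The
    value is then exp(A) times the accumulated gain, and [step_gain_value] splits it into the
    Lebesgue and the Stieltjes integral. *)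
Lemma pathwise_self_financing (al mu sigma S0 K : R) (g rho pi0 pi1 : R -> R) (s : seq (R * R)) :
  let A := fun t => \int[leb]_(u in `[0, t]) rho u in
  let B := fun t => expR (A t) in
  let S := fun t => S0 * expR (mu * t + sigma * g t) in
  let V := fun t => pi0 t * B t + pi1 t * S t in
  0 < al < 1 -> S0 != 0 -> {within `[0, 1], continuous g} ->
  measurable_fun (`[0, 1]%classic : set R) rho -> (forall t, 0 <= t <= 1 -> `|rho t| <= K) ->
  marchaud_finite al g 0 1 ->
  (forall k, k \in s -> 0 <= k.2 < 1 /\ marchaud_finite al g k.2 1) ->
  (forall t, 0 <= t <= 1 -> pi1 t = steps s t * B t / S t) ->
  (forall t, 0 <= t <= 1 -> pi0 t = step_gain mu sigma g A s t - steps s t) ->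
  forall t, 0 <= t <= 1 ->
  let f := fun u => pi0 u * rho u * B u + pi1 u * mu * S u in
  let h := fun u => sigma * pi1 u * S u in
  [/\ leb.-integrable `[0, t] (EFin \o f), gls_integrable al t h &
      V t = V 0 + \int[leb]_(u in `[0, t]) f u + gls_integral al t h g].
Proof.
move=> A B S V al01 S00 cg mrho rhoK fin0 fins pi1E pi0E t t01 f h.
have [M0 gM0] := clamp_bounded cg; have cg' := clamp_continuous cg.
pose M := Num.max M0 K; pose g' := g \o clamp.
have gM x : `|g' x| <= M by rewrite /M le_max gM0.
have gg' : {in `[0, 1], g =1 g'} by move=> x; rewrite in_itv /= => x01; rewrite /g' /= clamp_id.
have mr := measurable_rate_ext mrho; have rK := rate_ext_le rhoK.
have dA := rate_int_density mrho rhoK.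
have AM x : `|rate_int rho x| <= M by rewrite /M le_max (rate_int_le mrho rhoK) orbT.
have AE u : 0 <= u <= 1 -> A u = rate_int rho u by exact: (rate_intE mrho rhoK).
have k01 k : k \in s -> 0 <= k.2 < 1 by move=> /fins[].
have fing a : 0 <= a -> marchaud_finite al g a 1 -> marchaud_finite al g' a 1.
  move=> a0; apply: marchaud_finite_congr => x; rewrite in_itv /= => /andP[ax x1].
  by apply: gg'; rewrite in_itv /= (le_trans a0) ltW.
have fins' k : k \in s -> 0 <= k.2 < 1 /\ marchaud_finite al g' k.2 1.
  move=> ks; have [k2 fk] := fins k ks; split; first exact: k2.
  by apply: (fing _ _ fk); case/andP: k2.
have S0' u : S u != 0 by rewrite mulf_neq0 // gt_eqF ?expR_gt0.
have JE u : 0 <= u <= 1 -> discounted_log mu sigma g A u =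
    discounted_log mu sigma g' (rate_int rho) u.
  by move=> u01; rewrite /discounted_log AE // /g' /= clamp_id.
have GE u : 0 <= u <= 1 -> step_gain mu sigma g A s u = step_gain mu sigma g' (rate_int rho) s u.
  move=> u01; rewrite /step_gain big_seq [RHS]big_seq; apply: eq_bigr => k /k01 /andP[k0 k1].
  by rewrite !JE // k0 ltW.
have VE u : 0 <= u <= 1 -> V u = expR (rate_int rho u) * step_gain mu sigma g' (rate_int rho) s u.
  move=> u01; rewrite /V pi1E // pi0E // divfK // GE // /B AE //; ring.
have hE u : 0 <= u <= 1 -> h u = sigma * (steps s u * expR (rate_int rho u)).
  by move=> u01; rewrite /h pi1E // -[LHS]mulrA; congr (_ * _); rewrite (divfK (S0' u)) /B AE.
have fE u : 0 <= u <= 1 -> f u = steps_drift mu sigma g' (rate_int rho) (rate_ext rho) s u.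
  move=> u01; rewrite /f steps_driftE pi0E // GE // pi1E // /B AE // rate_extE //.
  by congr (_ + _); rewrite mulrAC divfK //; ring.
have V0 : V 0 = 0.
  rewrite VE ?lexx ?ler01 // /step_gain big_seq big1 ?mulr0 // => k /k01 /andP[k0 _].
  by rewrite /after ltNge k0 /= mul0r mulr0.
have [i1 _] := steps_drift_integrable mu sigma cg' gM mr rK dA AM t01 k01.
have mf : measurable_fun setT (steps_drift mu sigma g' (rate_int rho) (rate_ext rho) s).
  elim: (s) => [|k s' ih].
    by rewrite (_ : steps_drift _ _ _ _ _ _ = cst 0) //; apply/funext => u; rewrite /steps_drift big_nil.
  rewrite (_ : steps_drift _ _ _ _ _ _ = fun u => k.1 * (after k.2 u *
    step_drift mu sigma g' (rate_int rho) (rate_ext rho) k.2 u) +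
    steps_drift mu sigma g' (rate_int rho) (rate_ext rho) s' u); last first.
    by apply/funext => u; rewrite /steps_drift big_cons.
  apply: measurable_funD => //; apply: measurable_funM => //; apply: measurable_funM.
    exact: measurable_after.
  exact: (measurable_step_drift mu sigma cg' mr rK dA).
have t1' u : 0 <= u <= t -> 0 <= u <= 1.
  by move=> /andP[-> /le_trans ->] //; case/andP: t01.
have i2 : leb.-integrable `[0, t] (fun u : R =>
    (steps_drift mu sigma g' (rate_int rho) (rate_ext rho) s u)%:E).
  have /integrableP[_ fin1] := i1; apply/integrableP; split.
    exact/measurable_EFinP/measurable_funTS.
  rewrite -integral_itv_obnd_cbnd; last first.
    by apply: measurableT_comp => //; exact/measurable_EFinP/measurable_funTS.
  rewrite -integral_itv_bndo_bndc //.
  by apply: measurableT_comp => //; exact/measurable_EFinP/measurable_funTS.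
have i3 : leb.-integrable `[0, t] (EFin \o f).
  apply: (lebi_eq (measurable_itv _) _ i2) => u; rewrite /= in_itv /= => /t1' u01.
  by rewrite fE.
have E1 : \int[leb]_(u in `[0, t]) f u =
    \int[leb]_(u in `]0, t[) steps_drift mu sigma g' (rate_int rho) (rate_ext rho) s u.
  transitivity (\int[leb]_(u in `[0, t]) steps_drift mu sigma g' (rate_int rho) (rate_ext rho) s u).
    by apply: eq_Rintegral => u; rewrite inE /= in_itv /= => /t1' /fE.
  rewrite Rintegral_itv_bndo_bndc; last exact: i1.
  rewrite Rintegral_itv_obnd_cbnd //.
  by apply: integrableS i2 => //; apply: subset_itvr; rewrite bnd_simp.
(* At time 0 all intervals of integration are empty or reduced to a point; [gls_ok_steps] covers
   positive times. *)
rewrite V0 add0r E1; have [t0|tn0] := eqVneq t 0.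
  have set0t : `]0, t[%classic = set0 :> set R by rewrite t0 set_itvoo0.
  split; first exact: i3.
    rewrite t0; split; first by rewrite set_itv1; exact: measurable_fun_set1.
    by rewrite /gls_norm set_itvoo0 integral_set0 ltry.
  by rewrite /gls_integral set0t !Rintegral_set0 mulr0 addr0 t0 V0.
have t0' : 0 < t <= 1 by rewrite lt_neqAle eq_sym tn0.
have ok := gls_ok_steps al01 cg' gM mr rK dA AM t0' (fing _ (lexx 0) fin0) fins'.
(* The integrand [h] carries the factor sigma; scaling is obtained from linearity by adding the zero
   function. *)
have {}ok := gls_ok_linear sigma ok (gls_ok0 al t g').
have hh' : {in `[0, t], h =1 fun u => sigma * (steps s u * expR (rate_int rho u)) + cst 0 u}.
  by move=> u; rewrite in_itv /= => /t1' /hE ->; rewrite addr0.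
have hh : {in `]0, t[, h =1 fun u => sigma * (steps s u * expR (rate_int rho u)) + cst 0 u}.
  by move=> u; rewrite in_itv /= => /andP[/ltW u0 /ltW ut]; apply: hh'; rewrite in_itv /= u0.
have [[mh nh] vh] := gls_okP al01 ok.
split; first exact: i3.
  split; last by rewrite (gls_norm_congr al hh).
  by apply: eq_measurable_fun mh => u; rewrite inE => /hh' ->.
rewrite (gls_integral_congr al (g' := g') hh) ?vh; last first.
  move=> x; rewrite in_itv /= => /andP[/ltW x0 xt]; apply: gg'; rewrite in_itv /= x0.
  by apply: le_trans xt _; case/andP: t01.
rewrite VE // addr0.
exact: (step_gain_value mu sigma cg' gM mr rK dA AM t01 k01).
Qed.

End pathwise_market.

(** * Small ball estimate for Gaussian increments *)

(** The layer-cake formula with a weight. It is applied to [P] with weight 1 and to Lebesgue measure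
    with a normal density, so that second moments can be compared through the law alone. *)
Lemma tail_integral {d} {T : measurableType d} {R : realType}
    (mu : {sigma_finite_measure set T -> \bar R}) (X p : T -> R) :
  measurable_fun setT X -> measurable_fun setT p ->
  (forall w, 0 <= X w) -> (forall w, 0 <= p w) ->
  (\int[mu]_w (X w * p w)%:E =
   \int[leb]_(r in `]0%R, +oo[) \int[mu]_(w in [set w | (r < X w)%R]) (p w)%:E)%E.
Proof.
move=> mX mp X0 p0.
pose F (z : T * R) : \bar R := (if z.2 < X z.1 then (p z.1)%:E else 0%E).
have mF : measurable_fun setT F.
  apply: measurable_fun_ifT; last exact: measurable_cst.
    by apply: measurable_fun_ltr => //; exact: measurableT_comp.
  by apply/measurable_EFinP; exact: measurableT_comp.
have F0 z : (0 <= F z)%E by rewrite /F; case: ifP => _ //; rewrite lee_fin.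
have := @fubini_tonelli_setX _ _ _ _ R mu leb setT `]0%R, +oo[%classic F.
move=> /(_ measurableT (measurable_itv _)) swap.
transitivity (\int[mu]_w \int[leb]_(r in `]0%R, +oo[) F (w, r))%E.
  apply: eq_integral => w _.
  transitivity (\int[leb]_(r in `]0%R, +oo[) ((cst (p w)%:E : R -> \bar R) \_ `]-oo, X w[) r)%E.
    rewrite -integral_mkcondr (_ : _ `&` _ = `]0, X w[%classic); last first.
      by apply/seteqP; split => r /=; rewrite !in_itv /= andbT; [move=> [-> ->]|move=> /andP[-> ->]].
    rewrite /cst integral_cst //= lebesgue_measure_itv /= lte_fin; case: ltP => [_|X_0].
      by rewrite -EFinB -EFinM subr0 mulrC.
    have -> : X w = 0 by apply/eqP; rewrite eq_le X_0 X0.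
    by rewrite mul0r mule0.
  apply: eq_integral => r _; rewrite patchE /F /=.
  by rewrite mem_setE /= in_itv /=.
have -> := swap (measurable_funTS mF) (fun z _ => F0 z).
apply: eq_integral => r _; rewrite [RHS]integral_mkcond; apply: eq_integral => w _.
rewrite patchE /F /=; case: ifPn => rX; case: ifPn => //.
  by rewrite notin_setE /= rX.
by rewrite inE /= (negbTE rX).
Qed.

Section gaussian.
Context {R : realType}.
Implicit Types m s v x : R.

(* From [u e^(-u) <= e^(-u/2)] with [u = (y - m)^2 / (2 s^2)]. *)
Lemma normal_second_moment m s : s != 0 ->
  (\int[leb]_(y in setT) ((y - m) ^+ 2 * normal_pdf m s y)%:E <= (8 * s ^+ 2)%:E)%E.
Proof.
move=> s0; have s20 : 0 < s ^+ 2 by rewrite exprn_even_gt0.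
(* Half of the exponent absorbs the square; the other half is, up to the factor sqrt 2, the normal
   density of variance [q ^+ 2]. The constant 8 comes from u exp(- u / 2) <= 2, from sqrt 2 <= 2,
   and from the factor 2 in (y - m)^2 = 2 s^2 u. *)
pose q := s * Num.sqrt 2.
have q2 : q ^+ 2 = 2 * s ^+ 2 by rewrite exprMn sqr_sqrtr // mulrC.
have q0 : q != 0 by rewrite mulf_neq0 // gt_eqF // sqrtr_gt0.
have pk : normal_peak s = Num.sqrt 2 * normal_peak q.
  have r2 : Num.sqrt 2 != 0 :> R by rewrite gt_eqF // sqrtr_gt0.
  rewrite /normal_peak q2; have -> : 2 * s ^+ 2 * pi *+ 2 = 2 * (s ^+ 2 * pi *+ 2).
    by rewrite -mulrA mulrnAr.
  by rewrite [in RHS]sqrtrM // invfM mulrA divff // mul1r.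
have le y : (y - m) ^+ 2 * normal_pdf m s y <= 8 * s ^+ 2 * normal_pdf m q y.
  rewrite !normal_pdfE // /normal_fun q2 pk.
  pose u := (y - m) ^+ 2 / (s ^+ 2 *+ 2).
  have u0 : 0 <= u by rewrite divr_ge0 ?sqr_ge0 // mulrn_wge0 // ltW.
  have -> : - (y - m) ^+ 2 / (s ^+ 2 *+ 2) = - (u / 2) - u / 2 by rewrite /u; field.
  have -> : - (y - m) ^+ 2 / (2 * s ^+ 2 *+ 2) = - (u / 2).
    by rewrite /u; field.
  have -> : (y - m) ^+ 2 = u * (2 * s ^+ 2) by rewrite /u -mulr_natr; field.
  have ue : u * expR (- (u / 2)) <= 2.
    rewrite expRN ler_pdivrMr ?expR_gt0 //.
    by have := expR_ge1Dx (u / 2); lra.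
  have r2 : 0 <= Num.sqrt (2 : R) <= 2.
    rewrite sqrtr_ge0 /= -[leRHS]ger0_norm // -sqrtr_sqr ler_sqrt ?sqr_ge0 //; lra.
  rewrite expRD; set e := expR _ in ue *; set pq := normal_peak q.
  have -> : u * (2 * s ^+ 2) * (Num.sqrt 2 * pq * (e * e)) =
    (u * e) * (Num.sqrt 2) * (2 * s ^+ 2 * (pq * e)) by ring.
  have -> : 8 * s ^+ 2 * (pq * e) = 2 * 2 * (2 * s ^+ 2 * (pq * e)) by ring.
  have pe : 0 <= 2 * s ^+ 2 * (pq * e).
    by apply: mulr_ge0; [rewrite mulr_ge0 // ltW|rewrite mulr_ge0 ?normal_peak_ge0 ?expR_ge0].
  have [r20 r22] := andP r2.
  by rewrite ler_wpM2r // ler_pM // mulr_ge0 ?expR_ge0.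
have mpdf q' : measurable_fun setT (fun y => (normal_pdf m q' y)%:E).
  by apply/measurable_EFinP; exact: measurable_normal_pdf.
have c0 : 0 <= 8 * s ^+ 2 by rewrite mulr_ge0 // ltW.
apply: (@le_trans _ _ (\int[leb]_(y in setT) ((8 * s ^+ 2)%:E * (normal_pdf m q y)%:E))%E).
  apply: ge0_le_integral => //.
  - by move=> y _; rewrite lee_fin mulr_ge0 ?sqr_ge0 ?normal_pdf_ge0.
  - apply/measurable_EFinP/measurable_funM; last exact: measurable_normal_pdf.
    by apply: measurable_funX; exact: measurable_funB.
  - by apply: emeasurable_funM => //; exact: mpdf.
  - by move=> y _; rewrite -EFinM lee_fin.
rewrite ge0_integralZl //; last 2 first.
- exact: mpdf.
- by move=> y _; rewrite lee_fin normal_pdf_ge0.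
by rewrite integral_normal_pdf mule1.
Qed.

Lemma normal_prob_le_peak m s (A : set R) (l : \bar R) : s != 0 -> measurable A -> (leb A <= l)%E ->
  (normal_prob m s A <= (normal_peak s)%:E * l)%E.
Proof.
move=> s0 mA Al; apply: (@le_trans _ _ (\int[leb]_(x in A) (normal_peak s)%:E)%E).
  apply: ge0_le_integral => //.
  - by move=> x _; rewrite lee_fin normal_pdf_ge0.
  - by apply/measurable_funTS/measurable_EFinP; exact: measurable_normal_pdf.
  - by move=> x _; rewrite lee_fin normal_pdf_ub.
by rewrite integral_cst // lee_wpmul2l // lee_fin normal_peak_ge0.
Qed.

Lemma normal_peak_le s : s != 0 -> normal_peak s <= `|s|^-1.
Proof.
move=> s0; rewrite /normal_peak lef_pV2 ?posrE ?normr_gt0 ?sqrtr_gt0 //; last first.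
  by rewrite mulrn_wgt0 // mulr_gt0 ?pi_gt0 // exprn_even_gt0.
rewrite -sqrtr_sqr ler_sqrt; last by rewrite mulrn_wge0 // mulr_ge0 ?sqr_ge0 // pi_ge0.
rewrite -mulrnAr ler_peMr ?sqr_ge0 // -mulr_natr.
by have := pi_ge2 R; lra.
Qed.

Context {d : measure_display} {T : measurableType d} (P : probability T R).

(** The parameters m and s of the law are related to the moments only by an inequality. If s = 0,
    then Y = m almost surely, against the second moment v + m^2 > 0 of Y - m. Otherwise v <= 8 s^2
    by [normal_second_moment], so the density is at most 1 / |s| <= 3 / sqrt v, on an interval of
    length 2 x. *)
Lemma gaussian_small_ball (Y : T -> R) v x : measurable_fun setT Y -> is_gaussian P Y ->
  (\int[P]_w (Y w)%:E = 0)%E -> (\int[P]_w (Y w ^+ 2)%:E = v%:E)%E -> 0 < v -> 0 <= x ->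
  (P [set w | (`|Y w| <= x)%R] <= (6 * x / Num.sqrt v)%:E)%E.
Proof.
move=> mY [m [s law]] Y0 Y2 v0 x0.
have mY2 : measurable_fun setT (fun w => Y w ^+ 2) by exact: measurable_funX.
have iY2 : P.-integrable setT (fun w => (Y w ^+ 2)%:E).
  by apply: integrable_ge0 => //; [move=> w _; exact: sqr_ge0|rewrite Y2 ltry].
have i1 : P.-integrable setT (fun w => (cst 1 w : R)%:E).
  by apply: finite_measure_integrable_cst.
have iY : P.-integrable setT (fun w => (Y w)%:E).
  apply: integrable_dom (integrable_addr measurableT iY2 i1) => // w _.
  by rewrite /= ler_norml; have := sqr_ge0 (Y w - 1); have := sqr_ge0 (Y w + 1); nra.
have centered : (\int[P]_w ((Y w - m) ^+ 2 * 1)%:E = (v + m ^+ 2)%:E)%E.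
  have E w : (Y w - m) ^+ 2 * 1 = Y w ^+ 2 + ((- (2 * m)) * Y w + m ^+ 2 * cst 1 w).
    by rewrite /=; ring.
  under eq_integral do rewrite E.
  have i3 := integrable_mulrl (m ^+ 2) measurableT i1.
  have i2 := integrable_mulrl (- (2 * m)) measurableT iY.
  under eq_integral do rewrite EFinD.
  rewrite integralD //; last exact: integrable_addr.
  under [X in (_ + X)%E]eq_integral do rewrite EFinD.
  rewrite integralD //; under [X in (_ + (X + _))%E]eq_integral do rewrite EFinM.
  rewrite integralZl // Y0 mule0 add0e Y2 EFinD; congr (_ + _)%E.
  by under eq_integral do rewrite /= mulr1; rewrite integral_cst //= probability_setT mule1.
have mball : measurable [set y : R | `|y| <= x].
  rewrite (_ : [set y | _] = `[- x, x]%classic); first exact: measurable_itv.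
  by apply/seteqP; split => y /=; rewrite in_itv /= ler_norml.
have tail : (\int[P]_w ((Y w - m) ^+ 2 * 1)%:E =
    \int[leb]_(r in `]0%R, +oo[) gaussian_law m s [set y | (r < (y - m) ^+ 2)%R])%E.
  rewrite (@tail_integral _ _ _ P (fun w => (Y w - m) ^+ 2) (cst 1)) //; last 2 first.
  - by apply: measurable_funX; exact: measurable_funB.
  - by move=> w; exact: sqr_ge0.
  have Pcst A : measurable A -> (\int[P]_(w in A) (cst 1 w : R)%:E = P A)%E.
    by move=> mA; rewrite -[RHS]mul1e -(integral_cst P mA 1%E).
  have mlt d' (T' : measurableType d') (X : T' -> R) r : measurable_fun setT X ->
      measurable [set w | r < X w].
    move=> mX; rewrite (_ : [set w | _] = setT `&` X @^-1` `]r, +oo[%classic); first exact: mX.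
    by rewrite setTI; apply/seteqP; split => w /=; rewrite in_itv /= andbT.
  have mr r : measurable [set y : R | r < (y - m) ^+ 2].
    by apply: mlt; apply: measurable_funX; exact: measurable_funB.
  apply: eq_integral => r _; rewrite Pcst -?law //.
  by apply: mlt; apply: measurable_funX; exact: measurable_funB.
have [s0|s0] := eqVneq s 0.
  have : (0 < v + m ^+ 2)%R by rewrite ltr_pwDl ?sqr_ge0.
  rewrite -lte_fin -centered tail s0 /gaussian_law eqxx integral0_eq ?ltxx // => r /=.
  rewrite in_itv /= andbT => r0; rewrite diracE memNset //= subrr expr0n /=.
  by apply/negP; rewrite -leNgt ltW.
have s_ge : v <= 8 * s ^+ 2.
  rewrite -lee_fin; apply: le_trans (normal_second_moment m s0).
  rewrite (tail_integral leb (X := fun y : R => (y - m) ^+ 2)) //.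
  - apply: (@le_trans _ _ (v + m ^+ 2)%:E); first by rewrite lee_fin lerDl sqr_ge0.
    rewrite -centered tail le_eqVlt; apply/orP; left; apply/eqP; apply: eq_integral => r _.
    by rewrite /gaussian_law (negbTE s0).
  - by apply: measurable_funX; exact: measurable_funB.
  - exact: measurable_normal_pdf.
  - by move=> y; exact: sqr_ge0.
  - by move=> y; exact: normal_pdf_ge0.
have sv : Num.sqrt v <= 3 * `|s|.
  rewrite -[3 * _]ger0_norm ?mulr_ge0 // -sqrtr_sqr ler_sqrt ?sqr_ge0 //.
  by rewrite exprMn real_normK ?num_real //; have := sqr_ge0 s; lra.
have rv0 : 0 < Num.sqrt v by rewrite sqrtr_gt0.
have := law _ mball; rewrite /preimage /= => ->; rewrite /gaussian_law (negbTE s0).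
apply: (le_trans (@normal_prob_le_peak m s _ (2 * x)%:E s0 mball _)).
  rewrite (_ : [set y | _] = `[- x, x]%classic); last first.
    by apply/seteqP; split => y /=; rewrite in_itv /= ler_norml.
  rewrite lebesgue_measure_itv /= lte_fin; case: ifP => _; last by rewrite lee_fin mulr_ge0.
  by rewrite -EFinB lee_fin; lra.
rewrite -EFinM lee_fin; apply: (@le_trans _ _ (`|s|^-1 * (2 * x))).
  by rewrite ler_wpM2r ?mulr_ge0 // normal_peak_le.
rewrite ler_pdivlMr // -mulrA ler_pdivrMl ?normr_gt0 //.
by have := ler_wpM2r x0 sv; lra.
Qed.

End gaussian.

(** * Paths of the fractional Brownian motion *)

Section fbm.
Context {d : measure_display} {T : measurableType d} {R : realType}.
Variables (P : probability T R) (H : R) (BH : R -> T -> R).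
Hypotheses (H01 : 2^-1 < H < 1) (fbm : fractional_brownian_motion H P BH).
Implicit Types (a b t s x : R).

Let H0 : 0 < H. Proof. by case/andP: H01 => h _; lra. Qed.

Let mBH t : 0 <= t <= 1 -> measurable_fun setT (BH t).
Proof. exact: fbm_measurable fbm t. Qed.

Let EBB t s : 0 <= t <= 1 -> 0 <= s <= 1 -> (\int[P]_w (BH t w * BH s w)%:E =
  (2^-1 * (s `^ (2 * H) + t `^ (2 * H) - `|s - t| `^ (2 * H)))%:E)%E.
Proof. by move=> t01 s01; rewrite -(fbm_covariance fbm t01 s01) unlock. Qed.

Let EB2 t : 0 <= t <= 1 -> (\int[P]_w (BH t w ^+ 2)%:E = (t `^ (2 * H))%:E)%E.
Proof.
move=> t01; under eq_integral do rewrite expr2; rewrite EBB // subrr normr0.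
have -> : 0 `^ (2 * H) = 0 :> R by rewrite powR0 // mulf_neq0 // gt_eqF.
by congr EFin; rewrite subr0; field.
Qed.

Let iB2 t : 0 <= t <= 1 -> P.-integrable setT (fun w => (BH t w ^+ 2)%:E).
Proof.
move=> t01; apply: integrable_ge0 => //.
- by apply: measurable_funX; exact: mBH.
- by move=> w _; exact: sqr_ge0.
- by rewrite EB2 // ltry.
Qed.

Let iB t : 0 <= t <= 1 -> P.-integrable setT (fun w => (BH t w)%:E).
Proof.
move=> t01; have i1 : P.-integrable setT (fun w => (cst 1 w : R)%:E).
  by apply: finite_measure_integrable_cst.
apply: (integrable_dom _ _ _ (integrable_addr measurableT (iB2 t01) i1)) => //; first exact: mBH.
by move=> w _; rewrite /= ler_norml; have := sqr_ge0 (BH t w - 1); have := sqr_ge0 (BH t w + 1); nra.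
Qed.

Let iBB t s : 0 <= t <= 1 -> 0 <= s <= 1 -> P.-integrable setT (fun w => (BH t w * BH s w)%:E).
Proof.
move=> t01 s01; apply: (integrable_dom _ _ _ (integrable_addr measurableT (iB2 t01) (iB2 s01))) => //.
  by apply: measurable_funM; exact: mBH.
move=> w _; rewrite /= ler_norml.
by have := sqr_ge0 (BH t w - BH s w); have := sqr_ge0 (BH t w + BH s w); nra.
Qed.

Lemma measurable_fbm_increment a b : 0 <= a <= 1 -> 0 <= b <= 1 ->
  measurable_fun setT (fun w => BH b w - BH a w).
Proof. by move=> a01 b01; apply: measurable_funB; exact: mBH. Qed.

Lemma fbm_increment_gaussian a b : 0 <= a <= 1 -> 0 <= b <= 1 ->
  is_gaussian P (fun w => BH b w - BH a w).
Proof.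
move=> a01 b01.
have := fbm_gaussian fbm (n := 2) (t := fun i => if i == ord0 then a else b)
  (fun i => if i == ord0 then -1 else 1).
have h (i : 'I_2) : 0 <= (if i == ord0 then a else b) <= 1 by case: ifP.
move=> /(_ h); congr (is_gaussian P _); apply/funext => w.
by rewrite !big_ord_recl big_ord0 /= mulN1r mul1r addr0 addrC.
Qed.

Lemma fbm_increment_mean a b : 0 <= a <= 1 -> 0 <= b <= 1 ->
  (\int[P]_w (BH b w - BH a w)%:E = 0)%E.
Proof.
move=> a01 b01; under eq_integral do rewrite EFinB.
rewrite integralB //; [|exact: iB|exact: iB].
have E t : 0 <= t <= 1 -> (\int[P]_w (BH t w)%:E = 0)%E.
  by move=> t01; rewrite -(fbm_centered fbm t01) unlock.
by rewrite !E // sube0.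
Qed.

Lemma fbm_increment_sqr a b : 0 <= a <= 1 -> 0 <= b <= 1 -> a <= b ->
  (\int[P]_w ((BH b w - BH a w) ^+ 2)%:E = ((b - a) `^ (2 * H))%:E)%E.
Proof.
move=> a01 b01 ab.
have E w : (BH b w - BH a w) ^+ 2 = BH b w ^+ 2 + (BH a w ^+ 2 + - 2 * (BH b w * BH a w)) by ring.
under eq_integral do rewrite E EFinD; rewrite integralD //; first last.
- by apply: integrable_addr => //; [exact: iB2|apply: integrable_mulrl => //; exact: iBB].
- exact: iB2.
under [X in (_ + X)%E]eq_integral do rewrite EFinD.
rewrite integralD //; [|exact: iB2|by apply: integrable_mulrl => //; exact: iBB].
under [X in (_ + (_ + X))%E]eq_integral do rewrite EFinM.
rewrite integralZl //; last exact: iBB.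
rewrite !EB2 // EBB // -EFinM -!EFinD distrC ger0_norm ?subr_ge0 //; congr EFin.
by field.
Qed.

Lemma fbm_small_ball a b x : 0 <= a <= 1 -> 0 <= b <= 1 -> a < b -> 0 <= x ->
  (P [set w | (`|BH b w - BH a w| <= x)%R] <= (6 * x / (b - a) `^ H)%:E)%E.
Proof.
move=> a01 b01 ab x0; have ba : 0 < b - a by rewrite subr_gt0.
have -> : (b - a) `^ H = Num.sqrt ((b - a) `^ (2 * H)).
  by rewrite mulrC powRrM powR_mulrn ?powR_ge0 // sqrtr_sqr ger0_norm ?powR_ge0.
apply: gaussian_small_ball => //.
- exact: measurable_fbm_increment.
- exact: fbm_increment_gaussian.
- exact: fbm_increment_mean.
- by apply: fbm_increment_sqr => //; exact: ltW.
- exact: powR_gt0.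
Qed.

(** Integrate |y| <= y^2 / (2 c) + c / 2, where c = (b - a)^H is the standard deviation of the
    increment. *)
Lemma fbm_increment_abs a b : 0 <= a <= 1 -> 0 <= b <= 1 -> a < b ->
  (\int[P]_w (`|BH b w - BH a w|)%:E <= ((b - a) `^ H)%:E)%E.
Proof.
move=> a01 b01 ab; have ba : 0 < b - a by rewrite subr_gt0.
pose c := (b - a) `^ H; have c0 : 0 < c by exact: powR_gt0.
have my := measurable_fbm_increment a01 b01.
have cc : (b - a) `^ (2 * H) = c ^+ 2 by rewrite mulrC powRrM powR_mulrn ?powR_ge0.
apply: (@le_trans _ _ (\int[P]_w ((2 * c)^-1%:E * ((BH b w - BH a w) ^+ 2)%:E + (c / 2)%:E))%E).
  have c20 : 0 <= (2 * c)^-1 by rewrite invr_ge0 mulr_ge0 // ltW.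
  have c21 : 0 <= c / 2 by rewrite divr_ge0 // ltW.
  apply: ge0_le_integral => //.
  - by apply/measurable_EFinP; exact: measurableT_comp.
  - apply: emeasurable_funD => //; apply: emeasurable_funM => //.
    by apply/measurable_EFinP; exact: measurable_funX.
  - move=> w _; rewrite -EFinM -EFinD lee_fin; set y := BH b w - BH a w.
    have -> : (2 * c)^-1 * y ^+ 2 + c / 2 = (`|y| ^+ 2 + c ^+ 2) / (2 * c).
      by rewrite real_normK ?num_real //; field; rewrite gt_eqF.
    rewrite ler_pdivlMr ?mulr_gt0 //; have := sqr_ge0 (`|y| - c); nra.
rewrite ge0_integralD //; first last.
- by move=> w _; rewrite lee_fin divr_ge0 // ltW.
- apply: emeasurable_funM => //; apply/measurable_EFinP; exact: measurable_funX.
- by move=> w _; rewrite -EFinM lee_fin mulr_ge0 ?sqr_ge0 // invr_ge0 mulr_ge0 // ltW.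
rewrite ge0_integralZl //; first last.
- by rewrite lee_fin invr_ge0 mulr_ge0 // ltW.
- by move=> w _; rewrite lee_fin sqr_ge0.
- by apply/measurable_EFinP; exact: measurable_funX.
rewrite (fbm_increment_sqr a01 b01 (ltW ab)) cc integral_cst //= probability_setT mule1.
by rewrite -EFinM -EFinD lee_fin -/c le_eqVlt; apply/orP; left; apply/eqP; field; rewrite gt_eqF.
Qed.

(** Markov's inequality: each squared increment has expectation h^(2 H). *)
Lemma fbm_quadratic_sum (m : nat) a h x : 0 <= a -> 0 < h -> a + m%:R * h <= 1 -> 0 < x ->
  (P [set w | (x <= \sum_(i < m) (BH (a + i.+1%:R * h) w - BH (a + i%:R * h) w) ^+ 2)%R] <=
   (m%:R * h `^ (2 * H) / x)%:E)%E.
Proof.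
move=> a0 h0 am1 x0.
have pt i : (i <= m)%N -> 0 <= a + i%:R * h <= 1.
  move=> im; have ih0 : 0 <= i%:R * h by rewrite mulr_ge0 // ltW.
  rewrite addr_ge0 //=; apply: le_trans am1.
  by rewrite lerD2l ler_wpM2r ?ler_nat // ltW.
pose y (i : nat) w := (BH (a + i.+1%:R * h) w - BH (a + i%:R * h) w) ^+ 2.
have my (i : 'I_m) : measurable_fun setT (y i).
  by apply: measurable_funX; apply: measurable_fbm_increment; apply: pt => //; exact: ltnW.
have y0 (i : nat) w : 0 <= y i w by exact: sqr_ge0.
have mS : measurable_fun setT (fun w => \sum_(i < m) y i w) by exact: measurable_sum.
have mA : measurable [set w | x <= \sum_(i < m) y i w].
  rewrite (_ : [set w | _] = setT `&` (fun w => \sum_(i < m) y i w) @^-1` `[x, +oo[%classic).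
    exact: mS.
  by rewrite setTI; apply/seteqP; split => w /=; rewrite in_itv /= andbT.
have : (x%:E * P [set w | (x <= \sum_(i < m) y i w)%R] <= (m%:R * h `^ (2 * H))%:E)%E.
  have -> : ((m%:R * h `^ (2 * H))%:E = \int[P]_w (\sum_(i < m) y i w)%:E)%E.
    under eq_integral do rewrite -sumEFin.
    rewrite ge0_integral_sum //; first last.
    - by move=> i w _; rewrite lee_fin.
    - by move=> i; apply/measurable_EFinP; exact: my.
    transitivity (\sum_(i < m) (h `^ (2 * H))%:E)%E.
      by rewrite sumEFin sumr_const card_ord mulr_natl.
    apply: eq_bigr => i _; rewrite fbm_increment_sqr ?pt //; last 2 first.
    - exact: ltnW.
    - by rewrite lerD2l ler_wpM2r ?ler_nat // ltW.
    by congr ((_ `^ _)%:E); rewrite -natr1; ring.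
  rewrite -integral_cst //.
  apply: (@le_trans _ _ (\int[P]_(w in [set w | (x <= \sum_(i < m) y i w)%R]) (\sum_(i < m) y i w)%:E)%E).
    apply: ge0_le_integral => //.
    - by move=> w _; rewrite lee_fin ltW.
    - by apply/measurable_EFinP; exact: measurable_funTS.
  apply: ge0_subset_integral => //.
  - exact/measurable_EFinP.
  - by move=> w _; rewrite lee_fin sumr_ge0.
by move=> h1; rewrite EFinM lee_pdivlMr // muleC.
Qed.

End fbm.

(** * Measurability of a continuous process evaluated at a variable time *)

Section left_point_approximation.
Context {R : realType} {d : measure_display} {U : measurableType d}.
Variables (D : set U) (tau : U -> R) (X : R -> U -> R).
Hypotheses (tau01 : forall z, D z -> 0 <= tau z <= 1)
  (cX : forall z, D z -> {within `[0, 1], continuous (X ^~ z)}).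

(** A telescoping sum whose value is that of [X] at a grid point just before [tau z]. It is written
    with indicators and increments because products of an [after] with a function known at that time
    are the basic predictable functions. *)
Definition left_point (N : R) (m : nat) z : R :=
  X 0 z + \sum_(k < m) after (k.+1%:R / N) (tau z) *
    (X (k.+1%:R / N) z - X (k%:R / N) z).

Lemma left_pointE (N : R) m z : 0 < N -> D z ->
  exists k : nat, [/\ (k <= m)%N, left_point N m z = X (k%:R / N) z,
    k%:R / N <= tau z & k = m \/ tau z <= k.+1%:R / N].
Proof.
move=> N0 Dz; elim: m => [|m [k [km E kt hk]]].
  exists 0%N; split => //; last by left.
    by rewrite /left_point big_ord0 addr0 mul0r.
  by rewrite mul0r; case/andP: (tau01 Dz).
have S : left_point N m.+1 z = left_point N m z + after (m.+1%:R / N) (tau z) *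
    (X (m.+1%:R / N) z - X (m%:R / N) z) by rewrite /left_point big_ord_recr /= addrA.
have [mt|tm] := ltP (m.+1%:R / N) (tau z).
  have kEm : k = m.
    case: hk => // /(lt_le_trans mt); rewrite ltr_pM2r ?invr_gt0 // ltr_nat ltnS ltnNge km; done.
  exists m.+1; split => //; [|exact: ltW|by left].
  by rewrite S E /after mt kEm; ring.
exists k; split => //; first exact: leq_trans km _.
  by rewrite S E /after ltNge tm /= mul0r addr0.
by right; case: hk => [->|].
Qed.

Lemma left_point_cvg z : D z -> (fun n => left_point n.+1%:R n z) @ \oo --> X (tau z) z.
Proof.
move=> Dz; have /subspace_continuousP cz := cX Dz; have t01 := tau01 Dz.
apply/cvgrPdist_le => e e0.
have := cz (tau z); rewrite /= in_itv /= => /(_ t01) /cvgrPdist_le /(_ e e0).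
rewrite near_withinE => /nbhs_ballP[r /= r0 hr].
near=> n; have N0 : 0 < n.+1%:R :> R by rewrite ltr0n.
have [k [kn -> kt hk]] := left_pointE n N0 Dz.
have k1 : tau z <= k.+1%:R / n.+1%:R.
  by case: hk => // ->; rewrite divff ?gt_eqF //; case/andP: t01.
have kz : 0 <= k%:R / n.+1%:R :> R by rewrite divr_ge0.
have {}k1 : tau z - k%:R / n.+1%:R <= n.+1%:R^-1.
  by move: k1; rewrite -[k.+1%:R]natr1 mulrDl mul1r lerBlDl.
apply: hr => /=; last by rewrite in_itv /= kz (le_trans kt) //; case/andP: t01.
rewrite /ball /= ger0_norm ?subr_ge0 //; apply: le_lt_trans k1 _.
by near: n; apply: near_infty_natSinv_lt (PosNum r0).
Unshelve. all: by end_near. Qed.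

(** Pointwise limit of the left-point sums. With mesh 1 / (n + 1) and n terms, every indicator
    switches on at a time in []0, 1[]. The lemma gives both the joint measurability of the paths and
    the predictability of continuous adapted processes. *)
Lemma measurable_at_time : measurable_fun D (X 0) ->
  (forall a b, 0 < a < 1 -> 0 <= b <= a ->
     measurable_fun D (fun z => after a (tau z) * X b z)) ->
  measurable_fun D (fun z => X (tau z) z).
Proof.
move=> mX0 mX; apply: (measurable_fun_cvg _ left_point_cvg) => n.
apply: measurable_funD => //; apply: measurable_sum => k.
have N0 : 0 < n.+1%:R :> R by rewrite ltr0n.
have k01 : 0 < (k.+1%:R / n.+1%:R : R) < 1.
  by rewrite divr_gt0 ?ltr0n //= ltr_pdivrMr // mul1r ltr_nat ltnS.
rewrite (_ : (fun z => _) = fun z =>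
  after (k.+1%:R / n.+1%:R) (tau z) * X (k.+1%:R / n.+1%:R) z -
  after (k.+1%:R / n.+1%:R) (tau z) * X (k%:R / n.+1%:R) z); last first.
  by apply/funext => z; rewrite mulrBr.
apply: measurable_funB; apply: mX => //; first by rewrite lexx andbT ltW //; case/andP: k01.
by rewrite divr_ge0 //= ler_pM2r ?invr_gt0 // ler_nat.
Qed.

End left_point_approximation.

Lemma measurable_clamp {R : realType} : measurable_fun setT (@clamp R).
Proof.
apply: continuous_measurable_fun => x.
apply: continuous_max; first exact: cvg_cst.
by apply: continuous_min; [exact: cvg_cst|exact: cvg_id].
Qed.

Lemma integrable_powR_convolution {R : realType} (a b p q : R) : a < b -> -1 < p -> -1 < q ->
  (\int[leb]_(x in `]a, b[) \int[leb]_(u in `]x, b[) ((x - a) `^ p * (u - x) `^ q)%:E < +oo)%E.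
Proof.
move=> ab p1 q1; have q10 : 0 < q + 1 by lra.
have mx (x r : R) : measurable_fun setT (fun u : R => (u - x) `^ r).
  by apply: measurable_powR_comp; exact: measurable_funB.
have E x : x < b -> (\int[leb]_(u in `]x, b[) ((x - a) `^ p * (u - x) `^ q)%:E =
    ((x - a) `^ p * ((b - x) `^ (q + 1) / (q + 1)))%:E)%E.
  move=> xb; under eq_integral do rewrite EFinM.
  rewrite ge0_integralZl //; last 3 first.
  - by apply/measurable_funTS/measurable_EFinP; exact: mx.
  - by move=> u _; rewrite lee_fin powR_ge0.
  - by rewrite lee_fin powR_ge0.
  by rewrite (integral_powR_subr (ltW xb)).
have C0 : 0 <= (b - a) `^ (q + 1) / (q + 1) by rewrite divr_ge0 ?powR_ge0 // ltW.
apply: (@le_lt_trans _ _ (\int[leb]_(x in `]a, b[)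
    (((b - a) `^ (q + 1) / (q + 1))%:E * ((x - a) `^ p)%:E))%E); last first.
  rewrite ge0_integralZl //; last 2 first.
  - by apply/measurable_funTS/measurable_EFinP; exact: mx.
  - by move=> u _; rewrite lee_fin powR_ge0.
  by rewrite (integral_powR_subr (ltW ab)) // -EFinM ltry.
under eq_integral => x do rewrite inE /= in_itv /= => /andP[_ xb].
apply: ge0_le_integral => //.
- by move=> x _; apply: integral_ge0 => u _; rewrite lee_fin mulr_ge0 ?powR_ge0.
- have mF : measurable_fun setT (fun z : R * R => ((z.1 - a) `^ p * (z.2 - z.1) `^ q)%:E).
    apply/measurable_EFinP/measurable_funM; apply: measurable_powR_comp; exact: measurable_funB.
  apply: (measurable_triangle_tonelli1 mF) => z; by rewrite lee_fin mulr_ge0 ?powR_ge0.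
- by apply: emeasurable_funM => //; apply/measurable_funTS/measurable_EFinP; exact: mx.
move=> x; rewrite /= in_itv /= => /andP[ax xb]; rewrite E // -EFinM lee_fin mulrC.
rewrite ler_wpM2r ?powR_ge0 // ler_wpM2r //; first by rewrite invr_ge0 ltW.
by rewrite ge0_ler_powR ?nnegrE; lra.
Qed.

Section tonelli3.
Context {d1 d2 d3 : measure_display} {T1 : measurableType d1} {T2 : measurableType d2}
  {T3 : measurableType d3} {R : realType}.
Variables (m1 : {sigma_finite_measure set T1 -> \bar R})
  (m2 : {sigma_finite_measure set T2 -> \bar R}) (m3 : {sigma_finite_measure set T3 -> \bar R}).
Variable f : (T1 * T2) * T3 -> \bar R.
Hypotheses (mf : measurable_fun setT f) (f0 : forall z, (0 <= f z)%E).

Let g (z : T1 * T3) := (\int[m2]_y f ((z.1, y), z.2))%E.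

Let mg : measurable_fun setT g.
Proof.
have mh : measurable_fun setT (fun z : (T1 * T3) * T2 => ((z.1.1, z.2), z.1.2)).
  apply: measurable_fun_pair; last exact: measurableT_comp.
  by apply: measurable_fun_pair => //; exact: measurableT_comp.
have := @measurable_fun_fubini_tonelli_F _ _ _ _ _ m2 _ (measurableT_comp mf mh).
by apply=> z; exact: f0.
Qed.

Let g0 z : (0 <= g z)%E. Proof. exact: integral_ge0. Qed.

Lemma measurable_tonelli3_12 : measurable_fun setT (fun w => \int[m1]_x \int[m2]_y f ((x, y), w))%E.
Proof. exact: (@measurable_fun_fubini_tonelli_G _ _ _ _ _ m1 g mg g0). Qed.

Lemma measurable_tonelli3_3 : measurable_fun setT (fun z => \int[m3]_w f (z, w))%E.
Proof. exact: (@measurable_fun_fubini_tonelli_F _ _ _ _ _ m3 f mf f0). Qed.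

Lemma tonelli3 : (\int[m3]_w \int[m1]_x \int[m2]_y f ((x, y), w) =
  \int[m1]_x \int[m2]_y \int[m3]_w f ((x, y), w))%E.
Proof.
rewrite -(@fubini_tonelli _ _ _ _ _ m1 m3 g mg g0); apply: eq_integral => x _.
have mh : measurable_fun setT (fun z : T3 * T2 => ((x, z.2), z.1)).
  by apply: measurable_fun_pair => //; exact: measurable_fun_pair.
exact: (@fubini_tonelli _ _ _ _ _ m3 m2 (fun z : T3 * T2 => f ((x, z.2), z.1))
  (measurableT_comp mf mh) (fun z => f0 ((x, z.2), z.1))).
Qed.

End tonelli3.

Lemma le_iterated_integral {d1 d2 : measure_display} {T1 : measurableType d1}
    {T2 : measurableType d2} {R : realType} (m1 : {sigma_finite_measure set T1 -> \bar R})
    (m2 : {sigma_finite_measure set T2 -> \bar R}) (f g : T1 * T2 -> \bar R) :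
  measurable_fun setT f -> measurable_fun setT g -> (forall z, (0 <= f z)%E) ->
  (forall z, (f z <= g z)%E) ->
  (\int[m1]_x \int[m2]_y f (x, y) <= \int[m1]_x \int[m2]_y g (x, y))%E.
Proof.
move=> mf mg f0 fg; have g0 z : (0 <= g z)%E by exact: le_trans (fg z).
apply: ge0_le_integral => //.
- by move=> x _; exact: integral_ge0.
- exact: (@measurable_fun_fubini_tonelli_F _ _ _ _ _ m2 f mf f0).
- exact: (@measurable_fun_fubini_tonelli_F _ _ _ _ _ m2 g mg g0).
move=> x _; have mh : measurable_fun setT (fun y : T2 => (x, y)) by exact: measurable_fun_pair.
by apply: ge0_le_integral => //; [exact: (measurableT_comp mf mh)|exact: (measurableT_comp mg mh)].
Qed.

Section fbm_paths.
Context {d : measure_display} {T : measurableType d} {R : realType}.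
Variables (P : probability T R) (H : R) (BH : R -> T -> R).
Hypotheses (H01 : 2^-1 < H < 1) (fbm : fractional_brownian_motion H P BH).
Implicit Types (a b t s x : R).

Lemma measurable_fbm_clamp : measurable_fun setT (fun z : R * T => BH (clamp z.1) z.2).
Proof.
have m2 b : 0 <= b <= 1 -> measurable_fun setT (fun z : R * T => BH b z.2).
  by move=> b01; apply: (measurableT_comp (fbm_measurable fbm b01)).
apply: (@measurable_at_time _ _ _ setT (fun z : R * T => clamp z.1) (fun t z => BH t z.2)).
- by move=> z _; exact: clamp_itv.
- by move=> z _; exact: (fbm_continuous fbm).
- by apply: m2; rewrite lexx ler01.
move=> a b /andP[a0 a1] /andP[b0 ba]; apply: measurable_funM; last by apply: m2; apply/andP; split; lra.
apply: (measurableT_comp (measurable_after a)).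
exact: (measurableT_comp measurable_clamp).
Qed.

(** The double integral has finite expectation. By Tonelli's theorem and E |B_u - B_x| <= (u - x)^H,
    it is at most the integral of (x - a)^(- al) (u - x)^(H + al - 2), which converges because al <
    1 and H + al - 2 > -1. *)
Lemma ae_fbm_marchaud_finite al a : 1 - H < al -> al < 1 -> 0 <= a < 1 ->
  {ae P, forall w, marchaud_finite al (BH ^~ w) a 1}.
Proof.
move=> alH al1 /andP[a0 a1].
pose G t w := BH (clamp t) w.
pose F (z : (R * R) * T) : \bar R :=
  ((z.1.1 - a) `^ (- al) * (`|G z.1.2 z.2 - G z.1.1 z.2| * (z.1.2 - z.1.1) `^ (al - 2)))%:E.
have F0 z : (0 <= F z)%E by rewrite lee_fin !mulr_ge0 ?powR_ge0.
have mG1 : measurable_fun setT (fun z : (R * R) * T => G z.1.1 z.2).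
  have mh : measurable_fun setT (fun z : (R * R) * T => (z.1.1, z.2)).
    by apply: measurable_fun_pair => //; exact: measurableT_comp.
  exact: (measurableT_comp measurable_fbm_clamp mh).
have mG2 : measurable_fun setT (fun z : (R * R) * T => G z.1.2 z.2).
  have mh : measurable_fun setT (fun z : (R * R) * T => (z.1.2, z.2)).
    by apply: measurable_fun_pair => //; exact: measurableT_comp.
  exact: (measurableT_comp measurable_fbm_clamp mh).
have m11 : measurable_fun setT (fun z : (R * R) * T => z.1.1) by exact: measurableT_comp.
have m12 : measurable_fun setT (fun z : (R * R) * T => z.1.2) by exact: measurableT_comp.
have mF : measurable_fun setT F.
  apply/measurable_EFinP/measurable_funM.
    by apply: measurable_powR_comp; exact: measurable_funB.
  apply: measurable_funM; first by apply: measurableT_comp => //; exact: measurable_funB.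
  by apply: measurable_powR_comp; exact: measurable_funB.
pose D := triangle a (1 : R) `*` [set: T].
have mD : measurable D by apply: measurableX => //; exact: measurable_triangle.
pose FD := F \_ D.
have mFD : measurable_fun setT FD by apply/(measurable_restrictT _ _).1 => //; exact: measurable_funTS.
have FD0 z : (0 <= FD z)%E by apply: erestrict_ge0.
pose N (w : T) : \bar R := (\int[leb]_x \int[leb]_u FD ((x, u), w))%E.
have mN : measurable_fun setT N.
  exact: (@measurable_tonelli3_12 _ _ _ _ _ _ _ leb leb FD mFD FD0).
have N0 w : (0 <= N w)%E by apply: integral_ge0 => x _; exact: integral_ge0.
have EN : (\int[P]_w N w < +oo)%E.
  have -> := @tonelli3 _ _ _ _ _ _ _ leb leb P FD mFD FD0.
  pose B (z : R * R) : \bar R := ((z.1 - a) `^ (- al) * (z.2 - z.1) `^ (H + al - 2))%:E.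
  have mB : measurable_fun setT B.
    apply/measurable_EFinP/measurable_funM; apply: measurable_powR_comp; exact: measurable_funB.
  have B0 z : (0 <= B z)%E by rewrite lee_fin mulr_ge0 ?powR_ge0.
  have al1' : -1 < - al by lra.
  have Hal : -1 < H + al - 2 by lra.
  have : (\int[leb]_(x in `]a, 1%R[) \int[leb]_(u in `]x, 1%R[) B (x, u) < +oo)%E.
    exact: integrable_powR_convolution.
  rewrite -triangle_iterated; apply: le_lt_trans.
  pose EF (z : R * R) : \bar R := (\int[P]_w FD (z, w))%E.
  have mEF : measurable_fun setT EF by exact: (@measurable_tonelli3_3 _ _ _ _ _ _ _ P FD mFD FD0).
  apply: (@le_iterated_integral _ _ _ _ _ leb leb EF (B \_ (triangle a 1)) mEF).
  - apply/(measurable_restrictT _ _).1; first exact: measurable_triangle.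
    exact: measurable_funTS.
  - by move=> z; exact: integral_ge0.
  case=> x u; rewrite /EF patchE; case: ifPn => [|nt]; last first.
    rewrite integral0_eq // => w _; rewrite /FD patchE ifF //.
    by apply/negbTE; move: nt; rewrite !notin_setE /D /= => nt [].
  rewrite inE => tri; have := tri; rewrite /triangle /= => /andP[/andP[ax xu] u1].
  have x01 : 0 <= x <= 1 by apply/andP; split; lra.
  have u01 : 0 <= u <= 1 by apply/andP; split; lra.
  have ux : 0 < u - x by rewrite subr_gt0.
  have c0 : 0 <= (x - a) `^ (- al) * (u - x) `^ (al - 2) by rewrite mulr_ge0 ?powR_ge0.
  rewrite (eq_integral (fun w => ((x - a) `^ (- al) * (u - x) `^ (al - 2))%:E *
      (`|BH u w - BH x w|)%:E)%E); last first.
    move=> w _; rewrite /FD patchE mem_set /= //.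
    by rewrite /F /G /= !clamp_id // -EFinM; congr EFin; ring.
  rewrite ge0_integralZl //; last first.
    apply/measurable_EFinP; apply: measurableT_comp => //.
    exact: (measurable_fbm_increment fbm).
  apply: (@le_trans _ _ (((x - a) `^ (- al) * (u - x) `^ (al - 2))%:E * ((u - x) `^ H)%:E)%E).
    by rewrite lee_wpmul2l // (fbm_increment_abs H01 fbm).
  rewrite -EFinM lee_fin -mulrA -powRDp //= (_ : al - 2 + H = H + al - 2) //; ring.
have iN : P.-integrable setT N.
  apply/integrableP; split => //.
  by under eq_integral do rewrite gee0_abs //.
have := integrable_ae measurableT iN.
apply: filterS => w /(_ I) finN.
apply: (@marchaud_finite_congr _ _ (fun t => G t w)).
  by move=> t; rewrite in_itv /= => /andP[at_ t1]; rewrite /G clamp_id //; apply/andP; split; lra.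
rewrite /marchaud_finite.
have -> : (\int[leb]_(x in `]a, 1%R[) \int[leb]_(u in `]x, 1%R[)
    ((x - a) `^ (- al) * (`|G u w - G x w| * (u - x) `^ (al - 2)))%:E = N w)%E.
  rewrite -(@triangle_iterated _ a 1 (fun z => F (z, w))).
  apply: eq_integral => x _; apply: eq_integral => u _; rewrite /FD !patchE; move: (x, u) => z.
  suff -> : ((z, w) \in D) = (z \in triangle a 1) by [].
  by apply/idP/idP; rewrite !inE /D /=; [case|].
by rewrite -ge0_fin_numE.
Qed.

End fbm_paths.

(** * Predictability *)

Section predictable_facts.
Context {d : measure_display} {T : measurableType d} {R : realType}.
Variable G : R -> set (set T).
Local Notation F := (fun t => <<s G t >>).
Hypothesis Gmono : forall s t, s <= t -> G s `<=` G t.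

Definition known_at (t : R) (Z : T -> R) : Prop :=
  forall V : set R, measurable V -> F t (Z @^-1` V).

Let Ft t := g_sigma_algebraType (G t).

Lemma known_atP t Z : known_at t Z <-> measurable_fun [set: Ft t] (Z : Ft t -> R).
Proof.
split=> [h _ V mV|h V mV]; first by rewrite setTI; exact: h.
by have := h measurableT V mV; rewrite setTI.
Qed.

Lemma known_at_mono s t Z : s <= t -> known_at s Z -> known_at t Z.
Proof.
move=> st h V mV; have := h V mV; apply: smallest_sub.
  exact: smallest_sigma_algebra.
by move=> A /(Gmono st); exact: sub_gen_smallest.
Qed.

Let PT := g_sigma_algebraType (predictable_rectangle F).
Let D : set PT := @time_outcome d T R.

Let F_setT t : F t setT.
Proof. exact: (@measurableT _ (Ft t)). Qed.

Let rect_gen (C : set (R * T)) : predictable_rectangle F C -> measurable (C : set PT).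
Proof. exact: sub_gen_smallest. Qed.

Let rect_measurable (a : R) A : 0 <= a < 1 -> F a A -> measurable (`]a, 1%R]%classic `*` A : set PT).
Proof.
move=> /andP[a0 a1] FA; apply: rect_gen; right.
by exists a, 1, A; split.
Qed.

Let rect0_measurable A : F 0 A -> measurable ([set 0] `*` A : set PT).
Proof. by move=> FA; apply: rect_gen; left; exists A. Qed.

Let DE : D = ([set 0] `*` setT) `|` (`]0, 1%R]%classic `*` setT).
Proof.
apply/seteqP; split => -[t w]; rewrite /D /time_outcome /= !in_itv /=.
  move=> [/andP[t0 t1] _]; have [->|tn0] := eqVneq t 0; [by left|right; split => //].
  by rewrite lt_neqAle eq_sym tn0 t0.
by case=> -[]; [move=> -> _; rewrite lexx ler01|move=> /andP[/ltW -> ->]].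
Qed.

Lemma measurable_time_outcome : measurable D.
Proof.
rewrite DE; apply: measurableU; first exact: rect0_measurable.
by apply: rect_measurable => //; rewrite lexx ltr01.
Qed.

Definition predictable_fun (f : R * T -> R) := measurable_fun D (f : PT -> R).

(** [predictable_fun] refers to the sigma-algebra generated on the whole product, where the closure
    properties of measurable functions apply. Its trace on [time_outcome] lies in the sigma-algebra
    generated relative to [time_outcome], since all generating rectangles are contained in that
    set. *)
Lemma predictable_funP (X : R -> T -> R) : predictable_fun (fun p => X p.1 p.2) -> predictable F X.
Proof.
move=> mX _ [V mV <-].
have tr : <<s predictable_rectangle F>> `<=`
    [set A | <<s @time_outcome d T R, predictable_rectangle F>> (@time_outcome d T R `&` A)].
  have sD := @smallest_sigma_algebra _ (@time_outcome d T R) (predictable_rectangle F).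
  apply: smallest_sub.
    split => /=.
    - by rewrite setI0; case: sD.
    - move=> A hA; have -> : time_outcome `&` (setT `\` A) =
          @time_outcome d T R `\` (time_outcome `&` A).
        by rewrite setTD setDIr setDv set0U.
      by case: sD => _ + _; apply.
    - by move=> A hA; rewrite setI_bigcupr; case: sD => _ _; apply.
  move=> C hC /=; rewrite (_ : _ `&` C = C); first exact: sub_gen_smallest.
  apply/setIidPr => -[t w]; rewrite /time_outcome /= in_itv /=.
  case: hC => [[A _ ->]|[s [t' [A [s0 st t1 _ ->]]]]] /=.
    by move=> [-> _]; rewrite lexx ler01.
  by rewrite in_itv /= => -[/andP[st' tt'] _]; rewrite (le_trans tt') // ltW // (le_lt_trans s0).
have := mX measurable_time_outcome V mV => /tr /=.
by rewrite setIA setIid.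
Qed.

Lemma predictable_after a Z : 0 <= a < 1 -> known_at a Z ->
  predictable_fun (fun p => after a p.1 * Z p.2).
Proof.
move=> a01 kZ mD V mV; pose E : set PT := `]a, 1%R]%classic `*` setT.
have mE : measurable E by exact: rect_measurable.
have mZ : measurable (`]a, 1%R]%classic `*` (Z @^-1` V) : set PT).
  by apply: rect_measurable => //; exact: kZ.
(* Up to time [a] the function is 0, so the strip before [a] belongs to the preimage of [V] exactly
   when 0 is in [V]. *)
rewrite (_ : _ `&` _ = (`]a, 1%R]%classic `*` (Z @^-1` V)) `|`
    (if 0 \in V then D `\` E else set0)).
  by apply: measurableU => //; case: ifP => // _; exact: measurableD.
have Dt (t : R) (w : T) : D (t, w) <-> 0 <= t <= 1.
  by rewrite /D /time_outcome /= in_itv /=; split => [[]|].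
case/andP: a01 => a0 a1; apply/seteqP; split => -[t w].
  move=> [/[dup] Dtw /Dt /andP[t0 t1] /=]; rewrite /after; case: ltP => [at_|ta].
    by rewrite mul1r => Vz; left; split => //=; rewrite in_itv /= at_.
  rewrite mul0r => V0; right; rewrite mem_set //; split => //= -[].
  by rewrite /= in_itv /= ltNge ta.
case.
  rewrite /= in_itv /= => -[/andP[at_ t1] Vz]; split; first by apply/Dt; rewrite t1 (le_trans a0) ?ltW.
  by rewrite /= /after at_ mul1r.
case: ifP => // /set_mem V0 [Dtw nE]; split => //=.
rewrite /after; case: ltP => [at_|_]; last by rewrite mul0r.
by exfalso; apply: nE; split => //=; rewrite in_itv /= at_; case/Dt/andP: Dtw.
Qed.

Lemma predictable_known0 Z : known_at 0 Z -> predictable_fun (fun p => Z p.2).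
Proof.
move=> kZ mD V mV.
rewrite (_ : _ `&` _ = ([set 0] `*` (Z @^-1` V)) `|` (`]0, 1%R]%classic `*` (Z @^-1` V))).
  apply: measurableU; first by apply: rect0_measurable; exact: kZ.
  by apply: rect_measurable; [rewrite lexx ltr01|exact: kZ].
apply/seteqP; split => -[t w]; rewrite /D /time_outcome /= !in_itv /=.
  move=> [[/andP[t0 t1] _] Vz]; have [->|tn0] := eqVneq t 0; [by left|right; split => //].
  by rewrite lt_neqAle eq_sym tn0 t0.
by case=> -[]; [move=> -> ?; rewrite lexx ler01|move=> /andP[/ltW -> ->]].
Qed.

Lemma predictable_continuous (X : R -> T -> R) :
  (forall t, 0 <= t <= 1 -> known_at t (X t)) ->
  (forall w, {within `[0, 1], continuous (X ^~ w)}) ->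
  predictable_fun (fun p => X p.1 p.2).
Proof.
move=> kX cX; apply: (@measurable_at_time _ _ PT D fst (fun t p => X t p.2)).
- by move=> [t w]; rewrite /D /time_outcome /= in_itv /= => -[].
- by move=> [t w] _; exact: cX.
- by apply: predictable_known0; apply: kX; rewrite lexx ler01.
move=> a b /andP[a0 a1] /andP[b0 ba]; apply: predictable_after; first by rewrite ltW.
by apply: (known_at_mono ba); apply: kX; rewrite b0 (le_trans ba) ?ltW.
Qed.

End predictable_facts.

(** * The block strategy *)

Section strategy.
Context {R : realType}.
Implicit Types (J : R -> R) (t x : R) (s : seq (R * R)).
Variable m : nat -> nat.
Hypothesis m_gt0 : forall n, (0 < m n)%N.

Definition block_start n : R := 1 - 2^-1 ^+ n.
Definition block_length n : R := 2^-1 ^+ n.+1.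
Definition grid n i : R := block_start n + i%:R * (block_length n / (m n)%:R).

Lemma block_length_gt0 n : 0 < block_length n.
Proof. by rewrite exprn_gt0 // invr_gt0. Qed.

Lemma block_startS n : block_start n.+1 = block_start n + block_length n.
Proof. by rewrite /block_start /block_length exprS; field. Qed.

Lemma block_start_itv n : 0 <= block_start n < 1.
Proof.
have h : 0 < (2^-1 : R) ^+ n by rewrite exprn_gt0 // invr_gt0.
have h1 : (2^-1 : R) ^+ n <= 1 by rewrite exprn_ile1 // invf_le1 // ler1n.
by rewrite /block_start; apply/andP; split; lra.
Qed.

Let mesh_gt0 n : 0 < block_length n / (m n)%:R.
Proof. by rewrite divr_gt0 ?block_length_gt0 // ltr0n. Qed.

Lemma grid0 n : grid n 0 = block_start n.
Proof. by rewrite /grid mul0r addr0. Qed.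

Lemma grid_last n : grid n (m n) = block_start n.+1.
Proof.
rewrite /grid block_startS mulrC divfK // gt_eqF // ltr0n; exact: m_gt0.
Qed.

Lemma ltr_gridS n i : grid n i < grid n i.+1.
Proof. by rewrite ltrD2l ltr_pM2r // ltr_nat. Qed.

Lemma ler_grid n i j : (i <= j)%N -> grid n i <= grid n j.
Proof. by move=> ij; rewrite lerD2l ler_pM2r // ler_nat. Qed.

Lemma grid_itv n i : (i <= m n)%N -> 0 <= grid n i < 1.
Proof.
move=> im; have /andP[s0 _] := block_start_itv n; have /andP[_ s1] := block_start_itv n.+1.
rewrite (le_trans s0) -?grid0 ?ler_grid //=; apply: le_lt_trans s1.
by rewrite -grid_last ler_grid.
Qed.

Definition list_gain J s t : R := \sum_(k <- s) k.1 * (after k.2 t * (J t - J k.2)).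

(* With this weight, the gain of the block below is at least 1 as soon as the increment of
   [J] over the block is at least its length and the sum of squares is small. *)
Definition weight n : R := 2 / block_length n ^+ 2.

Definition coef J n x i : R := x * (2 * weight n * (J (grid n i) - J (block_start n))).

(** Each cell contributes two trades, one opening the position at its left end and one closing it at
    its right end; hence nothing is held once the block is over. *)
Definition block J n x : seq (R * R) :=
  flatten [seq [:: (coef J n x i, grid n i); (- coef J n x i, grid n i.+1)] | i <- iota 0 (m n)].

Lemma big_block J n x (f : R * R -> R) : \sum_(k <- block J n x) f k =
  \sum_(i < m n) (f (coef J n x i, grid n i) + f (- coef J n x i, grid n i.+1)).
Proof.
rewrite big_flatten big_map /=.
rewrite (_ : iota 0 (m n) = index_iota 0 (m n)) ?big_mkord; last by rewrite /index_iota subn0.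
by apply: eq_bigr => i _; rewrite !big_cons big_nil addr0.
Qed.

Lemma mem_block J n x k : k \in block J n x -> exists2 i, (i <= m n)%N & k.2 = grid n i.
Proof.
move=> /flatten_mapP[i]; rewrite mem_iota /= add0n => im.
by rewrite !inE => /orP[/eqP ->|/eqP ->]; [exists i => //; exact: ltnW|exists i.+1].
Qed.

Definition block_gain J n : R := weight n *
  ((J (block_start n.+1) - J (block_start n)) ^+ 2 -
   \sum_(i < m n) (J (grid n i.+1) - J (grid n i)) ^+ 2).

(** Summation by parts, from 2 a d = (a + d)^2 - a^2 - d^2 with a the increment so far and d the
    next one. *)
Lemma sum_increments_square (u : nat -> R) k :
  \sum_(i < k) 2 * (u i - u 0%N) * (u i.+1 - u i) =
  (u k - u 0%N) ^+ 2 - \sum_(i < k) (u i.+1 - u i) ^+ 2.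
Proof.
elim: k => [|k ih]; first by rewrite !big_ord0; ring.
by rewrite !big_ord_recr /= ih; ring.
Qed.

Lemma list_gain_block J n x t : block_start n.+1 <= t ->
  list_gain J (block J n x) t = x * block_gain J n.
Proof.
move=> st; rewrite /list_gain big_block.
transitivity (\sum_(i < m n) x * weight n * (2 * (J (grid n i) - J (grid n 0)) *
    (J (grid n i.+1) - J (grid n i)))).
  apply: eq_bigr => i _ /=; have it : grid n i.+1 <= t.
    by apply: le_trans st; rewrite -grid_last ler_grid.
  rewrite /after (lt_le_trans (ltr_gridS n i) it) /coef grid0.
  (* If [t] is the right end of the cell, the closing trade is not yet active, but its contribution
     at that instant would be zero anyway. *)
  have := it; rewrite le_eqVlt => /predU1P[->|->]; last by ring.
  by rewrite ltxx; ring.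
rewrite -mulr_sumr (sum_increments_square (fun i => J (grid n i))) /block_gain grid_last grid0.
by ring.
Qed.

Lemma block0 J n t : steps (block J n 0) t = 0 /\ list_gain J (block J n 0) t = 0.
Proof.
rewrite /steps /list_gain !big_block; split; rewrite big1 // => i _ /=.
  by rewrite /coef mul0r oppr0 !mul0r addr0.
by rewrite /coef mul0r oppr0 !mul0r addr0.
Qed.

Definition deficit x : R := Num.max 0 (1 - x).

Fixpoint wealth J n : R :=
  if n is n'.+1 then wealth J n' + deficit (wealth J n') * block_gain J n' else 0.

Fixpoint strategy J n : seq (R * R) :=
  if n is n'.+1 then strategy J n' ++ block J n' (deficit (wealth J n')) else [::].

Lemma mem_strategy J n k : k \in strategy J n ->
  exists l i, (i <= m l)%N /\ k.2 = grid l i.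
Proof.
elim: n => // n ih; rewrite mem_cat => /orP[/ih //|/mem_block[i im ->]].
by exists n, i.
Qed.

Lemma list_gain_strategy J n t : block_start n <= t -> list_gain J (strategy J n) t = wealth J n.
Proof.
elim: n => [|n ih] st; first by rewrite /list_gain big_nil.
rewrite /= /list_gain big_cat /= -!/(list_gain _ _ _) list_gain_block //.
rewrite ih // (le_trans _ st) // block_startS lerDl; exact/ltW/block_length_gt0.
Qed.

Lemma wealth_ge1 J k n : 1 <= block_gain J k -> (k < n)%N -> 1 <= wealth J n.
Proof.
move=> gk; elim: n => // n ih; rewrite ltnS leq_eqVlt => /predU1P[<-{n ih}|/ih w1] /=.
  rewrite /deficit; have [w1|w1] := leP 1 (wealth J k).
    by rewrite max_l ?subr_le0 // mul0r addr0.
  rewrite max_r; last by rewrite subr_ge0 ltW.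
  have : (1 - wealth J k) * 1 <= (1 - wealth J k) * block_gain J k.
    by rewrite ler_wpM2l // subr_ge0 ltW.
  by lra.
by rewrite /deficit max_l ?subr_le0 // mul0r addr0.
Qed.

Lemma strategy_eventually J k n t : 1 <= block_gain J k -> (k < n)%N ->
  steps (strategy J n) t = steps (strategy J k.+1) t /\
  list_gain J (strategy J n) t = list_gain J (strategy J k.+1) t.
Proof.
move=> gk; elim: n => // n ih; rewrite ltnS leq_eqVlt => /predU1P[<-//|kn].
have [ih1 ih2] := ih kn; have w1 := wealth_ge1 gk kn.
have d0 : deficit (wealth J n) = 0 by rewrite /deficit max_l // subr_le0.
have [b1 b2] := block0 J n t.
split; [rewrite -ih1|rewrite -ih2].
  by rewrite /= /steps big_cat /= -!/(steps _ _) d0 b1 addr0.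
by rewrite /= /list_gain big_cat /= -!/(list_gain _ _ _) d0 b2 addr0.
Qed.

(** Deciding at an early time whether some block will ever succeed would look into the future. The
    upper limit avoids this: it is predictable as a limit of predictable functions, agrees with a
    finite strategy once a block succeeds, and [fine] keeps it real on the remaining paths. *)
Definition final_steps J t : R := fine (limn_esup (fun n => (steps (strategy J n) t)%:E)).
Definition final_gain J t : R := fine (limn_esup (fun n => (list_gain J (strategy J n) t)%:E)).

Lemma limn_esup_eventually (u : nat -> R) k c : (forall n, (k < n)%N -> u n = c) ->
  fine (limn_esup (fun n => (u n)%:E)) = c.
Proof.
move=> h; have cu : (fun n => (u n)%:E) @ \oo --> c%:E.
  by apply: cvg_near_cst; exists k.+1 => // n /= kn; rewrite h.
rewrite is_cvg_limn_esupE; last by apply/cvg_ex; exists c%:E.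
by rewrite (cvg_lim _ cu).
Qed.

Lemma final_stepsE J k t : 1 <= block_gain J k -> final_steps J t = steps (strategy J k.+1) t.
Proof.
by move=> gk; apply: (@limn_esup_eventually _ k) => n kn; case: (strategy_eventually t gk kn).
Qed.

Lemma final_gainE J k t : 1 <= block_gain J k -> final_gain J t = list_gain J (strategy J k.+1) t.
Proof.
by move=> gk; apply: (@limn_esup_eventually _ k) => n kn; case: (strategy_eventually t gk kn).
Qed.

End strategy.

Section strategy_predictable.
Context {d : measure_display} {T : measurableType d} {R : realType}.
Variable G : R -> set (set T).
Hypothesis Gmono : forall s t, s <= t -> G s `<=` G t.
Variable m : nat -> nat.
Hypothesis m_gt0 : forall n, (0 < m n)%N.
Variable J : R -> T -> R.
Hypothesis kJ : forall t, 0 <= t <= 1 -> known_at G t (J t).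
Hypothesis cJ : forall w, {within `[0, 1], continuous (J ^~ w)}.

Let kJ' s t : 0 <= s <= t -> t < 1 -> known_at G t (J s).
Proof.
move=> /andP[s0 st] t1; apply: (known_at_mono Gmono st); apply: kJ.
by rewrite s0 (le_trans st) // ltW.
Qed.

Lemma wealth_known n : known_at G (block_start n) (fun w => wealth m (J ^~ w) n).
Proof.
elim: n => [|n ih].
  by apply/known_atP; exact: measurable_cst.
have s01 := block_start_itv (R := R) n; have s11 := block_start_itv (R := R) n.+1.
have nn : block_start (R := R) n <= block_start n.+1.
  by rewrite block_startS lerDl; exact/ltW/block_length_gt0.
have {}ih := (known_atP _ _ _).1 (known_at_mono Gmono nn ih).
have kg i : (i <= m n)%N -> known_at G (block_start n.+1) (J (grid m n i)).
  move=> im; apply: kJ'; last by case/andP: s11.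
  have /andP[-> _] := grid_itv (R := R) m_gt0 im.
  by rewrite -(grid_last m_gt0) ler_grid.
have kn : known_at G (block_start n.+1) (J (block_start n)) by rewrite -(grid0 m n); exact: (kg 0%N).
have kn1 : known_at G (block_start n.+1) (J (block_start n.+1)).
  by have := kg (m n) (leqnn _); rewrite (grid_last m_gt0).
apply/known_atP => /=; apply: measurable_funD => //; apply: measurable_funM.
  by apply: measurable_maxr => //; exact: measurable_funB.
apply: measurable_funM => //; apply: measurable_funB.
  by apply: measurable_funX; apply: measurable_funB; exact/known_atP.
apply: measurable_sum => i; apply: measurable_funX.
by apply: measurable_funB; apply/known_atP; apply: kg => //; exact: ltnW.
Qed.

(** Formulated at a later grid time as well, because the coefficient fixed at the i-th grid point is
    used again when the position is closed at the next one. *)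
Let coef_known n i j : (i <= j <= m n)%N ->
  known_at G (grid m n j) (fun w => coef m (J ^~ w) n (deficit (wealth m (J ^~ w) n)) i).
Proof.
move=> /andP[ij jm]; have im := leq_trans ij jm.
have g1 : grid (R := R) m n j < 1 by case/andP: (grid_itv (R := R) m_gt0 jm).
have ki : known_at G (grid m n j) (J (grid m n i)).
  by apply: kJ' => //; rewrite ler_grid // andbT; case/andP: (grid_itv (R := R) m_gt0 im).
have ks : known_at G (grid m n j) (J (block_start n)).
  apply: kJ' => //; rewrite -(grid0 m n) ler_grid // andbT grid0.
  by case/andP: (block_start_itv (R := R) n).
have kw : known_at G (grid m n j) (fun w => wealth m (J ^~ w) n).
  have sj : block_start (R := R) n <= grid m n j by rewrite -(grid0 m n) ler_grid.
  exact: (known_at_mono Gmono sj (@wealth_known n)).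
apply/known_atP; apply: measurable_funM.
  by apply: measurable_maxr => //; apply: measurable_funB => //; exact/known_atP.
by apply: measurable_funM => //; apply: measurable_funB; exact/known_atP.
Qed.

Let kM t Z Z' : known_at G t Z -> known_at G t Z' -> known_at G t (fun w => Z w * Z' w).
Proof.
by move=> /known_atP h /known_atP h'; apply/known_atP; exact: measurable_funM.
Qed.

Let grid01 n i : (i <= m n)%N -> 0 <= grid (R := R) m n i < 1.
Proof. exact: grid_itv. Qed.

Lemma predictable_steps n : predictable_fun G (fun p => steps (strategy m (J ^~ p.2) n) p.1).
Proof.
elim: n => [|n ih].
  rewrite (_ : (fun p => _) = cst 0); first exact: measurable_cst.
  by apply/funext => p; rewrite /steps big_nil.
rewrite (_ : (fun p => _) = fun p : R * T => steps (strategy m (J ^~ p.2) n) p.1 +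
    \sum_(i < m n) (after (grid m n i) p.1 * coef m (J ^~ p.2) n (deficit (wealth m (J ^~ p.2) n)) i -
      after (grid m n i.+1) p.1 * coef m (J ^~ p.2) n (deficit (wealth m (J ^~ p.2) n)) i)); last first.
  apply/funext => p; rewrite /= {1}/steps big_cat /= big_block; congr (_ + _).
  by apply: eq_bigr => i _ /=; ring.
apply: measurable_funD => //; apply: measurable_sum => i; apply: measurable_funB.
  apply: (@predictable_after _ _ _ G _ (fun w => coef m (J ^~ w) n (deficit (wealth m (J ^~ w) n)) i)).
    by apply: grid01; exact: ltnW.
  by apply: coef_known; rewrite leqnn ltnW.
apply: (@predictable_after _ _ _ G _ (fun w => coef m (J ^~ w) n (deficit (wealth m (J ^~ w) n)) i)).
  exact: grid01.
by apply: coef_known; rewrite leqnSn ltn_ord.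
Qed.

Lemma predictable_gain n :
  predictable_fun G (fun p => list_gain (J ^~ p.2) (strategy m (J ^~ p.2) n) p.1).
Proof.
have pJ := predictable_continuous Gmono kJ cJ.
elim: n => [|n ih].
  rewrite (_ : (fun p => _) = cst 0); first exact: measurable_cst.
  by apply/funext => p; rewrite /list_gain big_nil.
pose c i w := coef m (J ^~ w) n (deficit (wealth m (J ^~ w) n)) i.
(* Expanding the gain isolates the current value of [J], predictable by continuity; all other
   factors are indicators times variables known when the indicator switches on. *)
rewrite (_ : (fun p => _) = fun p : R * T =>
  list_gain (J ^~ p.2) (strategy m (J ^~ p.2) n) p.1 + \sum_(i < m n)
   ((after (grid m n i) p.1 * c i p.2 * J p.1 p.2 -
     after (grid m n i) p.1 * (c i p.2 * J (grid m n i) p.2)) -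
    (after (grid m n i.+1) p.1 * c i p.2 * J p.1 p.2 -
     after (grid m n i.+1) p.1 * (c i p.2 * J (grid m n i.+1) p.2)))); last first.
  apply/funext => p; rewrite /= {1}/list_gain big_cat /= big_block; congr (_ + _).
  by apply: eq_bigr => i _ /=; rewrite /c; ring.
have piece (i : 'I_(m n)) (j : nat) : (i <= j <= m n)%N -> predictable_fun G (fun p =>
    after (grid m n j) p.1 * c i p.2 * J p.1 p.2 -
    after (grid m n j) p.1 * (c i p.2 * J (grid m n j) p.2)).
  move=> ij; have jm : (j <= m n)%N by case/andP: ij.
  have k1 : known_at G (grid m n j) (c i) by exact: coef_known.
  have /andP[g0 g1] := grid01 jm.
  have k2 : known_at G (grid m n j) (J (grid m n j)) by apply: kJ; rewrite g0 ltW.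
  apply: measurable_funB; last first.
    exact: (@predictable_after _ _ _ G _ (fun w => c i w * J (grid m n j) w) (grid01 jm) (kM k1 k2)).
  by apply: measurable_funM pJ; exact: (predictable_after (grid01 jm) k1).
apply: measurable_funD => //; apply: measurable_sum => i; apply: measurable_funB.
  by apply: piece; rewrite leqnn ltnW.
by apply: piece; rewrite leqnSn ltn_ord.
Qed.

Let predictable_limit (X : nat -> R * T -> R) : (forall n, predictable_fun G (X n)) ->
  predictable_fun G (fun p => fine (limn_esup (fun n => (X n p)%:E))).
Proof.
move=> pX; apply: (measurableT_comp (@fine_measurable R setT measurableT)).
by apply: measurable_fun_limn_esup => n; apply/measurable_EFinP; exact: pX.
Qed.

Lemma predictable_final_steps : predictable_fun G (fun p => final_steps m (J ^~ p.2) p.1).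
Proof. by apply: predictable_limit => n; exact: predictable_steps. Qed.

Lemma predictable_final_gain : predictable_fun G (fun p => final_gain m (J ^~ p.2) p.1).
Proof. by apply: predictable_limit => n; exact: predictable_gain. Qed.

End strategy_predictable.

(** * Almost surely some block succeeds *)

Section fine_mesh.
Context {R : realType}.

Lemma fine_mesh (H del eta eps c : R) : 2^-1 < H -> 0 < del -> 0 < eta -> 0 < eps ->
  exists m : nat, [/\ (0 < m)%N, c <= m%:R & m%:R * (del / m%:R) `^ (2 * H) / eta <= eps].
Proof.
move=> Hh del0 eta0 eps0; pose p := 2 * H - 1; have p0 : 0 < p by rewrite /p; lra.
pose X := del `^ (2 * H) / (eta * eps).
have X0 : 0 < X by rewrite divr_gt0 ?powR_gt0 // mulr_gt0.
pose Y := Num.max c (X `^ p^-1).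
pose m := (Num.trunc Y).+1; have Ym : Y < m%:R by exact: truncnS_gt.
have m0 : 0 < m%:R :> R by rewrite ltr0n.
exists m; split => //; first by apply: le_trans (ltW Ym); rewrite /Y le_max lexx.
have Xm : X <= m%:R `^ p.
  have -> : X = (X `^ p^-1) `^ p by rewrite -powRrM mulVf ?gt_eqF // powRr1 // ltW.
  rewrite ge0_ler_powR ?nnegrE ?powR_ge0 ?ltW //.
  by apply: le_lt_trans Ym; rewrite /Y le_max lexx orbT.
have E : m%:R * (del / m%:R) `^ (2 * H) / eta = X * eps / m%:R `^ p.
  rewrite powRM ?ltW // ?invr_gt0 // -powR_inv1 ?ltW // -powRrM mulN1r powRN.
  have -> : m%:R `^ (2 * H) = m%:R * m%:R `^ p.
    by rewrite -{2}(powRr1 (ltW m0)) -powRDp // /p; congr (_ `^ _); ring.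
  have mp0 : m%:R `^ p != 0 by rewrite gt_eqF // powR_gt0.
  by rewrite /X; field; rewrite mp0 !gt_eqF.
rewrite E ler_pdivrMr ?powR_gt0 // mulrC ler_wpM2l // ltW //.
Qed.

End fine_mesh.

Section block_gain_lower_bound.
Context {R : realType}.
Variables (m : nat -> nat) (n : nat) (mu sigma K : R) (g A : R -> R).
Hypothesis m_gt0 : forall n, (0 < m n)%N.
Hypothesis sigma0 : sigma != 0.
Hypothesis AK : forall s t, 0 <= s -> s <= t -> t <= 1 -> `|A t - A s| <= K * (t - s).
Let L := `|mu| + K.
Hypothesis mL : 8 * L ^+ 2 <= (m n)%:R.
Local Notation J := (discounted_log mu sigma g A).
Local Notation del := (block_length n).

Let drift_le s t : 0 <= s -> s <= t -> t <= 1 -> `|mu * (t - s) - (A t - A s)| <= L * (t - s).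
Proof.
move=> s0 st t1; apply: (le_trans (ler_normB _ _)); rewrite /L mulrDl lerD ?AK //.
by rewrite normrM [`|t - s|]ger0_norm ?subr_ge0.
Qed.

Let JE s t : J t - J s = sigma * (g t - g s) + (mu * (t - s) - (A t - A s)).
Proof. by rewrite /discounted_log; ring. Qed.

(** A deterministic dichotomy. If the increment of [J] is below [del], subtracting the drift, at
    most L del, bounds that of [g]. Otherwise its square is at least del^2, so failure forces the
    sum of squares of [J] above del^2 / 2. The drift accounts for at most 2 L^2 del^2 / m <= del^2 /
    4 of it by [mL], and the remaining del^2 / 4 is at most 2 sigma^2 times the sum of squares of
    [g]. *)
Lemma block_gain_lt1 : block_gain m J n < 1 ->
  `|g (block_start n.+1) - g (block_start n)| <= (1 + L) / `|sigma| * del \/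
  del ^+ 2 / (8 * sigma ^+ 2) <= \sum_(i < m n) (g (grid m n i.+1) - g (grid m n i)) ^+ 2.
Proof.
have del0 : 0 < del :> R by exact: block_length_gt0.
have sg0 : 0 < `|sigma| by rewrite normr_gt0.
have s20 : 0 < sigma ^+ 2 by rewrite exprn_even_gt0.
have d20 : 0 < del ^+ 2 :> R by rewrite exprn_gt0.
have m0 : 0 < (m n)%:R :> R by rewrite ltr0n.
have /andP[s0 _] := block_start_itv (R := R) n.
have /andP[_ /ltW s1] := block_start_itv (R := R) n.+1.
have ss : block_start (R := R) n <= block_start n.+1 by rewrite block_startS lerDl ltW.
rewrite /block_gain /weight; set X := (J (block_start n.+1) - _) ^+ 2; set S := \sum_(i < m n) _.
move=> gain; have {}gain : X - S < del ^+ 2 / 2.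
  by move: gain; rewrite -ltr_pdivlMl ?divr_gt0 // invf_div mulr1.
have [Jd|dJ] := ltP `|J (block_start n.+1) - J (block_start n)| del.
  left; rewrite mulrAC ler_pdivlMr // mulrC -normrM.
  have -> : sigma * (g (block_start n.+1) - g (block_start n)) =
      (J (block_start n.+1) - J (block_start n)) -
      (mu * (block_start n.+1 - block_start n) - (A (block_start n.+1) - A (block_start n))).
    by rewrite JE; ring.
  apply: (le_trans (ler_normB _ _)); rewrite mulrDl mul1r; apply: lerD; first exact: ltW.
  apply: (le_trans (drift_le s0 ss s1)).
  by rewrite block_startS [_ + del]addrC addrK.
right; set Q := \sum_(i < m n) _.
have X2 : del ^+ 2 <= X.
  by rewrite /X -[leRHS]real_normK ?num_real // ler_pXn2r ?nnegrE // ltW.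
pose h := del / (m n)%:R : R.
have SQ : S <= 2 * sigma ^+ 2 * Q + (m n)%:R * (2 * (L * h) ^+ 2).
  have -> : (m n)%:R * (2 * (L * h) ^+ 2) = \sum_(i < m n) 2 * (L * h) ^+ 2.
    by rewrite sumr_const card_ord mulr_natl.
  rewrite /Q mulr_sumr -big_split /=; apply: ler_sum => i _; rewrite JE.
  have /andP[g0 _] := grid_itv (R := R) m_gt0 (ltnW (ltn_ord i)).
  have /andP[_ /ltW g1] := grid_itv (R := R) m_gt0 (ltn_ord i).
  have gg : grid m n i.+1 - grid m n i = h by rewrite /grid -natr1 /h; ring.
  have := drift_le g0 (ltW (ltr_gridS m_gt0 n i)) g1; rewrite gg.
  set D := mu * h - _ => hD; set y := g _ - g _.
  have D2 : D ^+ 2 <= (L * h) ^+ 2.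
    rewrite -[leLHS]real_normK ?num_real // ler_pXn2r ?nnegrE //.
    exact: le_trans hD.
  apply: (@le_trans _ _ (2 * (sigma * y) ^+ 2 + 2 * D ^+ 2)); last first.
    by rewrite exprMn mulrA lerD2l ler_wpM2l.
  have -> : 2 * (sigma * y) ^+ 2 + 2 * D ^+ 2 = (sigma * y + D) ^+ 2 + (sigma * y - D) ^+ 2 by ring.
  by rewrite lerDl sqr_ge0.
have Lh : (m n)%:R * (2 * (L * h) ^+ 2) <= del ^+ 2 / 4.
  have -> : (m n)%:R * (2 * (L * h) ^+ 2) = 2 * L ^+ 2 * del ^+ 2 / (m n)%:R.
    by rewrite /h; field; rewrite gt_eqF.
  rewrite ler_pdivrMr //; have := ler_wpM2l (ltW d20) mL; lra.
have c0 : 0 < 8 * sigma ^+ 2 by rewrite mulr_gt0.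
rewrite (ler_pdivrMr _ _ c0); have -> : Q * (8 * sigma ^+ 2) = 4 * (2 * sigma ^+ 2 * Q) by ring.
move: SQ Lh; move: (2 * sigma ^+ 2 * Q) (_ * (2 * _)) => E1 E2 SQ Lh; lra.
Qed.

End block_gain_lower_bound.

Section some_block_succeeds.
Context {d : measure_display} {T : measurableType d} {R : realType}.
Variables (P : probability T R) (H : R) (BH : R -> T -> R).
Hypotheses (H01 : 2^-1 < H < 1) (fbm : fractional_brownian_motion H P BH).
Variables (mu sigma K : R) (A : R -> T -> R).
Hypothesis sigma0 : sigma != 0.
Hypothesis K0 : 0 <= K.
Hypothesis AK : forall w s t, 0 <= s -> s <= t -> t <= 1 -> `|A t w - A s w| <= K * (t - s).

Let L := `|mu| + K.
Let eta n : R := block_length n ^+ 2 / (8 * sigma ^+ 2).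

Let fine_meshes : exists m : nat -> nat, forall n, [/\ (0 < m n)%N, 8 * L ^+ 2 <= (m n)%:R &
  (m n)%:R * (block_length n / (m n)%:R) `^ (2 * H) / eta n <= block_length n `^ (1 - H)].
Proof.
have [H1 H2] := andP H01.
have h n : exists k : nat, [/\ (0 < k)%N, 8 * L ^+ 2 <= k%:R &
    k%:R * (block_length n / k%:R) `^ (2 * H) / eta n <= block_length n `^ (1 - H)].
  have b0 := block_length_gt0 (R := R) n.
  apply: fine_mesh => //; last exact: powR_gt0.
  by rewrite divr_gt0 ?exprn_gt0 // mulr_gt0 // exprn_even_gt0.
by exists (fun n => sval (cid (h n))) => n; case: cid.
Qed.

(** A path on which every block fails lies, for every n, in one of the two exceptional sets of
    [block_gain_lt1]. The probability of their union tends to 0 geometrically, so the intersection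
    over n is a null set. *)
Lemma ae_block_gain : exists m : nat -> nat, (forall n, (0 < m n)%N) /\
  {ae P, forall w, exists n,
    1 <= block_gain m (discounted_log mu sigma (BH ^~ w) (A ^~ w)) n}.
Proof.
have [m hm] := fine_meshes; exists m.
have m0 n : (0 < m n)%N by case: (hm n).
have [H1 H2] := andP H01; split => //.
pose C1 := (1 + L) / `|sigma|.
have C10 : 0 <= C1 by rewrite divr_ge0 // addr_ge0 // addr_ge0.
pose E1 n := [set w | `|BH (block_start n.+1) w - BH (block_start n) w| <= C1 * block_length n].
pose E2 n := [set w | eta n <=
  \sum_(i < m n) (BH (grid m n i.+1) w - BH (grid m n i) w) ^+ 2].
have del0 n := block_length_gt0 (R := R) n.
have eta0 n : 0 < eta n by rewrite divr_gt0 ?exprn_gt0 // mulr_gt0 // exprn_even_gt0.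
have bs01 n : 0 <= block_start (R := R) n <= 1.
  by have /andP[-> /ltW] := block_start_itv (R := R) n.
have gr01 n i : (i <= m n)%N -> 0 <= grid (R := R) m n i <= 1.
  by move=> im; have /andP[-> /ltW] := grid_itv (R := R) m0 im.
have mE1 n : measurable (E1 n).
  rewrite (_ : E1 n = setT `&` (fun w => `|BH (block_start n.+1) w - BH (block_start n) w|) @^-1`
      `]-oo, C1 * block_length n]%classic).
    have mB : measurable_fun setT (fun w => `|BH (block_start n.+1) w - BH (block_start n) w|).
      by apply: measurableT_comp => //; exact: (measurable_fbm_increment fbm).
    exact: mB.
  by rewrite setTI; apply/seteqP; split => w /=; rewrite in_itv.
have mE2 n : measurable (E2 n).
  rewrite (_ : E2 n = setT `&` (fun w => \sum_(i < m n) (BH (grid m n i.+1) w - BH (grid m n i) w) ^+ 2) @^-1`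
      `[eta n, +oo[%classic).
    have mB : measurable_fun setT (fun w => \sum_(i < m n) (BH (grid m n i.+1) w - BH (grid m n i) w) ^+ 2).
      apply: measurable_sum => i; apply: measurable_funX.
      by apply: (measurable_fbm_increment fbm); apply: gr01 => //; exact: ltnW.
    exact: mB.
  by rewrite setTI; apply/seteqP; split => w /=; rewrite in_itv /= andbT.
(* The small ball bound for the radius C1 del and the standard deviation del^H gives 6 C1 del^(1 -
   H); the mesh was chosen so that the second set costs at most del^(1 - H). *)
have PE n : (P (E1 n `|` E2 n) <= ((6 * C1 + 1) * block_length n `^ (1 - H))%:E)%E.
  apply: (le_trans (measureU2 _ (mE1 n) (mE2 n))); rewrite mulrDl mul1r EFinD; apply: leeD.
    have lt : block_start (R := R) n < block_start n.+1 by rewrite block_startS ltrDl.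
    apply: (le_trans (fbm_small_ball H01 fbm (bs01 n) (bs01 n.+1) lt _)).
      by rewrite mulr_ge0 // ltW.
    rewrite block_startS [_ + block_length n]addrC addrK lee_fin powRDp // (powRr1 (ltW (del0 n))).
    by rewrite powRN le_eqVlt; apply/orP; left; apply/eqP; ring.
  have [_ _] := hm n; rewrite -lee_fin; apply: le_trans.
  apply: (fbm_quadratic_sum H01 fbm) => //.
  - by case/andP: (bs01 n).
  - by rewrite divr_gt0 // ltr0n.
  - have := grid_last (R := R) m0 n; rewrite /grid => ->; by case/andP: (bs01 n.+1).
pose N := \bigcap_n (E1 n `|` E2 n).
have mN : measurable N by apply: bigcapT_measurable => n; exact: measurableU.
exists N; split => //.
  apply/eqP; rewrite eq_le measure_ge0 andbT.
  pose q : R := 2^-1 `^ (1 - H).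
  have q01 : 0 <= q < 1.
    rewrite powR_ge0 /= /q -[ltRHS](@powRr0 _ (2^-1)).
    by rewrite /powR gt_eqF ?invr_gt0 // ltr_expR mul0r nmulr_llt0 ?ln_lt0 ?subr_gt0 //; lra.
  have qE n : block_length n `^ (1 - H) = q ^+ n.+1.
    rewrite /block_length -[2^-1 ^+ n.+1]powR_mulrn ?invr_ge0 // powRAC powR_mulrn ?powR_ge0 //.
  have cv : (fun n => ((6 * C1 + 1) * q ^+ n.+1)%:E) @ \oo --> (0 : R)%:E.
    apply: cvg_EFin; first exact: nearW.
    rewrite -[X in _ --> X](mulr0 (6 * C1 + 1)); apply: cvgMr.
    rewrite (cvg_shiftS (fun n => q ^+ n)); apply: cvg_expr.
    by case/andP: q01 => q0 q1; rewrite ger0_norm.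
  apply: (@le_trans _ _ (limn (fun n => ((6 * C1 + 1) * q ^+ n.+1)%:E))); last by rewrite (cvg_lim _ cv).
  apply: lime_ge; first by apply/cvg_ex; exists 0%E.
  apply: nearW => n; rewrite -qE; apply: le_trans (PE n).
  apply: le_measure; rewrite ?inE //; first exact: measurableU.
  by move=> w; apply.
move=> w /= nw n _; apply: contrapT => nE; apply: nw; exists n.
rewrite leNgt; apply/negP => lt1; apply: nE.
have [_ mL _] := hm n.
by case: (block_gain_lt1 m0 sigma0 (AK w) mL lt1); [left|right].
Qed.

End some_block_succeeds.

(** * The arbitrage portfolio in bonds and shares *)

Theorem theorem4p1 (R : realType) (d : measure_display) (T : measurableType d)
  (P : probability T R) (Pcomplete : measure_is_complete P)
  (H : R) (H_range : 2^-1 < H < 1)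
  (BH : R -> T -> R) (BH_fbm : fractional_brownian_motion H P BH)
  (S0 mu sigma : R) (S0_gt0 : 0 < S0) (sigma_neq0 : sigma != 0)
  (r : R -> T -> R) (r_measurable : measurable_process r)
  (r_bounded : exists K : R, forall (t : R) (w : T), 0 <= t <= 1 -> `|r t w| <= K) :
  let B := bond r in
  let S := stock S0 mu sigma BH in
  let F := completed_filtration P B S in
  exists pi0 pi1 : R -> T -> R,
    [/\ predictable F pi0, predictable F pi1,
        self_financing P H S0 mu sigma BH r pi0 pi1 &
        let V := portfolio_value B S pi0 pi1 in
        exists2 c : R, 0 < c & {ae P, forall w, V 0 w = 0 /\ c <= V 1 w}].
Proof.
move=> B S F; have [K rK] := r_bounded; have [H1 H2] := andP H_range.
have r01 : 0 <= (0 : R) <= 1 by rewrite lexx ler01.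
have r11 : 0 <= (1 : R) <= 1 by rewrite ler01 lexx.
have K0 : 0 <= K by apply: le_trans (rK 0 point r01); exact: normr_ge0.
have S00 : S0 != 0 by rewrite gt_eqF.
pose A t w := \int[leb]_(s in `[0, t]) r s w.
have mr w : measurable_fun (`[0, 1]%classic : set R) (r ^~ w).
  have mh : measurable_fun (`[0, 1]%classic : set R) (fun t : R => (t, w)).
    by apply: measurable_funTS; exact: measurable_fun_pair.
  apply: (measurable_comp _ _ r_measurable mh).
    by apply: measurableX.
  by move=> _ [t t01 <-]; split.
have rKw w t : 0 <= t <= 1 -> `|r t w| <= K by exact: rK.
have AE w t : 0 <= t <= 1 -> A t w = rate_int (r ^~ w) t by exact: (rate_intE (mr w) (rKw w)).
have dA w := rate_int_density (mr w) (rKw w).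
have mre w := measurable_rate_ext (mr w).
have reK w := rate_ext_le (rKw w).
have AK w s t : 0 <= s -> s <= t -> t <= 1 -> `|A t w - A s w| <= K * (t - s).
  move=> s0 st t1; have t01 : 0 <= t <= 1 by rewrite (le_trans s0 st) t1.
  have s01 : 0 <= s <= 1 by rewrite s0 (le_trans st t1).
  rewrite (AE _ _ t01) (AE _ _ s01).
  exact: (lipschitz_of_density (mre w) (reK w) (dA w) st).
have cA w : continuous (rate_int (r ^~ w)) := density_continuous (mre w) (reK w) (dA w).
pose J t w := discounted_log mu sigma (BH ^~ w) (A ^~ w) t.
have cJ w : {within `[0, 1], continuous (J ^~ w)}.
  apply: (@subspace_eq_continuous _ _ _
      (fun t => mu * t + sigma * (BH ^~ w \o clamp) t - rate_int (r ^~ w) t)).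
    move=> t /set_mem /=; rewrite in_itv /= => t01.
    by rewrite /from_subspace /= clamp_id // -(AE w t t01).
  apply: continuous_subspaceT => t; apply: cvgB; last exact: cA.
  have cB : continuous (BH ^~ w \o clamp) := clamp_continuous (@fbm_continuous _ _ _ _ _ _ BH_fbm w).
  by apply: cvgD; apply: cvgMr; [exact: cvg_id|exact: cB].
pose G t := [set C | exists (u : R) (V : set R), [/\ 0 <= u <= t, measurable V &
  C = B u @^-1` V \/ C = S u @^-1` V]] `|` P.-negligible.
have Gmono s t : s <= t -> G s `<=` G t.
  move=> st C [[u [V [/andP[u0 us] mV CE]]]|nC]; [left|by right].
  by exists u, V; split => //; rewrite u0 (le_trans us).
have kJ t : 0 <= t <= 1 -> known_at G t (J t).
  move=> /andP[t0 t1].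
  have kB : known_at G t (B t).
    move=> V mV; apply: sub_gen_smallest; left; exists t, V; split => //; last by left.
    by rewrite t0 lexx.
  have kS : known_at G t (S t).
    move=> V mV; apply: sub_gen_smallest; left; exists t, V; split => //; last by right.
    by rewrite t0 lexx.
  (* The filtration is generated by the prices, so [J] has to be recovered from them: it is ln(S /
     S0) - ln B. *)
  have -> : J t = fun w => ln (S0^-1 * S t w) - ln (B t w).
    apply/funext => w; rewrite /S /stock mulKf // expRK /B /bond expRK.
    by rewrite /J /discounted_log.
  apply/known_atP; apply: measurable_funB.
    apply: (measurableT_comp (@measurable_ln R)); apply: measurable_funM => //.
    exact/known_atP.
  by apply: (measurableT_comp (@measurable_ln R)); exact/known_atP.
have [m [m0 gain_ae]] := ae_block_gain H_range BH_fbm mu sigma_neq0 K0 AK.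
pose xi t w := final_steps m (J ^~ w) t; pose D t w := final_gain m (J ^~ w) t.
(* Here exp(- J) / S0 equals B / S; written through [J], its predictability follows from that of
   [J]. With [D] the discounted value and [xi] its part held in shares, [D - xi] is the number of
   bonds. *)
pose pi1 t w := xi t w * (expR (- J t w) / S0); pose pi0 t w := D t w - xi t w.
have pJ := predictable_continuous Gmono kJ cJ.
have pxi := predictable_final_steps Gmono m0 kJ.
have pD := predictable_final_gain Gmono m0 kJ cJ.
have pi1E t w : pi1 t w = xi t w * B t w / S t w.
  rewrite /pi1 /B /S /bond /stock -/(A t w) -mulrA; congr (_ * _).
  have -> : - J t w = A t w + - (mu * t + sigma * BH t w) by rewrite /J /discounted_log; ring.
  by rewrite expRD expRN invfM; ring.
have SN0 t w : S t w != 0 by rewrite mulf_neq0 // gt_eqF // expR_gt0.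
have VE t w : portfolio_value B S pi0 pi1 t w = D t w * B t w.
  by rewrite /portfolio_value pi1E divfK // /pi0; ring.
exists pi0, pi1; split.
- by apply: predictable_funP; exact: measurable_funB.
- apply: predictable_funP; apply: measurable_funM; first exact: pxi.
  apply: measurable_funM => //; apply: measurable_expR_comp.
  exact: (measurableT_comp _ pJ).
- pose al : R := (1 - H + 2^-1) / 2.
  have al01 : 0 < al < 1 by rewrite /al; apply/andP; split; lra.
  exists al; first by rewrite /al; apply/andP; split; lra.
  have fin_ae a : 0 <= a < 1 -> {ae P, forall w, marchaud_finite al (BH ^~ w) a 1}.
    by move=> a01; apply: (ae_fbm_marchaud_finite H_range BH_fbm) => //; rewrite /al; lra.
  have fin0 : {ae P, forall w, marchaud_finite al (BH ^~ w) 0 1}.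
    by apply: fin_ae; rewrite lexx ltr01.
  (* The grid times are deterministic and countably many, so a single null set serves all of them,
     whichever trades a path makes. *)
  have fing : {ae P, forall w, forall n i, (i <= m n)%N ->
      marchaud_finite al (BH ^~ w) (grid m n i) 1}.
    apply: ae_foralln => n; apply: ae_foralln => i.
    have [im|mi] := leqP i (m n); last by apply: aeW => w.
    by apply: filterS (fin_ae _ (grid_itv (R := R) m0 im)).
  (* On such a path block [n] succeeds, so the portfolio coincides on all of [0, 1] with the finite
     strategy of the first [n.+1] blocks, to which the pathwise lemma applies. *)
  apply: filterS3 fin0 fing gain_ae => w fin0 fing [n gn] t t01.
  apply: (pathwise_self_financing (S0 := S0) (g := BH ^~ w) (rho := r ^~ w)
    (pi0 := pi0 ^~ w) (pi1 := pi1 ^~ w) (s := strategy m (J ^~ w) n.+1)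
    al01 S00 (@fbm_continuous _ _ _ _ _ _ BH_fbm w) (mr w) (rKw w) fin0) t01.
  - move=> k /mem_strategy[l [i [il ->]]]; split; first exact: grid_itv.
    exact: fing.
  - by move=> u _; rewrite pi1E /xi (final_stepsE u gn).
  - by move=> u _; rewrite /pi0 /D /xi (final_stepsE u gn) (final_gainE u gn).
exists (expR (- K)); first exact: expR_gt0.
apply: filterS gain_ae => w [n gn]; have gn' := gn.
split.
  rewrite VE /D (final_gainE 0 gn) /list_gain big_seq big1 ?mul0r // => k /mem_strategy[l [i [il ->]]].
  have /andP[g0 _] := grid_itv (R := R) m0 il.
  by rewrite /after ltNge g0 /= mul0r mulr0.
rewrite VE /D (final_gainE 1 gn) list_gain_strategy //; last first.
  by have /andP[_ /ltW] := block_start_itv (R := R) n.+1.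
have w1 := wealth_ge1 gn (ltnSn n).
apply: (@le_trans _ _ (B 1 w)); last by rewrite ler_peMl // expR_ge0.
rewrite /B /bond ler_expR -/(A 1 w).
have := AK w 0 1 (lexx 0) ler01 (lexx 1); rewrite subr0 mulr1.
have -> : A 0 w = 0.
  by rewrite AE // /rate_int set_itvoo0 Rintegral_set0.
by rewrite subr0 ler_norml => /andP[].
Qed.
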